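(* Let $G$ be a countable amenable group acting freely by homeomorphisms on a compact, metrizable, zero-dimensional space $X$. Then there exist a compact, metrizable, zero-dimensional space $Y$ and a minimal action of $G$ on $Y$ by homeomorphisms such that the dynamical systems $(X,G)$ and $(Y,G)$ are Borel$^*$ isomorphic.
   Context: A countable group $G$ is amenable if there is a sequence of finite (nonempty) sets $F_n\subset G$ (a Følner sequence) such that $\lim_{n\to\infty}\frac{|gF_n\bigtriangleup F_n|}{|F_n|}=0$ for every $g\in G$. An action of $G$ on $X$ is a homomorphism from $G$ to the group of homeomorphisms of $X$; the image of $x$ under the homeomorphism corresponding to $g$ is written $gx$. The action is free if $gx=x$ for some $g\in G$, $x\in X$ implies that $g$ is the neutral element. The action is minimal if for every point the closure of its orbit $\{gx:g\in G\}$ is the whole space. $\mathcal P_G(X)$ denotes the set of all $G$-invariant Borel probability measures on $X$ (i.e. $\mu(gA)=\mu(A)$ for all $g\in G$ and Borel $A$), endowed with the weak* topology. A set $E\subset X$ is full if $\mu(E)=1$ for every $\mu\in\mathcal P_G(X)$. Two dynamical systems $(X,G)$ and $(Y,G)$ with the same acting group $G$ are Borel$^*$ isomorphic if there exists an equivariant (i.e. commuting with the actions of $G$) Borel-measurable bijection $\Phi:\tilde X\to\tilde Y$ between full invariant subsets $\tilde X\subset X$ and $\tilde Y\subset Y$ such that the conjugate map $\Phi^*:\mathcal P_G(X)\to\mathcal P_G(Y)$, $\Phi^*(\mu)=\mu\circ\Phi^{-1}$, is an (affine) homeomorphism with respect to the weak* topologies.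
   Formalization: The group G is assumed to be infinite and the space X nonempty: for finite G the claim fails (the trivial group acting on two points), and it holds for finite G only if X is a single orbit, hence already minimal. *)

(* Defs.v *)
From HB Require Import structures.
From mathcomp Require Import all_boot all_order all_algebra finmap.
From mathcomp Require Import all_classical all_reals all_analysis.

Set Implicit Arguments.
Unset Strict Implicit.
Unset Printing Implicit Defensive.

Import Order.TTheory GRing.Theory Num.Theory.
Import numFieldNormedType.Exports.

Local Open Scope classical_set_scope.
Local Open Scope ring_scope.

Definition homeomorphism (S T : topologicalType) (f : S -> T) : Prop :=
  continuous f /\
  exists g : T -> S, [/\ continuous g, cancel f g & cancel g f].

Definition metrizable (R : realType) (T : topologicalType) : Prop :=
  exists (M : metricType R) (f : T -> M), homeomorphism f.

(* [zero_dimensional] asks that distinct points be separated by clopen sets;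
   on the compact Hausdorff spaces considered here this is the usual
   requirement that the clopen sets form a base. *)
Lemma zero_dimensional_clopen_base (T : topologicalType) :
  hausdorff_space T -> compact [set: T] ->
  zero_dimensional T <->
  (forall (x : T) (U : set T), nbhs x U ->
     exists V : set T, [/\ clopen V, V x & V `<=` U]).
Proof.
move=> hT cT; split=> [zT x U Ux|bT x y xy].
  have := @zero_dimensional_cvg T x hT zT cT => /(_ _ Ux) [V [/= Vx cV] VU].
  by exists V.
have yx : nbhs x (~` [set y]).
  apply: open_nbhs_nbhs; split; last exact/eqP.
  by rewrite openC; exact: (accessible_closed_set1 (hausdorff_accessible hT)).
have [V [cV Vx Vy]] := bT _ _ yx.
by exists V; split => // /Vy; exact.
Qed.

Definition amenable (R : realType) (G : groupType) : Prop :=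
  exists F : nat -> {fset G},
    (forall n, F n != fset0) /\
    (forall g : G,
       let gF n := [fset (g * x)%g | x in F n]%fset in
       (fun n => (#|` ((gF n `\` F n) `|` (F n `\` gF n))%fset |)%:R
                 / (#|` F n |)%:R : R) @ \oo --> (0 : R)).

Section actions.
Context (G : groupType).

Definition is_action (T : topologicalType) (a : G -> T -> T) : Prop :=
  [/\ forall g, homeomorphism (a g),
      forall x, a 1%g x = x &
      forall g h x, a (g * h)%g x = a g (a h x)].

Definition free_action (T : Type) (a : G -> T -> T) : Prop :=
  forall g x, a g x = x -> g = 1%g.

Definition minimal_action (T : topologicalType) (a : G -> T -> T) : Prop :=
  forall x, closure [set a g x | g in [set: G]] = [set: T].

Definition invariant_set (T : Type) (a : G -> T -> T) (E : set T) : Prop :=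
  forall g, a g @` E = E.

End actions.

Notation borel T := (g_sigma_algebraType (@open T)).

Section measures.
Context (R : realType) (T : ptopologicalType).

Definition integrals (mu : probability (borel T) R) :
    {ptws continuousType T R -> R} :=
  fun f => \int[mu]_x f x.

(* Coarsest topology making every mu |-> \int[mu]_x f x, f continuous,
   continuous. *)
Definition weak_star : topologicalType := initial_topology integrals.

Context (G : groupType) (a : G -> T -> T).

Definition invariant_probability : set weak_star :=
  [set mu : probability (borel T) R |
    forall (g : G) (A : set (borel T)),
      measurable A -> mu (a g @` A) = mu A].

Definition full (E : set (borel T)) : Prop :=
  measurable E /\
  forall mu : probability (borel T) R, invariant_probability mu -> mu E = 1%E.

End measures.

(* P_G(T), with the subspace topology of the weak* topology *)
Definition PG (R : realType) (T : ptopologicalType) (G : groupType)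
    (a : G -> T -> T) : topologicalType :=
  set_type (invariant_probability (R := R) a).

Definition PG_measure (R : realType) (T : ptopologicalType) (G : groupType)
    (a : G -> T -> T) (mu : PG R a) : probability (borel T) R := \val mu.

Definition convex_comb (R : realType) (T : ptopologicalType) (G : groupType)
    (a : G -> T -> T) (t : R) (mu nu rho : PG R a) : Prop :=
  forall A : set (borel T), measurable A ->
    PG_measure rho A =
      (t%:E * PG_measure mu A + (1 - t)%:E * PG_measure nu A)%E.

Definition affine_map (R : realType) (S T : ptopologicalType) (G : groupType)
    (a : G -> S -> S) (b : G -> T -> T) (F : PG R a -> PG R b) : Prop :=
  forall (t : R) (mu nu rho : PG R a), 0 <= t <= 1 ->
    convex_comb t mu nu rho -> convex_comb t (F mu) (F nu) (F rho).

(* A map defined on S' is represented by a function on S whose values outside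
   S' are irrelevant; the pushforward of mu under it maps B to
   mu (S' `&` Phi @^-1` B). This formula determines [Phistar]. *)
Definition borel_star_isomorphic (R : realType) (G : groupType)
    (S T : ptopologicalType) (a : G -> S -> S) (b : G -> T -> T) : Prop :=
  exists (S' : set (borel S)) (T' : set (borel T)) (Phi : borel S -> borel T),
    [/\ full R a S' /\ invariant_set a S',
        full R b T' /\ invariant_set b T',
        set_bij S' T' Phi /\ measurable_fun S' Phi,
        forall (g : G) (x : S), S' x -> Phi (a g x) = b g (Phi x) &
        exists Phistar : PG R a -> PG R b,
          [/\ forall (mu : PG R a) (B : set (borel T)), measurable B ->
                PG_measure (Phistar mu) B =
                  PG_measure mu (S' `&` Phi @^-1` B),
              homeomorphism Phistar &
              affine_map Phistar]].

(* Main.v *)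
(* Fix locally constant maps [b i : X -> bool] whose tails [i >= s] all separate
   points; then [x] is determined by [fun p i => b i (p x)], a point of the
   shift of [G] on the arrays [G -> nat -> bool].  The isomorphism is the limit
   of approximations obtained by rewriting this array.  At step [j], wherever
   the orbit visits a small clopen marker set, the symbols of index below [s_j]
   in a finite window around the visit are replaced by the corresponding symbols
   of a fixed source point [z_j]; the symbols of index at least [s_j] still
   record the original orbit, so no information is lost.  The sources are chosen
   so that every finite pattern that keeps occurring in the approximations is
   eventually planted, hence occurs syndetically from then on: the limit points
   of the approximations form a minimal subshift [Y].

   Amenability provides window shapes that are unions of cells of approximate
   tilings at all earlier scales.  Such windows disturb the structure laid down
   at an earlier step [j] only on a set of density at most [2^-j], and the
   windows of step [j] themselves cover density at most [2^-j].  So, outside a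
   null set for every invariant measure, a point meets windows of finitely many
   steps only, the approximations converge, and the limit is inverted by reading
   the symbols of index between [s_j] and [s_(j+1)].  The bounds are uniform in the
   measure, so the induced maps on invariant measures are uniform limits of
   continuous ones.

   A library measure also has values, without any meaning, on non-Borel sets.
   For the map on invariant measures to be bijective these values have to be
   transported too, along a bijection between the non-Borel sets of [X] and of
   [Y].  It comes from the Cantor-Bernstein theorem: in the presence of an
   invariant measure, [X] and [Y] have recurrent points, so they contain Cantor
   sets and embed into each other. *)
Require Import Defs.
From HB Require Import structures.
From mathcomp Require Import all_boot all_order all_algebra finmap.
From mathcomp Require Import all_classical all_reals all_analysis.
From mathcomp Require Import zify ring lra measurable_realfun.
Import numFieldNormedType.Exports.
Local Open Scope classical_set_scope.
Local Open Scope ring_scope.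

Set Implicit Arguments.
Unset Strict Implicit.
Unset Printing Implicit Defensive.
Import Order.TTheory GRing.Theory Num.Theory.

(** * Finite subsets of an amenable group *)

Section counting.
Variable G : groupType.
Local Open Scope group_scope.
Local Open Scope nat_scope.
Implicit Types (A B C F K : {fset G}) (P Q : G -> Prop).

(** Two obstacles shape the construction. The first is that infinitely many later steps must not
    wear down the structure of step [j]. Overwritten symbols are read by applying the newest level
    to the orbit and then the older levels, in decreasing order, to the field so obtained; an old
    window is planted only where the newer ones have left the orbit unbroken on [lN]. As [lN] of a
    new level is large at all older scales, a patch of an old scale that meets a new window lies in
    a single unbroken piece, and its breaks after the step come only from the boundary of that
    window. The proportion [2^-(j+1)] of breaks is therefore inherited, not summed; the windows of
    step [j] cost another [2^-(j+1)], whence [2^-j]. The second obstacle is continuity: that two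
    values of a field lie suitably on one orbit is a closed condition on [x], not an open one. The
    counter of windows repairs this: copied values have positive count, values read off the orbit of
    [x] have count 0, so the two kinds never match and the approximations stay locally constant in
    [x]. *)

Definition fmulg K A : {fset G} := [fset (x * y)%g | x in K, y in A]%fset.
Definition finvg K : {fset G} := [fset x^-1%g | x in K]%fset.
Definition cnt F P : nat := count (fun f => `[< P f >]) F.

Lemma in_fmulg K A x y : x \in K -> y \in A -> (x * y)%g \in fmulg K A.
Proof. by move=> xK yA; apply/imfset2P; exists x => //; exists y. Qed.

Lemma fmulgP K A z :
  z \in fmulg K A -> exists x y, [/\ x \in K, y \in A & z = (x * y)%g].
Proof. by move=> /imfset2P[/= x xK [y yA ->]]; exists x, y. Qed.

Lemma in_finvg K x : x \in K -> x^-1%g \in finvg K.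
Proof. by move=> xK; apply/imfsetP; exists x. Qed.

Lemma finvgP K z : z \in finvg K -> exists2 x, x \in K & z = x^-1%g.
Proof. by move=> /imfsetP[/= x xK ->]; exists x. Qed.

Lemma cnt_le F P Q : (forall f, f \in F -> P f -> Q f) -> cnt F P <= cnt F Q.
Proof.
move=> PQ; rewrite /cnt -!sum1_count big_mkcond [leqRHS]big_mkcond /=.
rewrite big_seq_cond [leqRHS]big_seq_cond; apply: leq_sum => f /andP[fF _].
by case: asboolP => // Pf; case: asboolP => // nQ; case: nQ; exact: PQ.
Qed.

Lemma eq_cnt F P Q : (forall f, f \in F -> (P f <-> Q f)) -> cnt F P = cnt F Q.
Proof.
by move=> PQ; apply/eqP; rewrite eqn_leq !cnt_le// => f fF; case: (PQ f fF).
Qed.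

Lemma cnt_or F P Q : cnt F (fun f => P f \/ Q f) <= cnt F P + cnt F Q.
Proof.
rewrite /cnt -!sum1_count !(big_mkcond (fun f => `[< _ >])) /= -big_split /=.
apply: leq_sum => f _; case: asboolP => // -[] H.
- by case: asboolP.
- by case: (asboolP (Q f)) => // _; rewrite leq_addl.
Qed.

Lemma cnt_card F P : cnt F P <= #|` F|.
Proof. exact: count_size. Qed.

Lemma cntT F P : (forall f, f \in F -> P f) -> cnt F P = #|` F|.
Proof.
by move=> PF; apply/eqP; rewrite -all_count; apply/allP => f /PF ?; apply/asboolP.
Qed.

Lemma cnt0 F P : (forall f, f \in F -> ~ P f) -> cnt F P = 0.
Proof.
move=> PF; apply/eqP; rewrite -leqn0 leqNgt -has_count.
by apply/hasPn => f /PF ?; apply/asboolP.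
Qed.

Lemma cnt_gt0 F P : 0 < cnt F P -> exists2 f, f \in F & P f.
Proof. by rewrite -has_count => /hasP[f fF /asboolP]; exists f. Qed.

Lemma cnt_inj F A P Q (h : G -> G) :
  {in F &, injective h} ->
  (forall f, f \in F -> P f -> h f \in A /\ Q (h f)) -> cnt F P <= cnt A Q.
Proof.
move=> hi PQ; rewrite /cnt -!size_filter.
rewrite -(size_map h); apply: uniq_leq_size.
  rewrite map_inj_in_uniq; first by rewrite filter_uniq// fset_uniq.
  move=> x y; rewrite !mem_filter => /andP[_ xF] /andP[_ yF]; exact: hi.
move=> _ /mapP[f + ->]; rewrite !mem_filter => /andP[/asboolP Pf fF].
by have [hA Qh] := PQ _ fF Pf; apply/andP; split => //; apply/asboolP.
Qed.

Lemma cnt_card_inj F A P (h : G -> G) : {in F &, injective h} ->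
  (forall f, f \in F -> P f -> h f \in A) -> cnt F P <= #|` A|.
Proof.
move=> hi hA; apply: leq_trans (cnt_card A (fun=> True)).
by apply: cnt_inj hi _ => f fF Pf; split => //; apply: hA.
Qed.

Lemma cnt_exchange C T (U : G -> Prop) :
  \sum_(c <- C) cnt T (fun t => U (t * c)%g) =
  \sum_(t <- T) cnt C (fun c => U (t * c)%g).
Proof.
rewrite /cnt; under eq_bigr do rewrite -sum1_count big_mkcond /=.
under [RHS]eq_bigr do rewrite -sum1_count big_mkcond /=.
exact: exchange_big.
Qed.

Lemma card_fmulg1 A c : #|` fmulg A [fset c]%fset| = #|` A|.
Proof.
suff -> : fmulg A [fset c]%fset = [fset (x * c)%g | x in A]%fset.
  by rewrite card_imfset//; exact: mulIg.
apply/fsetP => z; apply/idP/imfsetP => [/fmulgP[x [y [xA]]]|[x /= xA ->]].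
  by rewrite inE => /eqP -> ->; exists x.
by apply: in_fmulg => //; rewrite inE.
Qed.

Lemma fmulgA A B C : fmulg A (fmulg B C) = fmulg (fmulg A B) C.
Proof.
apply/fsetP => z; apply/idP/idP.
  move=> /fmulgP[x [_ [xA /fmulgP[y [w [yB wC ->]]] ->]]].
  by rewrite mulgA !in_fmulg.
move=> /fmulgP[_ [w [/fmulgP[x [y [xA yB ->]]] wC ->]]].
by rewrite -mulgA !in_fmulg.
Qed.

Lemma fmulgSl A B C : {subset A <= B} -> {subset fmulg A C <= fmulg B C}.
Proof. by move=> AB _ /fmulgP[x [y [xA yC ->]]]; rewrite in_fmulg// AB. Qed.

Lemma fmulgSr A B C : {subset A <= B} -> {subset fmulg C A <= fmulg C B}.
Proof. by move=> AB _ /fmulgP[x [y [xA yC ->]]]; rewrite in_fmulg// AB. Qed.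

Lemma leq_card_sub A B : {subset A <= B} -> #|` A| <= #|` B|.
Proof. by move=> AB; apply: fsubset_leq_card; apply/fsubsetP. Qed.

Lemma card_finvg A : #|` finvg A| = #|` A|.
Proof. by rewrite card_imfset//; exact: invg_inj. Qed.

Lemma card_fmulg A B : #|` fmulg A B| <= #|` A| * #|` B|.
Proof.
pose s := [seq (x * y)%g | x <- A, y <- B].
rewrite -[leqRHS](size_allpairs (fun x y => x * y)%g A B).
apply: uniq_leq_size => // z /fmulgP[x [y [xA yB ->]]].
by apply/allpairsP; exists (x, y).
Qed.

End counting.

(** * Følner sets with prescribed invariance *)

Section folner.
Variables (R : realType) (G : groupType).
Hypothesis amG : amenable R G.
Local Open Scope nat_scope.
Implicit Types (F K Q : {fset G}).

Lemma folner (K : {fset G}) (m : nat) : exists F : {fset G},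
  F != fset0 /\ m * #|` (fmulg K F `\` F)%fset| <= #|` F|.
Proof.
have [F [F0 Flim]] := amG.
suff : \forall n \near \oo, m * #|` (fmulg K (F n) `\` F n)%fset| <= #|` F n|.
  by move=> [N _ /(_ N (leqnn N))] h; exists (F N).
have key g : \forall n \near \oo,
    m * #|` K| * #|` (fmulg [fset g]%fset (F n) `\` F n)%fset| <= #|` F n|.
  (* The factor [#|K|] is what the union over [K] will consume; the successor covers
     [m * #|K| = 0]. *)
  have e0 : (0 < ((m * #|` K|).+1%:R^-1 : R))%R by rewrite invr_gt0.
  have /cvgrPdist_lt/(_ _ e0) := Flim g; apply: filterS => n /=.
  have Fn0 : (0 < (#|` F n|)%:R :> R)%R by rewrite ltr0n cardfs_gt0.
  rewrite sub0r normrN ger0_norm ?divr_ge0// ltr_pdivrMr// ltr_pdivlMl//.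
  rewrite -natrM ltr_nat => h.
  rewrite ltnW//; apply: leq_ltn_trans h; apply: leq_mul => //.
  apply: leq_card_sub => z; rewrite !inE => /andP[-> /fmulgP[x [y [+ yF ->]]]].
  by rewrite inE => /eqP ->; apply/orP; left; apply/imfsetP; exists y.
have /(_ (enum_fset K)) : forall s : seq G, \forall n \near \oo, forall g, g \in s ->
    m * #|` K| * #|` (fmulg [fset g]%fset (F n) `\` F n)%fset| <= #|` F n|.
  elim=> [|g s IH]; first by near=> n => g; rewrite in_nil.
  near=> n => h; rewrite in_cons => /orP[/eqP ->|].
    by near: n; exact: key.
  by move: h; near: n; exact: IH.
apply: filterS => n hn.
have [K0|K0] := eqVneq K fset0.
  rewrite (_ : (_ `\` _)%fset = fset0) ?cardfs0 ?muln0//.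
  apply/fsetP => z; rewrite !inE; apply/negbTE/negP => /andP[_].
  by move=> /fmulgP[x [y [+ _ _]]]; rewrite K0.
rewrite -(@leq_pmul2r #|` K|) ?cardfs_gt0//.
have -> : m * #|` (fmulg K (F n) `\` F n)%fset| * #|` K| =
   m * #|` K| * #|` (fmulg K (F n) `\` F n)%fset| by rewrite mulnAC.
apply: (@leq_trans (\sum_(g <- K) m * #|` K| *
   #|` (fmulg [fset g]%fset (F n) `\` F n)%fset|)).
  rewrite -big_distrr /= leq_mul//.
  have -> : (fmulg K (F n) `\` F n)%fset =
     (\bigcup_(g <- K) (fmulg [fset g] (F n) `\` F n))%fset.
    apply/fsetP => z; apply/idP/bigfcupP => /=.
      rewrite !inE => /andP[zF /fmulgP[x [y [xK yF zE]]]].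
      exists x; first by rewrite xK.
      by rewrite !inE zF/= zE in_fmulg// inE.
    move=> [g]; rewrite andbT => gK; rewrite !inE => /andP[-> /=].
    by move=> /fmulgP[x [y [+ yF ->]]]; rewrite inE => /eqP ->; rewrite in_fmulg.
  elim: (enum_fset K) => [|g s IH]; first by rewrite !big_nil cardfs0.
  rewrite !big_cons; apply: leq_trans (leq_add (leqnn _) IH).
  by rewrite cardfsU leq_subr.
rewrite big_seq; apply: (@leq_trans (\sum_(g <- K | g \in K) #|` F n|)).
  exact: leq_sum.
by rewrite -big_seq big_const_seq count_predT iter_addn_0.
Unshelve. all: by end_near. Qed.

End folner.

(** A greedy procedure driven by such an enumeration reconsiders each site at arbitrarily late
    times. Values recur because the second component of the decoded pair is free and pairing is
    injective. *)
Lemma recurrent_enumeration (T : Type) (t0 : T) : countable [set: T] ->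
  exists c : nat -> T, forall t N, exists2 n, (N <= n)%N & c n = t.
Proof.
move=> /countable_injP[f fi0]; have fi : injective f by move=> x y; apply: fi0; rewrite inE.
pose e n := if pselect (exists t, f t = n) is left h then projT1 (cid h) else t0.
have ef t : e (f t) = t.
  by rewrite /e; case: pselect => [h|[]]; [apply: fi; case: cid|exists t].
exists (fun n => if (choice.unpickle n : option (nat * nat)) is Some ij then e ij.1 else t0) => t N.
have [m _ mN] : exists2 m, True & (N <= @choice.pickle (nat * nat)%type (f t, m))%N.
  apply: contrapT => h.
  have lt m : (@choice.pickle (nat * nat)%type (f t, m) < N)%N.
    by rewrite ltnNge; apply/negP => ?; apply: h; exists m.
  have inj : injective (fun m : 'I_N.+1 => Ordinal (lt m)).
    move=> x y [] /(pcan_inj (@choice.pickleK (nat * nat)%type)) [xy]; exact: val_inj.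
  by have := leq_card _ inj; rewrite !card_ord ltnn.
by exists (@choice.pickle (nat * nat)%type (f t, m)) => //; rewrite choice.pickleK /= ef.
Qed.

(** * Approximate tilings at one scale *)

Section cells.
Variables (R : realType) (G : groupType).
Hypothesis amG : amenable R G.
Hypothesis cG : countable [set: G].
Local Open Scope nat_scope.

(** [H0] is the [K]-core of [H]. The difference [T \ H0] consists of [T \ H] and, for each [r] in
    [K], of the points that [r] pushes out of [H]; each of these [#|K| + 1] pieces embeds in one
    Følner boundary. *)
Lemma folner_core (K : {fset G}) (m : nat) : 1%g \in K -> exists H H0 : {fset G},
  let T := fmulg (finvg K) H in
  [/\ H != fset0, {subset H0 <= H},
     forall t r, t \in H0 -> r \in K -> (r * t)%g \in H &
     m * #|` (T `\` H0)%fset| <= #|` T|].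
Proof.
move=> K1; have [H [H0 hH]] := folner amG (K `|` finvg K)%fset (m * (#|` K|.+1)).
pose core := [fset t in H | all (fun r => (r * t)%g \in H) K]%fset.
exists H, core; split => //.
- by move=> t; rewrite !inE => /andP[].
- by move=> t r; rewrite !inE /= => /andP[_ /allP]; apply.
set T := fmulg _ _.
have HT : {subset H <= T}.
  move=> h hH'; rewrite -[h]mul1g in_fmulg// -invg1; exact: in_finvg.
set bd := (fmulg (K `|` finvg K) H `\` H)%fset in hH.
suff le : #|` (T `\` core)%fset| <= #|` K|.+1 * #|` bd|.
  apply: leq_trans (leq_card_sub HT); apply: leq_trans hH.
  by rewrite -mulnA leq_mul2l le orbT.
pose S0 := (T `\` H)%fset.
pose S r := [fset t in H | (r * t)%g \notin H]%fset.
have : {subset (T `\` core)%fset <= (S0 `|` \bigcup_(r <- K) S r)%fset}.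
  move=> t; rewrite !inE => /andP[+ tT]; rewrite tT andbT.
  have [tH|//] := boolP (t \in H); rewrite /= => /allPn[r rK rt].
  by apply/bigfcupP; exists r; rewrite ?rK// !inE tH.
move=> /leq_card_sub le; apply: leq_trans le _.
rewrite cardfsU mulSn; apply: leq_trans (leq_subr _ _) _; apply: leq_add.
  apply: leq_card_sub => t; rewrite !inE => /andP[-> /fmulgP[x [y [xK yH ->]]]].
  by rewrite in_fmulg// inE xK orbT.
have : forall s : seq G, {subset s <= K} ->
    #|` (\bigcup_(r <- s) S r)%fset| <= size s * #|` bd|.
  elim=> [|r s IH] sK; first by rewrite big_nil cardfs0.
  rewrite big_cons mulSn cardfsU; apply: leq_trans (leq_subr _ _) _.
  apply: leq_add; last by apply: IH => x xs; apply: sK; rewrite in_cons xs orbT.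
  have -> : #|` S r| = #|` [fset (r * t)%g | t in S r]%fset|.
    by rewrite [RHS]card_imfset// => x y /mulgI.
  apply: leq_card_sub => _ /imfsetP[/= t + ->]; rewrite !inE => /andP[tH ->].
  by rewrite in_fmulg// inE sK// mem_head.
by move=> /(_ K); apply.
Qed.

(* A one-scale Ornstein-Weiss argument: translates [H c] are laid down
   greedily, a translate being used only if few of the still undecided points
   of [T c] lie near its boundary; double counting shows that the points which
   are never decided have small density. *)
Lemma cell_structure (K Q : {fset G}) (k : nat) : 1%g \in K -> 0 < k ->
  exists (F B : {fset G}) (cell : nat -> G -> Prop),
  [/\ F != fset0, #|` fmulg Q F| <= 2 * #|` F|,
      forall n n' p, cell n p -> cell n' p -> n = n',
      forall n p q, cell n p -> cell n q -> (q * p^-1)%g \in B &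
      forall p, k * cnt F (fun f => ~ exists n, forall r, r \in K ->
                  cell n (r * (f * p))%g) <= #|` F|].
Proof.
(* Undecided points and decided points near a boundary will each number at most [1/k1] of a set of
   size at most [2 * #|F|], hence [4/k1 = 1/k] of [F] together. *)
move=> K1 k0; pose k1 := 4 * k.
(* One factor [k1] is spent on the failure of admissibility, the other is the density bound for the
   undecided points. *)
have [H [H0 /= [Hn0 H0H HK]]] := folner_core (k1 * k1) K1.
set T := fmulg (finvg K) H => hT; pose D := (T `\` H0)%fset.
have HT : {subset H <= T}.
  move=> h hH'; rewrite -[h]mul1g in_fmulg// -invg1; exact: in_finvg.
have Tn0 : 0 < #|` T|.
  rewrite cardfs_gt0; have /fset0Pn[h hH] := Hn0.
  by apply/fset0Pn; exists h; exact: HT.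
have DT : {subset D <= T} by move=> d; rewrite !inE => /andP[].
have [c hc] := recurrent_enumeration (1%g : G) cG.
(* A translate of [T] that meets a set [S] lies in [W S]. *)
pose W := fmulg T (finvg T).
have [F [F0 hF]] := folner amG (Q `|` W)%fset 1.
have small (S : {fset G}) : {subset S <= (Q `|` W)%fset} ->
    #|` fmulg S F| <= 2 * #|` F|.
  move=> SQ; rewrite mul2n -addnn.
  have : {subset fmulg S F <= (fmulg (Q `|` W) F `\` F) `|` F}%fset.
    move=> z zS; rewrite !inE; case: (z \in F) => //=.
    by rewrite orbF; apply: fmulgSl zS => x; exact: SQ.
  move=> /leq_card_sub /leq_trans; apply; rewrite cardfsU.
  by apply: leq_trans (leq_subr _ _) _; rewrite leq_add2r -[leqLHS]mul1n.
pose adm (U : G -> Prop) x := 0 < cnt T (fun t => U (t * x)%g) /\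
  k1 * cnt D (fun t => U (t * x)%g) <= cnt T (fun t => U (t * x)%g).
pose inT x (p : G) := (p * x^-1)%g \in T.
pose fix Und n := if n is m.+1 then
  fun p => Und m p /\ ~ (adm (Und m) (c m) /\ inT (c m) p) else fun=> True.
pose proc n := adm (Und n) (c n).
have UndS n m p : n <= m -> Und m p -> Und n p.
  elim: m => [|m IH]; first by rewrite leqn0 => /eqP ->.
  by rewrite leq_eqVlt => /orP[/eqP -> //|]; rewrite ltnS => nm [/(IH nm)].
have Und_proc n m p : n < m -> proc n -> Und m p -> ~ inT (c n) p.
  by move=> nm pn /(UndS n.+1 _ _ nm) [_ h] ip; apply: h.
pose inH n (p : G) := (p * (c n)^-1)%g \in H.
pose cell n p := [/\ proc n, inH n p & forall m, m < n -> proc m -> ~ inH m p].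
pose bad n p := exists2 m, m < n & [/\ proc m, Und m p & (p * (c m)^-1)%g \in D].
pose Undoo p := forall n, Und n p.
pose badoo p := exists n, bad n p.
(* Each used site near [S] pays for its bad points: it removes at least [k1] times as many undecided
   points from [W S]. *)
have bad_count p n (S := fmulg F [fset p]%fset) :
    k1 * cnt S (bad n) + cnt (fmulg W S) (Und n) <= #|` fmulg W S|.
  elim: n => [|n IH].
    rewrite [cnt S _]cnt0 ?muln0 ?add0n ?cnt_card//.
    by move=> f _ [].
  have [pn|npn] := pselect (proc n); last first.
    apply: leq_trans IH; apply: leq_add; last by apply: cnt_le => f _ [].
    rewrite leq_mul//; apply: cnt_le => f _ [m]; rewrite ltnS leq_eqVlt.
    by move=> /orP[/eqP -> [/npn]//|mn h]; exists m.
  have [[s sS [Us Ts]]|no] :=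
      pselect (exists2 s, s \in S & Und n s /\ inT (c n) s); last first.
    apply: leq_trans IH; apply: leq_add; last by apply: cnt_le => f _ [].
    rewrite leq_mul//; apply: cnt_le => f fS [m]; rewrite ltnS leq_eqVlt.
    move=> /orP[/eqP -> [_ Uf /DT fD]|mn h]; last by exists m.
    by case: no; exists f.
  have b1 : cnt S (bad n.+1) <= cnt S (bad n) +
      cnt S (fun p => Und n p /\ (p * (c n)^-1)%g \in D).
    apply: leq_trans (cnt_or _ _ _); apply: cnt_le => f _ [m].
    rewrite ltnS leq_eqVlt => /orP[/eqP -> [_ Uf fD]|mn h]; first by right.
    by left; exists m.
  have b2 : cnt S (fun p => Und n p /\ (p * (c n)^-1)%g \in D) <=
      cnt D (fun t => Und n (t * c n)%g).
    apply: (@cnt_inj _ _ _ _ _ (fun p => p * (c n)^-1)%g).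
      by move=> x y _ _; exact: mulIg.
    by move=> f _ [Uf fD]; split => //; rewrite mulgVK.
  have b3 : cnt T (fun t => Und n (t * c n)%g) <=
      cnt (fmulg W S) (fun p => Und n p /\ inT (c n) p).
    apply: (@cnt_inj _ _ _ _ _ (fun t => t * c n)%g).
      by move=> x y _ _; exact: mulIg.
    move=> f fT Uf; split; last by rewrite /inT mulgK.
    rewrite (_ : (f * c n = (f * (s * (c n)^-1)^-1) * s)%g); last first.
      by rewrite invgF -!mulgA mulVg mulg1.
    by apply: in_fmulg => //; apply: in_fmulg => //; exact: in_finvg.
  have b4 : cnt (fmulg W S) (fun p => Und n p /\ inT (c n) p) +
      cnt (fmulg W S) (Und n.+1) <= cnt (fmulg W S) (Und n).
    rewrite /cnt -!sum1_count !(big_mkcond (fun f => `[< _ >])) /= -big_split /=.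
    apply: leq_sum => f _.
    have [[Uf Tf]|h1] := asboolP (Und n f /\ inT (c n) f).
      rewrite asboolF ?asboolT//; first by move=> [_]; apply.
    by case: asboolP => // -[Uf _]; rewrite asboolT.
  have [_ pn2] := pn; move: IH; rewrite -/S in b1 b2 b3 b4 *.
  move: pn2 b1 b2 b3 b4; clear; nia.
(* On the finite set [T x] the undecided points are final from some time on. The site [x] comes up
   again later, and using it then would decide a point that is never decided. *)
have Und_adm x : cnt T (fun t => Undoo (t * x)%g) <=
    k1 * cnt D (fun t => Undoo (t * x)%g).
  have [N hN] : exists N, forall t, t \in T -> Und N (t * x)%g -> Undoo (t * x)%g.
    have : forall s : seq G, exists N, forall t, t \in s ->
        Und N (t * x)%g -> Undoo (t * x)%g.
      elim=> [|t s [N IH]]; first by exists 0.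
      have [N' hN'] : exists N', Und N' (t * x)%g -> Undoo (t * x)%g.
        have [h|h] := pselect (Undoo (t * x)%g); first by exists 0.
        by move/existsNP : h => [N' hN']; exists N'.
      exists (maxn N N') => u; rewrite in_cons => /orP[/eqP ->|us] Uu.
        by apply: hN'; apply: UndS Uu; rewrite leq_maxr.
      by apply: IH => //; apply: UndS Uu; rewrite leq_maxl.
    by move=> /(_ T).
  have [n Nn cnx] := hc x N.
  have UE t : t \in T -> Und n (t * x)%g <-> Undoo (t * x)%g.
    by move=> tT; split=> [/(UndS _ _ _ Nn)/(hN _ tT)|/(_ n)].
  have -> : cnt D (fun t => Undoo (t * x)%g) = cnt D (fun t => Und n (t * x)%g).
    by apply: eq_cnt => t /DT/UE [].
  have -> : cnt T (fun t => Undoo (t * x)%g) = cnt T (fun t => Und n (t * x)%g).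
    by apply: eq_cnt => t /UE [].
  rewrite leqNgt; apply/negP => lt.
  have pn : proc n.
    by rewrite /proc cnx; split; [apply: leq_ltn_trans lt|exact: ltnW].
  have [t tT /(UE _ tT) Ut] := cnt_gt0 (leq_ltn_trans (leq0n _) lt).
  have := Ut n.+1; rewrite /= -/(proc n) => -[_]; apply; split => //.
  by rewrite /inT cnx mulgK.
(* Double counting over sites [x]: a point of [S] lies in [#|T|] of the sets [T x], while a point of
   [W S] lies in at most [#|D|] of the sets [D x]. *)
have und_count p (S := fmulg F [fset p]%fset) :
    k1 * cnt S Undoo <= #|` fmulg W S|.
  pose C := fmulg (finvg T) S.
  have low : #|` T| * cnt S Undoo <= \sum_(x <- C) cnt T (fun t => Undoo (t * x)%g).
    rewrite cnt_exchange -sum1_size big_distrl /=.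
    rewrite big_seq [leqRHS]big_seq; apply: leq_sum => t tT; rewrite mul1n.
    apply: (@cnt_inj _ _ _ _ _ (fun u => t^-1 * u)%g).
      by move=> x y _ _; exact: mulgI.
    by move=> u uS Uu; rewrite in_fmulg ?in_finvg// mulVKg.
  have up : \sum_(x <- C) cnt D (fun t => Undoo (t * x)%g) <=
      #|` D| * #|` fmulg W S|.
    rewrite cnt_exchange -sum1_size big_distrl /=.
    rewrite big_seq [leqRHS]big_seq; apply: leq_sum => t tD; rewrite mul1n.
    apply: (@cnt_card_inj _ _ _ _ (fun u => t * u)%g).
      by move=> x y _ _; exact: mulgI.
    move=> u uC _; rewrite /W -fmulgA; apply: in_fmulg => //; exact: DT.
  have mid : \sum_(x <- C) cnt T (fun t => Undoo (t * x)%g) <=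
      k1 * \sum_(x <- C) cnt D (fun t => Undoo (t * x)%g).
    by rewrite big_distrr /=; exact: leq_sum.
  rewrite -(leq_pmul2l Tn0).
  move: low up mid hT; rewrite -/D; set a := #|` T|; set b := \sum_(_ <- _) _.
  set d := \sum_(_ <- _) _; set e := #|` D|; set u := cnt _ _; set w := #|` _|.
  move: a b d e u w; clear; move: k1 => j a b d e u w low up mid hT.
  apply: (@leq_trans (j * (j * (e * w)))).
    rewrite mulnCA leq_mul2l; apply/orP; right.
    by apply: (leq_trans low); apply: (leq_trans mid); rewrite leq_mul2l up orbT.
  by rewrite !mulnA leq_mul2r hT orbT.
(* Here [T = K^-1 H] matters: had an earlier used translate of [H] met [K p], the point [p] would
   have been decided at that time. *)
have good_cell p : ~ Undoo p -> ~ badoo p ->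
    exists n, forall r, r \in K -> cell n (r * p)%g.
  move=> nU nB.
  have /existsNP[n0 hn0] := nU.
  have [n [pn Un Tn]] : exists n, [/\ proc n, Und n p & inT (c n) p].
    elim: n0 hn0 => [[]//|n IH] h.
    have [Un|/IH//] := pselect (Und n p).
    exists n; split => //; apply: contrapT => h'; apply: h; split => // -[? ?];
      exact: h'.
  have pH0 : (p * (c n)^-1)%g \in H0.
    apply/negPn/negP => pH0; apply: nB; exists n.+1, n => //; split => //.
    by rewrite !inE pH0.
  exists n => r rK; split => //; first by rewrite /inH -mulgA HK.
  move=> m mn pm h; apply: (Und_proc _ _ _ mn pm Un).
  rewrite /inT (_ : (p * _ = r^-1 * (r * p * (c m)^-1))%g).
    by apply: in_fmulg => //; exact: in_finvg.
  by rewrite !mulgA mulVg mul1g.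
exists F, (fmulg H (finvg H)), cell; split => //.
- by apply: small => x xQ; rewrite inE xQ.
- move=> n n' p [pn hn ln] [pn' hn' ln']; have [lt|lt|//] := ltngtP n n'.
  + by case: (ln' _ lt pn).
  + by case: (ln _ lt pn').
- move=> n p q [_ hp _] [_ hq _].
  rewrite (_ : (q * p^-1 = (q * (c n)^-1) * (p * (c n)^-1)^-1)%g).
    by apply: in_fmulg => //; exact: in_finvg.
  by rewrite invgF !mulgA mulgVK.
move=> p; set S := fmulg F [fset p]%fset.
have WS : #|` fmulg W S| <= 2 * #|` F|.
  rewrite /S fmulgA card_fmulg1; apply: small => x xW; by rewrite inE xW orbT.
have le : cnt F (fun f => ~ exists n, forall r, r \in K -> cell n (r * (f * p))%g)
    <= cnt S Undoo + cnt S badoo.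
  apply: leq_trans (cnt_or _ _ _).
  apply: (@cnt_inj _ _ _ _ _ (fun f => f * p)%g).
    by move=> x y _ _; exact: mulIg.
  move=> f fF h; split; first by rewrite in_fmulg// inE.
  by apply: contrapT => /not_orP[h1 h2]; apply: h; exact: good_cell.
have bad_le : k1 * cnt S badoo <= #|` fmulg W S|.
  have [N hN] : exists N, forall s, s \in S -> badoo s -> bad N s.
    have : forall s : seq G, exists N, forall t, t \in s -> badoo t -> bad N t.
      elim=> [|t s [N IH]]; first by exists 0.
      have [N' hN'] : exists N', badoo t -> bad N' t.
        by have [[N' ?]|nb] := pselect (badoo t); [exists N'|exists 0].
      exists (maxn N N') => u; rewrite in_cons => /orP[/eqP ->|us] bu.
        have [m mN ?] := hN' bu; exists m => //.
        by apply: leq_trans mN _; rewrite leq_maxr.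
      have [m mN ?] := IH _ us bu; exists m => //.
      by apply: leq_trans mN _; rewrite leq_maxl.
    by move=> /(_ S).
  apply: leq_trans (bad_count p N); rewrite -/S.
  by apply: leq_trans (leq_addr _ _); rewrite leq_mul//; exact: cnt_le.
have := und_count p; rewrite -/S; move: WS bad_le le; rewrite /k1.
clear -k0; move: (cnt _ _) (cnt _ _) (cnt _ _) (#|` _|) (#|` F|) k0.
by move=> b u g w f k0; nia.
Qed.

End cells.

(** * Window shapes adapted to several scales *)

Section hereditary.
Variables (R : realType) (G : groupType).
Hypothesis amG : amenable R G.
Hypothesis cG : countable [set: G].
Local Open Scope nat_scope.

Definition cut (A K : {fset G}) (q : G) : Prop :=
  (exists2 r, r \in K & (r * q)%g \in A) /\
  (exists2 r, r \in K & (r * q)%g \notin A).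

(* Every finite set can be saturated to a member of [Her] at bounded distance. *)
Definition thick (Her : {fset G} -> Prop) (B : {fset G}) : Prop :=
  forall E : {fset G}, exists A : {fset G},
    [/\ {subset E <= A}, {subset A <= fmulg B E} & Her A].

(* Replacing a finite set by the union of the cells it meets confines its
   boundary to cell boundaries. *)
Lemma thick_refine (Her : {fset G} -> Prop) (B K Q : {fset G}) (k : nat) :
  thick Her B -> 0 < k ->
  exists (F B' : {fset G}), [/\ F != fset0, #|` fmulg Q F| <= 2 * #|` F| &
    thick (fun A => Her A /\
      forall p, k * cnt F (fun f => cut A K (f * p)%g) <= #|` F|) B'].
Proof.
move=> thB k0.
(* The part [B^-1 K] leads back from [A], which lies in [B E'], to [E'] itself. *)
pose K' := (1%g |` (K `|` fmulg (finvg B) K))%fset.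
have K'1 : 1%g \in K' by rewrite !inE eqxx.
have [F [B0 [cell [F0 hF cfun cB hcell]]]] := cell_structure amG cG Q K'1 k0.
exists F, (fmulg B (1%g |` B0)%fset); split => // E.
pose E' := (E `|` [fset q in fmulg B0 E | `[< exists n, cell n q /\
  exists2 e, e \in E & cell n e >]])%fset.
have EE' : {subset E' <= fmulg (1%g |` B0)%fset E}.
  move=> q; rewrite !inE => /orP[qE|/= /andP[]].
    by rewrite -[q]mul1g in_fmulg// !inE eqxx.
  by move=> /fmulgP[x [y [xB yE ->]]] _; rewrite in_fmulg// !inE xB orbT.
(* The older saturation is applied last, so that [A] belongs to [Her]; the cells of the new scale
   absorb its displacement by [B]. *)
have [A [E'A AE' HA]] := thB E'.
exists A; split.
- by move=> e eE; apply: E'A; rewrite !inE eE.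
- by move=> x /AE'/(fmulgSr EE'); rewrite fmulgA.
split => // p; apply: leq_trans (hcell p); rewrite leq_mul//.
apply: cnt_le => f fF [[r1 r1K r1A] [r2 r2K r2A]] [n hn].
set q := (f * p)%g in hn r1A r2A.
have inK' r : r \in K -> r \in K' by rewrite !inE => ->; rewrite orbT.
have [[e [eE ce]]|no] := pselect (exists e, e \in E /\ cell n e).
  have /negP := r2A; apply; apply: E'A; rewrite !inE; apply/orP; right.
  have c2 := hn _ (inK' _ r2K).
  apply/andP; split; last by apply/asboolP; exists n; split => //; exists e.
  rewrite -[(r2 * q)%g](mulgVK e).
  by apply: in_fmulg => //; exact: (cB _ _ _ ce c2).
have {}no r : r \in K' -> (r * q)%g \notin E'.
  move=> rK'; apply/negP; rewrite !inE => /orP[rE|/= /andP[_ /asboolP]].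
    by apply: no; exists (r * q)%g; split => //; exact: hn.
  move=> [n' [c1 [e eE ce]]]; apply: no; exists e; split => //.
  by rewrite (cfun _ _ _ (hn _ rK') c1).
have [b [x [bB xE' rqE]]] := fmulgP (AE' _ r1A).
have : (b^-1 * r1)%g \in K'.
  by rewrite !inE in_fmulg ?orbT// in_finvg.
by move=> /no; rewrite -mulgA rqE mulKg xE'.
Qed.

End hereditary.

(** * Fields and windows *)

Section fields.
Variables (G : groupType) (X : topologicalType) (a : G -> X -> X).
Hypothesis aX : is_action a.
Local Open Scope nat_scope.

Lemma action1 x : a 1%g x = x. Proof. by case: aX. Qed.
Lemma actionM g h x : a (g * h)%g x = a g (a h x). Proof. by case: aX. Qed.
Lemma actionK g : cancel (a g) (a g^-1%g).
Proof. by move=> x; rewrite -actionM mulVg action1. Qed.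
Lemma actionVK g : cancel (a g^-1%g) (a g).
Proof. by move=> x; rewrite -actionM mulgV action1. Qed.
Lemma action_continuous g : continuous (a g).
Proof. by case: aX => + _ _ => /(_ g)[]. Qed.

(* A field assigns to [p : G] a point of [X], from which the symbols at [p]
   are read, and the number of windows in which [p] lies. *)
Local Notation field := (G -> X * nat).
Implicit Types (w : field) (F K N A S M Q : {fset G}).

Definition act g (s : X * nat) : X * nat := (a g s.1, s.2).
(** A window raises all counts of an unbroken piece alike. Readers insensitive to [sh] therefore
    read in a window what they read on the orbit of the source. *)
Definition sh (d : nat) (s : X * nat) : X * nat := (s.1, s.2 + d).
Definition orb (v : X) : field := fun g => (a g v, 0).
Definition unbroken w S c := forall n, n \in S -> w (n * c)%g = act n (w c).

(* Windows are copies of [lA], centred at the visits of the field to [lC]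
   around which the field is an undisturbed orbit on [lN]; [lz] is the source. *)
Record level := Level
  { lC : set X; lN : {fset G}; lA : {fset G}; lz : X }.

Definition allowed (L : level) w c := lC L (w c).1 /\ unbroken w (lN L) c.

Definition in_window L w p c := allowed L w c /\ (p * c^-1)%g \in lA L.

Definition step L w : field := fun p =>
  if pselect (exists c, in_window L w p c) is left h
  then (a (p * (projT1 (cid h))^-1)%g (lz L), (w p).2.+1) else w p.

Record good_level L : Prop := GoodLevel {
  goodN1 : 1%g \in lN L;
  goodAN : {subset lA L <= lN L};
  good_sep : forall v g, lC L v -> lC L (a g v) ->
    g \in fmulg (finvg (lN L)) (lN L) -> g = 1%g }.

Lemma act_act g h s : act g (act h s) = act (g * h)%g s.
Proof. by rewrite /act /= actionM. Qed.

Lemma unbroken_orb v S c : unbroken (orb v) S c.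
Proof. by move=> n _; rewrite /orb /act /= actionM. Qed.

(** Where two unbroken pieces overlap, both centres carry points of [lC] on one orbit with return
    time in [N^-1 N], and separation forces this time to be 1. So even the neighbourhoods [lN] of
    distinct windows are disjoint. *)
Lemma allowed_uniq L w c c' n n' : good_level L ->
  allowed L w c -> allowed L w c' -> n \in lN L -> n' \in lN L ->
  (n * c = n' * c')%g -> c = c'.
Proof.
move=> gL [Cc uc] [Cc' uc'] nN nN' e.
have := uc _ nN; rewrite e (uc' _ nN') => -[e1 _].
have : (n'^-1 * n)%g = 1%g.
  apply: (good_sep gL Cc); first by rewrite actionM -e1 actionK.
  by apply: in_fmulg => //; exact: in_finvg.
move=> /mulg1_eq nn; rewrite invgK in nn; by apply: (@mulgI _ n); rewrite e nn.
Qed.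

Lemma step_in L w c t : good_level L -> allowed L w c -> t \in lA L ->
  step L w (t * c)%g = (a t (lz L), (w (t * c)%g).2.+1).
Proof.
move=> gL ac tA; rewrite /step; case: pselect => [h|[]]; last first.
  by exists c; split => //; rewrite mulgK.
case: cid => c' /= [ac' tc']; suff -> : c' = c by rewrite mulgK.
apply: (@allowed_uniq L w _ _ (t * c * c'^-1)%g t) => //; [exact: goodAN..|].
by rewrite mulgVK.
Qed.

Lemma step_out L w p : (forall c, ~ in_window L w p c) -> step L w p = w p.
Proof. by move=> h; rewrite /step; case: pselect => [[c hc]|//]; case: (h _ hc). Qed.

(** A window containing [s] has its centre in [lA^-1 s], and whether that centre is allowed is
    decided on [lN] around it. *)
Definition reach L S : {fset G} :=
  fmulg (1%g |` fmulg (lN L) (finvg (lA L)))%fset S.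

Lemma step_local L w w' p p' d S : good_level L ->
  (forall s, s \in reach L S -> w (s * p)%g = sh d (w' (s * p')%g)) ->
  forall s, s \in S -> step L w (s * p)%g = sh d (step L w' (s * p')%g).
Proof.
move=> gL ww' s sS.
have ws : w (s * p)%g = sh d (w' (s * p')%g).
  by apply: ww'; rewrite -[s]mul1g in_fmulg// !inE eqxx.
have wn t n : t \in lA L -> n \in lN L ->
    w (n * (t^-1 * s * p))%g = sh d (w' (n * (t^-1 * s * p'))%g).
  move=> tA nN; rewrite !mulgA; apply: ww'; apply: in_fmulg => //.
  by rewrite !inE in_fmulg ?orbT// in_finvg.
have wc t : t \in lA L -> w (t^-1 * s * p)%g = sh d (w' (t^-1 * s * p')%g).
  by move=> tA; rewrite -[(_ * _)%g]mul1g wn ?mul1g//; exact: goodN1.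
have al t : t \in lA L ->
    allowed L w (t^-1 * s * p)%g <-> allowed L w' (t^-1 * s * p')%g.
  move=> tA; rewrite /allowed wc//=; split=> -[Cc u]; split => // n nN.
    have := u n nN; rewrite wn// wc// /sh /act /= => -[e1 /addIn e2].
    by rewrite [LHS]surjective_pairing e1 e2.
  by rewrite wn// wc// u.
have [[c [ac sc]]|no] := pselect (exists c, in_window L w (s * p)%g c).
  have cE : c = ((s * p * c^-1)^-1 * s * p)%g by rewrite invgF -mulgA mulgVK.
  move: sc ac; set t := (s * p * c^-1)%g in cE *; move=> tA; rewrite cE => ac.
  have ac' := (al _ tA).1 ac.
  have e x : (s * x = t * (t^-1 * s * x))%g by rewrite !mulgA mulgV mul1g.
  have -> : step L w (s * p)%g = (a t (lz L), (w (s * p)%g).2.+1).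
    by rewrite (e p); exact: (step_in gL ac tA).
  have -> : step L w' (s * p')%g = (a t (lz L), (w' (s * p')%g).2.+1).
    by rewrite (e p'); exact: (step_in gL ac' tA).
  by rewrite ws /sh /= addSn.
rewrite step_out//; last by move=> c h; apply: no; exists c.
rewrite step_out// => c [ac sc]; apply: no.
have cE : c = ((s * p' * c^-1)^-1 * s * p')%g by rewrite invgF -mulgA mulgVK.
move: sc ac; set t := (s * p' * c^-1)%g in cE *; move=> tA; rewrite cE => ac.
exists (t^-1 * s * p)%g; split; first exact/al.
rewrite (_ : s * p = t * (t^-1 * s * p))%g; first by rewrite mulgK.
by rewrite !mulgA mulgV mul1g.
Qed.

Definition sparse_breaks (F K : {fset G}) (k : nat) w := forall p,
  k * cnt F (fun f => ~ unbroken w K (f * p)%g) <= #|` F|.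

(** If a window meets the patch [Q p], the patch lies in the unbroken piece around its centre, so
    new breaks occur only where [lA] cuts [K], and [cut] obeys the same bound. Otherwise the patch
    is unchanged. Nothing is added up. *)
Lemma sparse_breaks_step L w F K k (Q := fmulg K F) : good_level L ->
  1%g \in K -> {subset fmulg (fmulg Q (finvg Q)) (lA L) <= lN L} ->
  (forall p, k * cnt F (fun f => cut (lA L) K (f * p)%g) <= #|` F|) ->
  sparse_breaks F K k w -> sparse_breaks F K k (step L w).
Proof.
move=> gL K1 QN hcut sw p.
have FQ f : f \in F -> f \in Q by move=> fF; rewrite -[f]mul1g in_fmulg.
have [[c [q [ac qQ qA]]]|no] :=
    pselect (exists c q, [/\ allowed L w c, q \in Q & (q * p * c^-1)%g \in lA L]).
  apply: leq_trans (hcut (p * c^-1)%g); rewrite leq_mul//.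
  apply: cnt_le => f fF nb; apply: contrapT => ncut; apply: nb.
  have wQ q' : q' \in Q -> (q' * p * c^-1)%g \in lN L.
    move=> q'Q; apply: QN.
    rewrite (_ : (q' * p * c^-1 = q' * q^-1 * (q * p * c^-1))%g).
      by apply: in_fmulg => //; apply: in_fmulg => //; exact: in_finvg.
    by rewrite !mulgA mulgVK.
  have wE q' : q' \in Q -> w (q' * p)%g = act (q' * p * c^-1)%g (w c).
    by move=> q'Q; rewrite -ac.2 ?wQ// mulgVK.
  have rfQ r : r \in K -> (r * f)%g \in Q by move=> rK; rewrite in_fmulg.
  have [[r0 r0K r0A]|none] := pselect (exists2 r, r \in K &
      (r * f * p * c^-1)%g \in lA L).
    have all r : r \in K -> (r * f * p * c^-1)%g \in lA L.
      move=> rK; apply/negPn/negP => nr; apply: ncut; split.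
        by exists r0; rewrite // !mulgA.
      by exists r; rewrite // !mulgA.
    have sE r : r \in K -> step L w (r * f * p)%g =
        act r (a (f * p * c^-1)%g (lz L), (w c).2.+1).
      move=> rK; rewrite -{1}[(r * f * p)%g](mulgVK c) step_in// ?all//.
      by rewrite mulgVK wE ?rfQ// /act /= -!mulgA actionM.
    move=> r rK; rewrite mulgA sE// -{2}[f]mul1g sE//.
    by rewrite act_act mulg1.
  (* A second window meeting the patch would share a point of [lN] with the window at [c], hence
     have the same centre. *)
  have sE r : r \in K -> step L w (r * f * p)%g = w (r * f * p)%g.
    move=> rK; rewrite step_out// => c' [ac' rA].
    suff e : c' = c by apply: none; exists r => //; rewrite -e.
    apply: (@allowed_uniq L w _ _ (r * f * p * c'^-1)%g (r * f * p * c^-1)%g) => //.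
    - exact: goodAN.
    - exact/wQ/rfQ.
    - by rewrite !mulgVK.
  move=> r rK; rewrite mulgA sE// -{2}[f]mul1g sE// mul1g.
  by rewrite wE ?rfQ// (wE f (FQ _ fF)) act_act -!mulgA.
have sE q : q \in Q -> step L w (q * p)%g = w (q * p)%g.
  by move=> qQ; rewrite step_out// => c [ac qA]; apply: no; exists c, q.
apply: leq_trans (sw p); rewrite leq_mul//; apply: cnt_le => f fF nb.
apply: contra_not nb => u r rK; rewrite sE ?FQ// -u//.
by rewrite mulgA sE ?in_fmulg.
Qed.

(* Every value of a tame family of fields is, locally in [x], either read off
   the orbit of [x] or constant. *)
Definition tame (W : X -> field) := forall x p,
  (\forall y \near x, W y p = (a p y, 0)) \/
  ((0 < (W x p).2) /\ \forall y \near x, W y p = W x p).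

Lemma tame_orb : tame orb.
Proof. by move=> x p; left; apply: nearW. Qed.

Lemma tame_near_clopen W (C : set X) : tame W -> clopen C -> forall x p,
  \forall y \near x, (C (W y p).1 <-> C (W x p).1).
Proof.
move=> tW [oC cC] x p; case: (tW x p) => [h|[_ h]]; last first.
  by apply: filterS h => y ->.
have hx := nbhs_singleton h.
have [Cx|nCx] := pselect (C (a p x)).
  have : \forall y \near x, C (a p y).
    by apply: (@action_continuous p x C); exact: open_nbhs_nbhs.
  by apply: filterS2 h => y -> Cy; rewrite hx.
have : \forall y \near x, ~ C (a p y).
  apply: (@action_continuous p x (~` C)); apply: open_nbhs_nbhs.
  by split => //; exact: closed_openC.
by apply: filterS2 h => y -> Cy; rewrite hx.
Qed.

(** In the two mixed cases one count is 0 and the other positive, so the equation fails at [x] and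
    at all nearby points alike. *)
Lemma tame_near_unbroken W S : tame W -> forall x c,
  \forall y \near x, (unbroken (W y) S c <-> unbroken (W x) S c).
Proof.
move=> tW x c.
have near1 n : \forall y \near x,
    (W y (n * c)%g = act n (W y c) <-> W x (n * c)%g = act n (W x c)).
  case: (tW x c) (tW x (n * c)%g) => [h1|[p1 h1]] [h2|[p2 h2]].
  - have e1 := nbhs_singleton h1; have e2 := nbhs_singleton h2.
    near=> y; rewrite (near h1 y)// (near h2 y)// e1 e2.
    by rewrite /act /= !actionM.
  - have e1 := nbhs_singleton h1.
    near=> y; rewrite (near h1 y)// (near h2 y)// e1.
    by split => e; move: p2; rewrite e.
  - have e2 := nbhs_singleton h2.
    near=> y; rewrite (near h1 y)// (near h2 y)// e2.
    by split => -[_ e]; move: p1; rewrite -e.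
  - by near=> y; rewrite (near h1 y)// (near h2 y).
have /(_ S) : forall s : seq G, \forall y \near x, forall n, n \in s ->
    (W y (n * c)%g = act n (W y c) <-> W x (n * c)%g = act n (W x c)).
  elim=> [|m s IH]; first by apply: nearW => y n.
  apply: filterS2 (near1 m) IH => y hm IH n.
  by rewrite in_cons => /orP[/eqP ->|/IH].
by apply: filterS => y h; split=> u n nS; have [h1 h2] := h _ nS; [apply: h1|apply: h2]; apply: u.
Unshelve. all: by end_near. Qed.

Lemma tame_step L W : good_level L -> clopen (lC L) ->
  tame W -> tame (fun x => step L (W x)).
Proof.
move=> gL cC tW x p.
have nal c : \forall y \near x, (allowed L (W y) c <-> allowed L (W x) c).
  apply: filterS2 (tame_near_clopen tW cC x c) (tame_near_unbroken (lN L) tW x c).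
  by move=> y h1 h2; rewrite /allowed; tauto.
have : \forall y \near x, forall t, t \in lA L ->
    (allowed L (W y) (t^-1 * p)%g <-> allowed L (W x) (t^-1 * p)%g).
  have /(_ (lA L)) : forall s : seq G, \forall y \near x, forall t, t \in s ->
      (allowed L (W y) (t^-1 * p)%g <-> allowed L (W x) (t^-1 * p)%g).
    elim=> [|t s IH]; first by apply: nearW => y n.
    apply: filterS2 (nal (t^-1 * p)%g) IH => y hm IH n.
    by rewrite in_cons => /orP[/eqP ->|/IH].
  by [].
move=> hal.
have depth : \forall y \near x, (W y p).2 = (W x p).2.
  case: (tW x p) => [h|[_ h]]; last by apply: filterS h => y ->.
  by have e := nbhs_singleton h; apply: filterS h => y ->; rewrite e.
have [[c [ac pc]]|no] := pselect (exists c, in_window L (W x) p c).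
  have pE : p = (p * c^-1 * c)%g by rewrite mulgVK.
  have cE : ((p * c^-1)^-1 * p = c)%g by rewrite invgF mulgVK.
  right; rewrite {1}pE step_in//; split => //.
  near=> y; have ay : allowed L (W y) c.
    have := near hal y => /(_ _ _ pc); rewrite cE => /(_ _)[]//.
    by move=> _; apply.
  rewrite pE step_in// step_in// -pE; congr pair.
  by rewrite (near depth y).
have hout : \forall y \near x, step L (W y) p = W y p.
  apply: filterS hal => y hy; apply: step_out => c [ac pc]; apply: no.
  exists c; split => //; have := (hy _ pc).1; rewrite invgF mulgVK; exact.
case: (tW x p) => [h|[d h]].
  by left; apply: filterS2 hout h => y ->.
right; rewrite step_out; last by move=> c h'; apply: no; exists c.
by split => //; apply: filterS2 hout h => y ->.
Unshelve. all: by end_near. Qed.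

Definition reader := field -> G -> nat -> bool.

Definition reader_local (T : reader) M := forall w w' p p' d,
  (forall m, m \in M -> w (m * p)%g = sh d (w' (m * p')%g)) ->
  T w p = T w' p'.

Definition reader_tame (T : reader) := forall W, tame W ->
  forall x p i, \forall y \near x, T (W y) p i = T (W x) p i.

Variable b : nat -> X -> bool.
Hypothesis bc : forall i x, \forall y \near x, b i y = b i x.

Definition reader0 : reader := fun w p i => b i (w p).1.

(** The new level acts first and the older reader [T] on its outcome: what gets planted is the older
    approximation of the source. Indices from [s] on show the field before the step. *)
Definition reader_step L (s : nat) (T : reader) : reader := fun w p i =>
  if i < s then T (step L w) p i else b i (w p).1.

Lemma reader0_local : reader_local reader0 [fset 1%g]%fset.
Proof.
move=> w w' p p' d h; rewrite /reader0; apply/funext => i.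
by have := h 1%g; rewrite !mul1g inE eqxx => /(_ isT) ->.
Qed.

Lemma reader_step_local L s T M : good_level L -> 1%g \in M ->
  reader_local T M -> reader_local (reader_step L s T) (reach L M).
Proof.
move=> gL M1 lT w w' p p' d h; apply/funext => i; rewrite /reader_step.
case: ifP => _.
  have -> // := lT (step L w) (step L w') p p' d; exact: step_local h.
have := h 1%g; rewrite !mul1g => -> //.
by rewrite -[1%g]mul1g in_fmulg// !inE eqxx.
Qed.

Lemma tame_read W : tame W ->
  forall x p i, \forall y \near x, b i (W y p).1 = b i (W x p).1.
Proof.
move=> tW x p i; case: (tW x p) => [h|[_ h]]; last by apply: filterS h => y ->.
have e := nbhs_singleton h.
have : \forall y \near x, b i (a p y) = b i (a p x).
  exact: (@action_continuous p x _ (bc i (a p x))).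
by apply: filterS2 h => y ->; rewrite e.
Qed.

Lemma reader0_tame : reader_tame reader0.
Proof. by move=> W tW x p i; exact: tame_read. Qed.

Lemma reader_step_tame L s T : good_level L -> clopen (lC L) ->
  reader_tame T -> reader_tame (reader_step L s T).
Proof.
move=> gL cC tT W tW x p i; rewrite /reader_step; case: ifP => _.
  exact: (tT _ (tame_step gL cC tW)).
exact: tame_read.
Qed.

End fields.

(** * Spaces coded by locally constant maps *)

Section compact_covers.
Variable T : ptopologicalType.
Hypothesis cT : compact [set: T].

Lemma compact_finite_choice (P : T -> set T -> Prop) :
  (forall x, exists2 U, open_nbhs x U & P x U) ->
  exists (s : seq T) (U : T -> set T),
    (forall x, open_nbhs x (U x) /\ P x (U x)) /\
    forall x, exists2 y, y \in s & U y x.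
Proof.
move=> h; pose U x := projT1 (cid2 (h x)).
have hU x : open_nbhs x (U x) /\ P x (U x) by rewrite /U; case: cid2.
have cT' := cT; rewrite compact_cover in cT'.
have [|x _|s _ sc] := cT' T setT U.
- by move=> x _; have [[]] := hU x.
- by exists x => //; have [[]] := hU x.
exists s, U; split => // x; have [y /= ys Uyx] := sc x I.
by exists y.
Qed.

End compact_covers.

Definition agree (T : Type) (c : nat -> T -> bool) n (x y : T) :=
  forall i, (i < n)%N -> c i x = c i y.

Definition locally_constant (T : topologicalType) (U : Type) (h : T -> U) :=
  forall x, \forall y \near x, h y = h x.

(* A space with locally constant maps [c i] to [bool] separating its points;
   when compact it is a closed subset of the Cantor space. *)
Record coded (T : topologicalType) (c : nat -> T -> bool) : Prop := Coded
  { coded_compact : compact [set: T];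
    coded_lc : forall i, locally_constant (c i);
    coded_sep : forall x y, x <> y -> exists i, c i x <> c i y }.

Lemma locally_constant_clopen (T : topologicalType) (U : Type) (h : T -> U)
  (P : set U) : locally_constant h -> clopen (h @^-1` P).
Proof.
move=> lh; split.
  by rewrite openE => x Px; apply: filterS (lh x) => y; rewrite /preimage /= => ->.
rewrite -openC openE => x Px.
by apply: filterS (lh x) => y e; rewrite /preimage /= e.
Qed.

Lemma clopen_locally_constant (T : topologicalType) (A : set T) : clopen A ->
  forall x, \forall y \near x, A y <-> A x.
Proof.
move=> [oA cA] x; have [Ax|nAx] := pselect (A x).
  have : nbhs x A by exact: open_nbhs_nbhs.
  by apply: filterS => y.
have : nbhs x (~` A) by apply: open_nbhs_nbhs; split => //; exact: closed_openC.
by apply: filterS => y.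
Qed.

Section coded.
Variables (T : ptopologicalType) (c : nat -> T -> bool).
Hypothesis cc : coded c.

Lemma agree_locally_constant n x : \forall y \near x, agree c n y x.
Proof.
elim: n => [|n IH]; first exact: nearW.
apply: filterS2 (coded_lc cc n x) IH => y hy IH i; rewrite ltnS leq_eqVlt.
by move=> /orP[/eqP ->|/IH].
Qed.

Lemma agree_open n x : open (agree c n x).
Proof.
rewrite openE => y xy; apply: filterS (agree_locally_constant n y) => z zy i ni.
by rewrite xy// zy.
Qed.

Lemma agree_le m n x y : (m <= n)%N -> agree c n x y -> agree c m x y.
Proof. by move=> mn h i im; apply: h; exact: leq_trans mn. Qed.

(** The open sets on which [c i] differs from its value at [x] cover the compact set [D], so
    finitely many indices suffice. *)
Lemma coded_closed_base (D : set T) x : closed D -> ~ D x ->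
  exists n, forall y, agree c n x y -> ~ D y.
Proof.
move=> cD Dx.
have cD' : compact D by exact: subclosed_compact (coded_compact cc) _.
rewrite compact_cover in cD'.
have [|y Dy|s _ sc] := cD' nat setT (fun i => [set y | c i y <> c i x]).
- by move=> i _; case: (locally_constant_clopen [set b | b <> c i x] (coded_lc cc i)).
- have /(coded_sep cc)[i ne] : y <> x by move=> e; apply: Dx; rewrite -e.
  by exists i.
exists (\max_(i <- s) i).+1 => y xy Dy.
have [i /= si] := sc y Dy; apply; rewrite xy// ltnS.
exact: leq_bigmax_seq.
Qed.

Lemma coded_base x U : nbhs x U -> exists n, forall y, agree c n x y -> U y.
Proof.
rewrite nbhsE => -[V [oV Vx] VU].
have [||n hn] := @coded_closed_base (~` V) x; [exact: open_closedC|by move=> /(_ Vx)|].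
by exists n => y /hn nV; apply: VU; apply: contrapT.
Qed.

Lemma coded_nbhsP x U : nbhs x U <-> exists n, forall y, agree c n x y -> U y.
Proof.
split=> [|[n h]]; first exact: coded_base.
by apply: filterS h _; apply: open_nbhs_nbhs; split => //; exact: agree_open.
Qed.

Lemma coded_determines (U : Type) (h : T -> U) : locally_constant h ->
  exists n, forall x y, agree c n x y -> h x = h y.
Proof.
move=> lh.
have [|s [V [hV sV]]] := @compact_finite_choice T (coded_compact cc)
    (fun x V => exists n, forall y z, V y -> agree c n y z -> h y = h z).
  move=> x; have [n hn] := coded_base (lh x).
  exists (agree c n x); first by split => //; exact: agree_open.
  exists n => y z xy yz; rewrite hn// hn// => i ni.
  by rewrite xy// yz.
pose n x := projT1 (cid (hV x).2).
have hn x : forall y z, V x y -> agree c (n x) y z -> h y = h z.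
  by rewrite /n; case: cid.
exists (\max_(x <- s) n x) => x y xy.
have [x0 x0s Vx] := sV x.
apply: (hn x0) => //; apply: agree_le xy.
exact: leq_bigmax_seq.
Qed.

Lemma coded_zero_dimensional : zero_dimensional T.
Proof.
move=> x y /eqP/(coded_sep cc)[i ne]; exists [set z | c i z = c i x]; split => //.
- exact: (locally_constant_clopen [set b | b = c i x] (coded_lc cc i)).
- by move=> /= /esym.
Qed.

Lemma coded_continuous_uniform (R : realType) (f : T -> R) (e : R) :
  continuous f -> 0 < e -> exists n, forall x y, agree c n x y -> `|f x - f y| < e.
Proof.
move=> cf e0; have e20 : 0 < e / 2 by rewrite divr_gt0.
have [|s [V [hV sV]]] := @compact_finite_choice T (coded_compact cc)
    (fun x V => exists n, forall y z, V y -> agree c n y z -> `|f y - f z| < e).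
  move=> x; have := cf x => /cvgrPdist_lt/(_ _ e20).
  move=> /coded_base[n hn].
  exists (agree c n x); first by split => //; exact: agree_open.
  exists n => y z xy yz; rewrite -(subrKA (f x)) (splitr e).
  rewrite (le_lt_trans (ler_normD _ _))// ltrD//.
    by rewrite distrC; exact: hn.
  by apply: hn => i ni; rewrite xy// yz.
pose n x := projT1 (cid (hV x).2).
have hn x : forall y z, V x y -> agree c (n x) y z -> `|f y - f z| < e.
  by rewrite /n; case: cid.
exists (\max_(x <- s) n x) => x y xy.
have [x0 x0s Vx] := sV x.
apply: (hn x0) => //; apply: agree_le xy.
exact: leq_bigmax_seq.
Qed.

End coded.

Definition coded_metric (R : realType) (T : choiceType) (c : nat -> T -> bool)
  (_ : forall x y, x <> y -> exists i, c i x <> c i y) : Type := T.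

Section coded_metric.
Variables (R : realType) (T : choiceType) (c : nat -> T -> bool).
Hypothesis sep : forall x y, x <> y -> exists i, c i x <> c i y.

Definition first_diff (x y : T) : nat :=
  if pselect (exists i, c i x != c i y) is left h then ex_minn h else 0%N.

Definition coded_dist (x y : T) : R :=
  if x == y then 0 else (2^-1) ^+ first_diff x y.

Lemma coded_dist_agree x y n : coded_dist x y < (2^-1) ^+ n -> agree c n.+1 x y.
Proof.
rewrite /coded_dist; case: eqVneq => [-> //|xy].
rewrite /first_diff; case: pselect => [h|[]]; last first.
  by have [i ne] := sep (elimN eqP xy); exists i; apply/eqP.
case: ex_minnP => m cm hm; rewrite ltr_iXn2l ?invr_gt0// ?invf_lt1 ?ltr1n// => nm.
move=> i; rewrite ltnS => ni; apply/eqP/negPn/negP => /hm.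
by move=> /(leq_trans nm); rewrite ltnNge ni.
Qed.

Lemma agree_coded_dist x y n : agree c n x y -> coded_dist x y <= (2^-1) ^+ n.
Proof.
rewrite /coded_dist; case: eqVneq => [-> //|xy].
rewrite /first_diff; case: pselect => [h|[]]; last first.
  by have [i ne] := sep (elimN eqP xy); exists i; apply/eqP.
case: ex_minnP => m cm hm ag; rewrite ler_iXn2l ?invr_gt0// ?invf_lt1 ?ltr1n//.
by rewrite leqNgt; apply/negP => /ag /eqP; rewrite (negbTE cm).
Qed.

Lemma coded_distxx x : coded_dist x x = 0.
Proof. by rewrite /coded_dist eqxx. Qed.

Lemma coded_dist_eq0 x y : coded_dist x y = 0 -> x = y.
Proof.
rewrite /coded_dist; case: eqVneq => // _ /eqP.
by rewrite expf_eq0 invr_eq0 pnatr_eq0 andbF.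
Qed.

Lemma coded_dist_sym x y : coded_dist x y = coded_dist y x.
Proof.
rewrite /coded_dist eq_sym; case: eqVneq => // _; congr (_ ^+ _).
rewrite /first_diff; case: pselect => [h|h]; case: pselect => [h'|h'] //.
- by apply: eq_ex_minn => i; rewrite eq_sym.
- by case: h'; case: h => i; rewrite eq_sym; exists i.
- by case: h; case: h' => i; rewrite eq_sym; exists i.
Qed.

Lemma coded_dist_triangle y x z :
  coded_dist x z <= coded_dist x y + coded_dist y z.
Proof.
have d0 u v : 0 <= coded_dist u v.
  by rewrite /coded_dist; case: ifP => // _; rewrite exprn_ge0 ?invr_ge0.
have [->|xy] := eqVneq x y; first by rewrite coded_distxx add0r.
have [->|yz] := eqVneq y z; first by rewrite coded_distxx addr0.
pose m := minn (first_diff x y) (first_diff y z).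
have ag u v : u != v -> (m <= first_diff u v)%N -> agree c m u v.
  move=> uv; rewrite /first_diff; case: pselect => [h|[]]; last first.
    by have [i ne] := sep (elimN eqP uv); exists i; apply/eqP.
  case: ex_minnP => k ck hk mk i im; apply/eqP/negPn/negP => /hk.
  by rewrite leqNgt (leq_trans im mk).
have : coded_dist x z <= (2^-1) ^+ m.
  apply: agree_coded_dist => i im.
  by rewrite (ag x y)// ?geq_minl// (ag y z)// geq_minr.
move=> /le_trans; apply; rewrite /m; case: leqP => _.
  by rewrite -[leLHS]addr0 lerD// /coded_dist (negbTE xy).
by rewrite -[leLHS]add0r lerD// /coded_dist (negbTE yz).
Qed.

HB.instance Definition _ := Choice.on (coded_metric R sep).
HB.instance Definition _ := @isMetric.Build R (coded_metric R sep) coded_dist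
  coded_distxx coded_dist_eq0 coded_dist_sym coded_dist_triangle.

End coded_metric.

Lemma coded_metrizable (R : realType) (T : ptopologicalType) (c : nat -> T -> bool) :
  coded c -> metrizable R T.
Proof.
move=> cc; pose M : metricType R := coded_metric R (coded_sep cc).
exists M, (idfun : T -> M); split.
  move=> x U /nbhs_ballP[e /= e0 eU]; apply/(coded_nbhsP cc).
  have [n hn] : exists n, (2^-1 : R) ^+ n < e.
    have := @cvg_expr R (2^-1); rewrite ger0_norm ?invr_ge0// invf_lt1 ?ltr1n//.
    move=> /(_ isT) /cvgrPdist_lt/(_ _ e0)[n _ /(_ n (leqnn n))].
    by rewrite sub0r normrN ger0_norm ?exprn_ge0 ?invr_ge0//; exists n.
  exists n => y xy; apply: eU; rewrite ballEmdist /=.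
  by apply: le_lt_trans hn; exact: (agree_coded_dist _ (coded_sep cc)).
exists (idfun : M -> T); split => // x U /(coded_base cc)[n hn].
apply/nbhs_ballP; exists ((2^-1) ^+ n) => /=; first by rewrite exprn_gt0 ?invr_gt0.
move=> y; rewrite ballEmdist /= => /(coded_dist_agree (coded_sep cc)) h.
by apply: hn; exact: agree_le h.
Qed.

Lemma metrizable_hausdorff (R : realType) (T : topologicalType) :
  metrizable R T -> hausdorff_space T.
Proof.
move=> [M [f [cf [g [cg fK gK]]]]] x y xy.
apply: (can_inj fK); apply: (@metric_hausdorff R M) => A B nA nB.
have [z [Az Bz]] := xy _ _ (cf _ _ nA) (cf _ _ nB).
by exists (f z).
Qed.

Lemma exists_code (R : realType) (T : ptopologicalType) :
  compact [set: T] -> metrizable R T -> zero_dimensional T ->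
  exists b : nat -> T -> bool, forall s, coded (fun i => b (s + i)%N).
Proof.
move=> cT mT zT; have hT := metrizable_hausdorff mT.
have bT := (zero_dimensional_clopen_base hT cT).1 zT.
have [M [f [cf [g [cg fK gK]]]]] := mT.
have cover n : exists s : seq (set T), (forall A, A \in s -> clopen A /\
    forall x y, A x -> A y -> ball (f x) n.+1%:R^-1 (f y)) /\
    forall x, exists2 A, A \in s & A x.
  have [|s [U [hU sU]]] := @compact_finite_choice T cT (fun x U => clopen U /\
      forall x y, U x -> U y -> ball (f x) n.+1%:R^-1 (f y)).
    move=> x; have e0 : 0 < (n.+1%:R^-1 / 2 : R) by rewrite divr_gt0 ?invr_gt0.
    have [V [cV Vx VU]] := bT x _ (cf x _ (nbhsx_ballx _ _ e0)).
    exists V; first by split => //; case: cV.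
    split => // y z Vy Vz.
    rewrite (splitr n.+1%:R^-1); apply: ball_triangle (VU _ Vz).
    by apply: ball_sym; exact: VU.
  exists [seq U x | x <- s]; split=> [_ /mapP[x _ ->]|x].
    by have [] := hU x.
  by have [y ys Uyx] := sU x; exists (U y) => //; exact: map_f.
pose sC n := projT1 (cid (cover n)).
have sCP n : (forall A, A \in sC n -> clopen A /\
    forall x y, A x -> A y -> ball (f x) n.+1%:R^-1 (f y)) /\
    forall x, exists2 A, A \in sC n & A x by rewrite /sC; case: cid.
(* The third component of the decoded triple is a dummy: it lists every clopen piece at arbitrarily
   large indices, so that each tail still separates points. *)
pose b k (x : T) := if (choice.unpickle k : option (nat * nat * nat)) is Some u then
  `[< nth set0 (sC u.1.1) u.1.2 x >] else false.
have bl k : locally_constant (b k).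
  rewrite /b; case: (choice.unpickle k) => [[[n i] j]|] x; last exact: nearW.
  have cl : clopen (nth set0 (sC n) i).
    have [isz|isz] := ltnP i (size (sC n)); last by rewrite nth_default//; exact: clopen0.
    by have [+ _] := (sCP n).1 _ (mem_nth set0 isz).
  apply: filterS (clopen_locally_constant cl x) => y /=.
  by move=> h; apply: asbool_equiv_eq.
exists b => s; split => // x y xy.
have d0 : 0 < mdist (f x) (f y).
  by rewrite mdist_gt0; apply/eqP => /(can_inj fK).
have [n hn] : exists n, n.+1%:R^-1 < mdist (f x) (f y).
  have := @cvg_harmonic R => /cvgrPdist_lt/(_ _ d0)[n _ /(_ n (leqnn n))].
  by rewrite sub0r normrN ger0_norm ?invr_ge0//; exists n.
have [A As Ax] := (sCP n).2 x.
have nAy : ~ A y.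
  move=> Ay; have [_ /(_ x y Ax Ay)] := (sCP n).1 _ As.
  by rewrite ballEmdist /= ltNge (ltW hn).
have [j hj] : exists j : nat, (s <= choice.pickle (n, index A (sC n), j))%N.
  apply: contrapT => h.
  have lt (m : nat) : (choice.pickle (n, index A (sC n), m) < s)%N.
    by rewrite ltnNge; apply/negP => ?; apply: h; exists m.
  have inj : injective (fun m : 'I_s.+1 => Ordinal (lt m)).
    move=> u v [] /(pcan_inj (@choice.pickleK (nat * nat * nat)%type)) [uv].
    exact: val_inj.
  by have := leq_card _ inj; rewrite !card_ord ltnn.
exists (choice.pickle (n, index A (sC n), j) - s)%N; rewrite subnKC// /b.
rewrite choice.pickleK /= nth_index//.
by rewrite asboolT// asboolF.
Qed.

(** * Clopen marker sets of a free action *)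

Section markers.
Variables (G : groupType) (X : ptopologicalType) (a : G -> X -> X).
Hypothesis aX : is_action a.
Hypothesis fX : free_action a.
Hypothesis cX : compact [set: X].
Hypothesis zX : zero_dimensional X.

(** Freeness and compactness give a finite cover by clopen sets without returns along [K]. They are
    added one by one, each deprived of the points from which [K] leads into the set built so far;
    symmetry of [K] excludes returns in the other direction. *)
Lemma exists_markers (K : {fset G}) :
  (forall g, g \in K -> (g^-1)%g \in K) ->
  exists C : set X, [/\ clopen C,
    forall v g, C v -> C (a g v) -> g \in K -> g = 1%g &
    forall v, exists2 g, g \in (1%g |` K)%fset & C (a g v)].
Proof.
move=> KV.
have ac g : continuous (a g) by exact: action_continuous.
have pc g (U : set X) : clopen U -> clopen (a g @^-1` U).
  by move=> ?; apply: preimage_clopen.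
have [|s [U [hU sU]]] := @compact_finite_choice X cX (fun _ U => clopen U /\
    forall v g, U v -> U (a g v) -> g \in K -> g = 1%g).
  move=> x.
  suff : forall s : seq G, exists2 U, U x & clopen U /\
      forall v g, U v -> U (a g v) -> g \in s -> g = 1%g.
    by move=> /(_ K) [U Ux [cU hU]]; exists U => //; split => //; case: cU.
  elim=> [|g s [U Ux [cU hU]]]; first by exists setT => //; split => //; exact: clopenT.
  have [->|g1] := eqVneq g 1%g.
    exists U => //; split => // v h Uv Uh.
    by rewrite in_cons => /orP[/eqP ->//|]; exact: hU Uv Uh.
  have [|W [cW Wx Wg]] := @zX x (a g x).
    by apply/eqP => /esym/fX e; rewrite e eqxx in g1.
  exists (U `&` (W `&` ~` (a g @^-1` W))) => //; split.
    by do 2 apply: clopenI => //; apply: clopenC => //; exact: pc.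
  move=> v h [Uv [Wv nv]] [Uh [Wh _]]; rewrite in_cons => /orP[/eqP hg|].
    by case: nv; rewrite /preimage /= -hg.
  exact: hU Uv Uh.
suff : forall t : seq X, exists C : set X, [/\ clopen C,
    forall v g, C v -> C (a g v) -> g \in K -> g = 1%g &
    forall v, (exists2 y, y \in t & U y v) ->
      exists2 g, g \in (1%g |` K)%fset & C (a g v)].
  move=> /(_ s) [C [cC sC dC]]; exists C; split => // v.
  by apply: dC; exact: sU.
elim=> [|y t [C [cC sC dC]]].
  by exists set0; split => //; [exact: clopen0|move=> v []].
pose near v := exists2 g, g \in K & C (a g v).
have cnear : clopen near.
  have -> : near = \big[setU/set0]_(g <- K) (a g @^-1` C).
    apply/seteqP; split=> v.
      by move=> [g gK Cg]; rewrite -bigcup_seq; exists g.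
    by rewrite -bigcup_seq => -[g /= gK Cg]; exists g.
  elim: (enum_fset K) => [|g r IH]; first by rewrite big_nil; exact: clopen0.
  by rewrite big_cons; apply: clopenU => //; exact: pc.
have [_ [cUy hUy]] := hU y.
exists (C `|` (U y `&` ~` near)); split.
- by apply: clopenU => //; apply: clopenI => //; exact: clopenC cnear.
- move=> v g [Cv|[Uv nv]] [Cg|[Ug ng]] gK.
  + exact: sC Cv Cg gK.
  + by case: ng; exists g^-1%g; [exact: KV|rewrite (actionK aX)].
  + by case: nv; exists g.
  + exact: hUy Uv Ug gK.
- move=> v [z]; rewrite in_cons => /orP[/eqP -> Uv|zt Uv].
    have [[g gK Cg]|nv] := pselect (near v).
      by exists g; [rewrite !inE gK orbT|left].
    exists 1%g; first by rewrite !inE eqxx.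
    by rewrite (action1 aX); right.
  by have [|g gK Cg] := dC v; [exists z|exists g => //; left].
Qed.

End markers.

(** * Construction of the approximations *)

Section construction.
Variables (R : realType) (G : groupType).
Hypotheses (cG : countable [set: G]) (iG : infinite_set [set: G]).
Hypothesis amG : amenable R G.
Variables (X : ptopologicalType) (a : G -> X -> X).
Hypotheses (cX : compact [set: X]) (zX : zero_dimensional X).
Hypotheses (aX : is_action a) (fX : free_action a).
Variable b : nat -> X -> bool.
Hypothesis bcoded : forall s, coded (fun i => b (s + i)%N).
Variables (E : nat -> {fset G}) (pat : nat -> seq (G * nat * bool)).
Local Open Scope nat_scope.

Definition matches (y : G -> nat -> bool) (u : seq (G * nat * bool)) :=
  forall e, e \in u -> y e.1.1 e.1.2 = e.2.

(* [sT] reads a symbolic point off a field using the levels built so far; all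
   further levels alter only the symbols of index at least [ss]; [sH] lists
   the patterns already planted.  Later windows belong to [sHer] and satisfy
   [next_QN], which keeps the breaks of the earlier levels sparse. *)
Record state := State { sT : reader G X; sM : {fset G}; sHer : {fset G} -> Prop;
  sB : {fset G}; sQ : {fset G}; sH : seq nat; ss : nat }.

Record data := Data { dL : level G X; dR : {fset G}; dF : {fset G};
  dU : {fset G} }.

Definition occurs (S : state) n := (forall e, e \in pat n -> e.1.2 < ss S) /\
  exists x, matches (sT S (orb a x)) (pat n).

Record inv_state (S : state) : Prop := InvState {
  inv_M1 : 1%g \in sM S;
  inv_local : reader_local (sT S) (sM S);
  inv_tame : reader_tame a (sT S);
  inv_thick : thick (sHer S) (sB S);
  inv_tail : forall w p i, ss S <= i -> sT S w p i = b i (w p).1 }.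

(** With [U = A^-1 M], as in [next_U], these are the points with a marker so near that a window
    could touch the neighbourhood [M] on which the symbol at 1 is read. *)
Definition window_set (d : data) : set X :=
  [set v | exists2 u, u \in dU d & lC (dL d) (a u v)].

Definition plants (S : state) (d : data) (S' : state) n :=
  [/\ occurs S n, n \notin sH S, sH S' = n :: sH S,
     matches (sT S (orb a (lz (dL d)))) (pat n) &
     (forall m, occurs S m -> m \notin sH S -> n <= m) /\
     forall e m, e \in pat n -> m \in sM S -> (m * e.1.1)%g \in lA (dL d)].

(** [next_size] and [next_F] make windows rare, [next_her_cut] makes later breaks rare. [next_det]
    permits decoding: the block of original symbols between [ss S] and [ss S'] determines whether a
    window is near, the symbols written below [ss S] and the original ones there. *)
Record next (j : nat) (S : state) (d : data) (S' : state) : Prop := Next {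
  next_good : good_level a (dL d);
  next_clopen : clopen (lC (dL d));
  next_T : sT S' = reader_step a b (dL d) (ss S) (sT S);
  next_M : sM S' = reach (dL d) (sM S);
  next_her : sHer S (lA (dL d));
  next_her_le : forall A, sHer S' A -> sHer S A;
  next_her_cut : forall A, sHer S' A -> forall p,
    2 ^ j.+1 * cnt (dF d) (fun f => cut A (dR d) (f * p)%g) <= #|` dF d|;
  next_QN : {subset fmulg (sQ S) (lA (dL d)) <= lN (dL d)};
  next_QS : {subset sQ S <= sQ S'};
  next_Q : {subset fmulg (fmulg (dR d) (dF d)) (finvg (fmulg (dR d) (dF d)))
    <= sQ S'};
  next_U : dU d = fmulg (finvg (lA (dL d))) (sM S);
  next_size : 2 ^ j.+2 * #|` dU d| <= #|` lN (dL d)|;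
  next_F0 : dF d != fset0;
  next_F : #|` fmulg (fmulg (lN (dL d)) (dU d)) (dF d)| <= 2 * #|` dF d|;
  next_R1 : 1%g \in dR d;
  next_syndetic : forall v, exists l,
    (forall n, n \in lN (dL d) -> (n * l)%g \in dR d) /\ lC (dL d) (a l v);
  next_RU : {subset fmulg (lN (dL d)) (dU d) <= dR d};
  next_RE : {subset fmulg (sM S') (E j) <= dR d};
  next_ss : ss S < ss S';
  next_det : forall v v', (forall i, ss S <= i < ss S' -> b i v = b i v') ->
    [/\ window_set d v <-> window_set d v',
       forall i, i < ss S -> sT S' (orb a v) 1%g i = sT S' (orb a v') 1%g i &
       forall i, i < ss S -> b i v = b i v'];
  next_task : (exists n, plants S d S' n) \/
    ((forall m, occurs S m -> m \in sH S) /\ sH S' = sH S) }.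

Definition state0 := State (reader0 b) [fset 1%g]%fset (fun=> True)
  [fset 1%g]%fset fset0 [::] 1.

Lemma b_lc i : locally_constant (b i).
Proof. exact: (coded_lc (bcoded 0) i). Qed.

Lemma inv_state0 : inv_state state0.
Proof.
split => //=.
- by rewrite inE.
- exact: reader0_local.
- exact: (reader0_tame aX b_lc).
- move=> A; exists A; split => // g gA.
  by rewrite -[g]mul1g in_fmulg// inE.
Qed.

Lemma big_fset n : exists2 B : {fset G}, True & n <= #|` B|.
Proof. by have [B _ ?] := infinite_set_fset n iG; exists B. Qed.

(** Each choice must dominate the preceding ones: the window shape, its neighbourhood [N], markers
    separated along [N^-1 N], a patch [F] almost invariant under [N U], and lastly a block long
    enough to determine all of this locally. *)
Lemma next_exists j S : inv_state S ->
  exists d S', next j S d S' /\ inv_state S'.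
Proof.
move=> [M1 lT tT thT tailT].
have [z [H' [core htask]]] : exists (z : X) (H' : seq nat) (core : {fset G}),
    (exists n, [/\ occurs S n, n \notin sH S, H' = n :: sH S,
       matches (sT S (orb a z)) (pat n) &
       (forall m, occurs S m -> m \notin sH S -> n <= m) /\
       forall e m, e \in pat n -> m \in sM S -> (m * e.1.1)%g \in core]) \/
    ((forall m, occurs S m -> m \in sH S) /\ H' = sH S).
  have [h|h] := pselect (exists n, `[< occurs S n /\ n \notin sH S >]).
    case: (ex_minnP h) => n /asboolP[on nH] nmin.
    have [_ [z hz]] := on.
    (* The window must contain the pattern with the neighbourhoods on which its symbols are read. *)
    exists z, (n :: sH S), (fmulg (sM S) [fset e.1.1 | e in pat n]%fset).
    left; exists n; split => //; split.
      by move=> m om mH; apply: nmin; apply/asboolP.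
    by move=> e m eu mM; apply: in_fmulg => //; apply/imfsetP; exists e.
  exists point, (sH S), fset0; right; split => // m om.
  by apply/negPn/negP => mH; apply: h; exists m; apply/asboolP.
have [A [coreA _ HA]] := thT core.
pose U := fmulg (finvg A) (sM S).
(* Infiniteness of [G] enters here: the disjoint sets [N c] must outweigh [U] by the factor
   [2^(j+2)]. *)
have [BB _ hBB] := big_fset (2 ^ j.+2 * #|` U|).
pose N := (1%g |` (A `|` (fmulg (sQ S) A `|` BB)))%fset.
pose NN := fmulg (finvg N) N.
have N1 : 1%g \in N by rewrite !inE eqxx.
have NNV g : g \in NN -> (g^-1)%g \in NN.
  move=> /fmulgP[_ [y [/finvgP[x xN ->] yN ->]]].
  by rewrite invgM invgK in_fmulg// in_finvg.
have [C [cC sC dC]] := exists_markers aX fX cX zX NNV.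
pose L := Level C N A z.
have gL : good_level a L.
  by split => //= g gA; rewrite !inE gA !orbT.
pose M' := reach L (sM S).
(* The part built from [NN] holds a marker reached from any point together with its whole [N]; the
   other parts hold what decides hits and what the next reader sees from [E j]. *)
pose Rr := (1%g |` (fmulg N (1%g |` NN) `|` (fmulg N U `|` fmulg M' (E j))))%fset.
have [F [B' [F0 hF thF]]] := thick_refine amG cG Rr (fmulg N U) thT (expn_gt0 2 j.+1).
pose T' := reader_step a b L (ss S) (sT S).
have tT' : reader_tame a T' by apply: (reader_step_tame aX b_lc).
pose d := Data L Rr F U.
pose h v := (`[< window_set d v >],
  [seq T' (orb a v) 1%g i | i <- iota 0 (ss S)], [seq b i v | i <- iota 0 (ss S)]).
have seq_lc (f : X -> nat -> bool) (r : seq nat) :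
    (forall i, locally_constant (f^~ i)) -> locally_constant (fun v => map (f v) r).
  move=> lf x; elim: r => [|i r IH]; first exact: nearW.
  by apply: filterS2 (lf i x) IH => y /= -> ->.
have lh : locally_constant h.
  have h1 : locally_constant (fun v => `[< window_set d v >]).
    have -> : (fun v => `[< window_set d v >]) =
       (fun v => has id [seq `[< C (a u v) >] | u <- (U : seq G)]).
      apply/funext => v; apply/asboolP/hasP => [[u uU Cu]|[_ /mapP[u uU ->]]].
        by exists `[< C (a u v) >]; [exact: map_f|apply/asboolP].
      by move=> /asboolP; exists u.
    move=> x; have : \forall y \near x,
        [seq `[< C (a u y) >] | u <- (U : seq G)] = [seq `[< C (a u x) >] | u <- (U : seq G)].
      elim: (U : seq G) => [|u r IH]; first exact: nearW.
      have cu : clopen (a u @^-1` C).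
        by apply: preimage_clopen => //; exact: action_continuous.
      apply: filterS2 (clopen_locally_constant cu x) IH => y /= e ->.
      by congr cons; exact: asbool_equiv_eq.
    by apply: filterS => y ->.
  have h2 := seq_lc (fun v i => T' (orb a v) 1%g i) (iota 0 (ss S))
    (fun i x => tT' _ (@tame_orb _ _ a) x 1%g i).
  have h3 := seq_lc (fun v i => b i v) (iota 0 (ss S)) b_lc.
  move=> x; have h1x := h1 x; have h2x := h2 x; have h3x := h3 x.
  near=> y; rewrite /h; congr (_, _, _).
  - by near: y.
  - by near: y.
  - by near: y.
(* The tail from [ss S] on separates points by itself, so finitely many of its symbols determine
   [h]. The new bound is [ss S + n.+1], with a successor to keep the block nonempty. *)
have [n hn] := coded_determines (bcoded (ss S)) lh.
pose S' := State T' M' (fun A => sHer S A /\ forall p,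
   2 ^ j.+1 * cnt F (fun f => cut A Rr (f * p)%g) <= #|` F|) B'
   (sQ S `|` fmulg (fmulg Rr F) (finvg (fmulg Rr F)))%fset H' (ss S + n.+1).
exists d, S'; split; last first.
  split => //=.
  - by rewrite -[1%g]mul1g in_fmulg// !inE eqxx.
  - exact: reader_step_local.
  - move=> w p i hi; rewrite /T' /reader_step ltnNge.
    by rewrite (leq_trans _ hi)// leq_addr.
split => //=.
- by move=> A' [].
- by move=> A' [].
- by move=> g gQ; rewrite !inE gQ !orbT.
- by move=> g gQ; rewrite !inE gQ.
- by move=> g gQ; rewrite !inE gQ orbT.
- apply: leq_trans hBB _; apply: leq_card_sub => g gB.
  by rewrite !inE gB !orbT.
- by rewrite !inE eqxx.
- move=> v; have [l lN Cl] := dC v; exists l; split => // m mN.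
  by rewrite !inE in_fmulg ?orbT.
- by move=> g gQ; rewrite !inE gQ !orbT.
- by move=> g gQ; rewrite !inE gQ !orbT.
- by rewrite addnS ltnS leq_addr.
- move=> v v' hv.
  have [e1 e2 e3] : h v = h v'.
    by apply: hn => i ni; apply: hv; rewrite leq_addr ltn_add2l ltnW.
  split.
  + by split=> wv; apply/asboolP; [rewrite -e1|rewrite e1]; apply/asboolP.
  + by move=> i hi; move/eq_in_map : e2 => /(_ i); rewrite mem_iota; apply.
  + by move=> i hi; move/eq_in_map : e3 => /(_ i); rewrite mem_iota; apply.
- case: htask => [[m [om mH HE mm [mmin mcore]]]|[h1 h2]]; last by right.
  left; exists m; split => //; split => // e g eu gM.
  exact/coreA/mcore.
Unshelve. all: by end_near. Qed.

Lemma exists_sequence : exists (st : nat -> state) (dt : nat -> data),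
  [/\ st 0 = state0, forall j, inv_state (st j) &
      forall j, next j (st j) (dt j) (st j.+1)].
Proof.
have /choice[f hf] : forall jS : nat * {S | inv_state S},
    exists dS : data * {S | inv_state S},
    next jS.1 (sval jS.2) dS.1 (sval dS.2).
  move=> [j [S iS]]; have [d [S' [nS iS']]] := next_exists j iS.
  by exists (d, exist _ S' iS').
pose fix st n : {S | inv_state S} :=
  if n is m.+1 then (f (m, st m)).2 else exist _ state0 inv_state0.
exists (fun n => sval (st n)), (fun n => (f (n, st n)).1); split => //.
  by move=> j; case: (st j).
by move=> j; exact: (hf (j, st j)).
Qed.

End construction.

Lemma coded_limit (T : ptopologicalType) (c : nat -> T -> bool) (u : nat -> T) :
  coded c -> (forall n m, (n <= m)%N -> agree c n (u n) (u m)) ->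
  exists x, forall n, agree c n (u n) x.
Proof.
move=> cc hu; apply: contrapT => no.
have cT := coded_compact cc; rewrite compact_cover in cT.
have [n _|x _|s _ sc] := cT nat setT (fun n => ~` agree c n (u n)).
- have lc : locally_constant (fun x => `[< agree c n (u n) x >]).
    move=> x; apply: filterS (agree_locally_constant cc n x) => y yx.
    apply: asbool_equiv_eq; split=> h i ni; first by rewrite h// yx.
    by rewrite h// yx.
  have [+ _] := locally_constant_clopen (fun b : bool => ~~ b) lc.
  congr open; apply/seteqP; split=> x /=; first by move=> /asboolP.
  by move=> h; apply/negP => /asboolP.
- have /existsNP[n hn] : ~ forall n, agree c n (u n) x.
    by move=> h; apply: no; exists x.
  by exists n.
have [n /= ns []] := sc (u (\max_(n <- s) n)) I.
by apply: hu; exact: leq_bigmax_seq.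
Qed.

(** * Density estimates, planting and decoding *)

Section consequences.
Variables (R : realType) (G : groupType).
Variables (X : ptopologicalType) (a : G -> X -> X).
Hypothesis aX : is_action a.
Variable b : nat -> X -> bool.
Hypothesis bcoded : forall s, coded (fun i => b (s + i)%N).
Variables (E : nat -> {fset G}) (pat : nat -> seq (G * nat * bool)).
Hypothesis E1 : forall j, 1%g \in E j.
Hypothesis Eev : forall g, exists j0, forall j, (j0 <= j)%N -> g \in E j.
Variables (st : nat -> state G X) (dt : nat -> data G X).
Hypothesis st0 : st 0 = state0 G b.
Hypothesis inv_st : forall j, inv_state a b (st j).
Hypothesis next_st : forall j, next a b E pat j (st j) (dt j) (st j.+1).
Local Open Scope nat_scope.

Definition approx j (x : X) : G -> nat -> bool := sT (st j) (orb a x).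
Definition shift (y : G -> nat -> bool) (p : G) : G -> nat -> bool :=
  fun g i => y (g * p)%g i.
Definition hits j : set X := window_set a (dt j).
(** The counterpart, for symbolic points, of not being hit. It depends on finitely many coordinates
    of [y], so its frequency passes to limit points. *)
Definition good j (y : G -> nat -> bool) := exists v, ~ hits j v /\
  forall g i, g \in E j -> i < ss (st j.+1) -> y g i = approx j.+1 v g i.

Lemma ss_lt j : ss (st j) < ss (st j.+1). Proof. by case: (next_st j). Qed.

Lemma ss_le j k : j <= k -> ss (st j) <= ss (st k).
Proof.
elim: k => [|k IH]; first by rewrite leqn0 => /eqP ->.
rewrite leq_eqVlt => /orP[/eqP -> //|]; rewrite ltnS => /IH h.
exact: leq_trans h (ltnW (ss_lt k)).
Qed.

Lemma ss_ge j : j <= ss (st j).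
Proof. by elim: j => // j IH; apply: leq_ltn_trans IH (ss_lt j). Qed.

Lemma sHer_le j k A : j <= k -> sHer (st k) A -> sHer (st j) A.
Proof.
elim: k => [|k IH]; first by rewrite leqn0 => /eqP ->.
rewrite leq_eqVlt => /orP[/eqP -> //|]; rewrite ltnS => /IH h hA; apply: h.
exact: (next_her_le (next_st k)).
Qed.

Lemma sQ_le j k : j <= k -> {subset sQ (st j) <= sQ (st k)}.
Proof.
elim: k => [|k IH]; first by rewrite leqn0 => /eqP ->.
rewrite leq_eqVlt => /orP[/eqP -> //|]; rewrite ltnS => /IH h g gQ.
exact/(next_QS (next_st k))/h.
Qed.

Local Notation sparse j := (sparse_breaks a (dF (dt j)) (dR (dt j)) (2 ^ j.+1)).

Lemma sparse_orb j x : sparse j (orb a x).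
Proof.
move=> p; rewrite cnt0 ?muln0// => f _; apply.
exact: (unbroken_orb aX).
Qed.

Lemma sparse_step j k w : j < k -> sparse j w -> sparse j (step a (dL (dt k)) w).
Proof.
move=> jk; have nj := next_st j; have nk := next_st k.
apply: (sparse_breaks_step aX (next_good nk) (next_R1 nj)).
  move=> g gQ; apply: (next_QN nk); apply: fmulgSl gQ => h hQ.
  exact/(sQ_le jk)/(next_Q nj).
exact/(next_her_cut nj)/(sHer_le jk)/(next_her nk).
Qed.

(** The levels [k-1], ..., [j+1] are absorbed into the field [w']; all that is remembered of them is
    that [w'] is rarely broken at scale [j]. *)
Lemma read_through j k w : j < k -> sparse j w ->
  exists2 w', sparse j w' & forall p i, i < ss (st j.+1) ->
    sT (st k) w p i = sT (st j.+1) w' p i.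
Proof.
elim: k w => // k IH w; rewrite ltnS leq_eqVlt => /orP[/eqP -> hw|jk hw].
  by exists w.
have [w' hw' e] := IH _ jk (sparse_step jk hw).
exists w' => // p i hi; rewrite -e// (next_T (next_st k)) /reader_step.
by rewrite (leq_trans hi (ss_le jk)).
Qed.

Lemma approx_read j S w p : unbroken a w (fmulg (sM (st j)) S) p ->
  forall g, g \in S -> sT (st j) w (g * p)%g = approx j (w p).1 g.
Proof.
move=> u g gS; apply: (inv_local (inv_st j) (d := (w p).2)) => m mM.
by rewrite mulgA u ?in_fmulg// /sh /act /orb /= add0n.
Qed.

Lemma approx_shift j x g : shift (approx j x) g = approx j (a g x).
Proof.
apply/funext => p; apply: (inv_local (inv_st j) (d := 0)) => m _.
by rewrite /sh /orb /= -(actionM aX) !mulgA.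
Qed.

(** Each such [f] leads by an element of [U] to an allowed centre, and the sets [N c] of distinct
    centres are disjoint inside [N U F p]. The count is thus at most [#|U|] times [2 * #|F| / #|N|],
    which [next_size] bounds. *)
Lemma windows_sparse j w p : 2 ^ j.+1 * cnt (dF (dt j)) (fun f =>
  unbroken a w (dR (dt j)) (f * p)%g /\ hits j (w (f * p)%g).1) <= #|` dF (dt j)|.
Proof.
have nj := next_st j; have gL := next_good nj.
set F := dF _; set U := dU (dt j); set N := lN (dL (dt j)); set L := dL (dt j).
pose Cs := [fset c in fmulg U (fmulg F [fset p]) | `[< allowed a L w c >]]%fset.
have c1 : cnt F (fun f => unbroken a w (dR (dt j)) (f * p)%g /\
    hits j (w (f * p)%g).1) <= #|` U| * #|` Cs|.
  rewrite -(card_finvg U); apply: leq_trans (card_fmulg _ _).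
  apply: (@cnt_card_inj _ _ _ _ (fun f => f * p)%g); first by move=> x y _ _ /mulIg.
  move=> f fF [uf [u uU Cu]].
  rewrite -[(f * p)%g](mulKg u); apply: in_fmulg; first exact: in_finvg.
  rewrite !inE /=; apply/andP; split; first by rewrite !in_fmulg// inE.
  have uR n : n \in N -> (n * u)%g \in dR (dt j).
    by move=> nN; apply: (next_RU nj); rewrite in_fmulg.
  have wu : w (u * (f * p))%g = act a u (w (f * p)%g).
    by rewrite -uf// -[u]mul1g uR//; exact: goodN1 gL.
  apply/asboolP; split; first by rewrite wu.
  by move=> n nN; rewrite wu (act_act aX) -uf ?uR// !mulgA.
have c2 : #|` N| * #|` Cs| <= 2 * #|` F|.
  apply: leq_trans (next_F nj); rewrite -/F -/U -/N -/L.
  rewrite -[leqRHS](card_fmulg1 _ p) -!fmulgA.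
  rewrite -[leqLHS](size_allpairs (fun x y => x * y)%g N Cs).
  apply: uniq_leq_size.
    apply: allpairs_uniq; [exact: fset_uniq|exact: fset_uniq|].
    move=> [n c] [n' c'] /allpairsP[[n1 c1'] /= [nN + [-> ->]]].
    rewrite !inE /= => /andP[_ /asboolP ac].
    move=> /allpairsP[[n2 c2'] /= [nN' + [-> ->]]].
    rewrite !inE /= => /andP[_ /asboolP ac'] e.
    have ec := allowed_uniq aX gL ac ac' nN nN' e.
    by move: e; rewrite ec => /mulIg ->.
  move=> _ /allpairsP[[n c] /= [nN + ->]]; rewrite !inE /= => /andP[cU _].
  exact: in_fmulg.
have := next_size nj; rewrite -/F -/U -/N -/L.
move: c1 c2; rewrite (expnS 2 j.+1).
have N0 : 0 < #|` N| by rewrite cardfs_gt0; apply/fset0Pn; exists 1%g; exact: goodN1 gL.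
move: (cnt _ _) (#|` U|) (#|` Cs|) (#|` N|) (#|` F|) (2 ^ j.+1) N0.
move=> c u s n f t n0 h1 h2 h3.
rewrite -(leq_pmul2l n0).
apply: (@leq_trans (n * (t * (u * s)))); first by rewrite !leq_mul.
have h4 : 2 * t * u * s <= n * s by rewrite leq_mul.
have h5 : n * (2 * (t * u * s)) <= n * (n * s) by rewrite leq_mul// !mulnA.
have h6 : n * (n * s) <= n * (2 * f) by rewrite leq_mul.
move: (leq_trans h5 h6); rewrite ![n * (2 * _)]mulnCA leq_pmul2l//.
by rewrite !mulnA.
Qed.

(** Where [w] is unbroken on [dR] and its point is not hit, that point witnesses goodness; either
    exception has proportion at most [2^-(j+1)]. *)
Lemma good_frequent j k x p : j < k -> 2 ^ j * cnt (dF (dt j)) (fun f =>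
  ~ good j (shift (approx k x) (f * p)%g)) <= #|` dF (dt j)|.
Proof.
move=> jk; have nj := next_st j.
have [w sw rw] := read_through jk (sparse_orb j x).
have le : cnt (dF (dt j)) (fun f => ~ good j (shift (approx k x) (f * p)%g)) <=
    cnt (dF (dt j)) (fun f => ~ unbroken a w (dR (dt j)) (f * p)%g) +
    cnt (dF (dt j)) (fun f => unbroken a w (dR (dt j)) (f * p)%g /\
      hits j (w (f * p)%g).1).
  apply: leq_trans (cnt_or _ _ _); apply: cnt_le => f fF ng.
  have [u|] := pselect (unbroken a w (dR (dt j)) (f * p)%g); last by left.
  right; split => //; apply: contrapT => nh; apply: ng.
  exists (w (f * p)%g).1; split => // g i gE hi.
  rewrite /shift /approx rw//.
  have u' : unbroken a w (fmulg (sM (st j.+1)) (E j)) (f * p)%g.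
    by move=> m mE; apply: u; exact: (next_RE nj).
  by rewrite (approx_read u').
have h1 := sw p; have h2 := windows_sparse j w p.
move: le h1 h2; rewrite !(expnS 2 j).
move: (cnt _ _) (cnt _ _) (cnt _ _) (#|` _|) (2 ^ j) => c1 c2 c3 f t.
move=> le h1 h2; apply: leq_trans (leq_mul (leqnn t) le) _.
by rewrite mulnDr; lia.
Qed.

Lemma hits_frequent j x :
  2 ^ j * cnt (dF (dt j)) (fun f => hits j (a f x)) <= #|` dF (dt j)|.
Proof.
apply: leq_trans (windows_sparse j (orb a x) 1%g).
apply: leq_mul; first by rewrite leq_exp2l.
apply: cnt_le => f fF h; split; first exact: (unbroken_orb aX).
by rewrite mulg1.
Qed.

Lemma approx_unhit j v i : ~ hits j v -> approx j.+1 v 1%g i = approx j v 1%g i.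
Proof.
move=> nh; have nj := next_st j; rewrite /approx (next_T nj) /reader_step.
case: ltnP => hi; last by rewrite (inv_tail (inv_st j)).
have -> // := @inv_local _ _ _ _ _ (inv_st j) (step a (dL (dt j)) (orb a v))
  (orb a v) 1%g 1%g 0.
move=> m mM; rewrite step_out; first by rewrite /sh addn0; case: (orb a v _).
move=> c [[Cc _] mA]; apply: nh; exists c => //.
rewrite (next_U nj) (_ : c = (m * 1 * c^-1)^-1 * m)%g.
  by apply: in_fmulg => //; exact: in_finvg.
by rewrite mulg1 invgF mulgVK.
Qed.

Lemma approx_tail j v i : ss (st j) <= i -> approx j v 1%g i = b i v.
Proof.
by move=> hi; rewrite /approx (inv_tail (inv_st j))//= (action1 aX).
Qed.

Lemma approx_block j v i : ss (st j) <= i -> approx j.+1 v 1%g i = b i v.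
Proof.
move=> hi; rewrite /approx (next_T (next_st j)) /reader_step ltnNge hi /=.
by rewrite (action1 aX).
Qed.

Lemma approx_lc j g i : locally_constant (fun x => approx j x g i).
Proof. by move=> x; exact: (inv_tame (inv_st j) (@tame_orb _ _ a)). Qed.

(** A proportion [2^-(j+1)] of breaks leaves some place of [F] unbroken on [R]; within [R] there is
    then a marker with its whole neighbourhood, hence a window carrying the pattern. *)
Lemma planted_syndetic j n : plants a pat (st j) (dt j) (st j.+1) n ->
  exists V : {fset G}, forall k x, j < k -> exists2 q, q \in V &
    matches (shift (approx k x) q) (pat n).
Proof.
move=> [[pn _] _ _ mz [_ core]]; have nj := next_st j; have gL := next_good nj.
exists (fmulg (dR (dt j)) (dF (dt j))) => k x jk.
have [w sw rw] := read_through jk (sparse_orb j x).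
have [f fF uf] : exists2 f, f \in dF (dt j) & unbroken a w (dR (dt j)) f.
  apply: contrapT => no.
  have := sw 1%g; rewrite cntT; last first.
    by move=> f fF u; apply: no; exists f => //; rewrite -[f]mulg1.
  rewrite leqNgt => /negP; apply.
  rewrite -[ltnLHS]mul1n ltn_pmul2r ?cardfs_gt0 ?(next_F0 nj)//.
  by rewrite -[1](expn0 2) ltn_exp2l.
have [l [lN Cl]] := next_syndetic nj (w f).1.
have lR : l \in dR (dt j) by rewrite -[l]mul1g lN//; exact: goodN1 gL.
exists (l * f)%g; first exact: in_fmulg.
have wl : w (l * f)%g = act a l (w f) by rewrite uf.
have al : allowed a (dL (dt j)) w (l * f)%g.
  split; first by rewrite wl.
  by move=> m mN; rewrite wl (act_act aX) -uf ?lN// mulgA.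
move=> [[g i] v] eu /=; have /= hi := pn _ eu; have /= <- := mz _ eu.
rewrite /shift /approx rw; last exact: ltn_trans hi (ss_lt j).
rewrite (next_T nj) /reader_step hi.
have -> // := @inv_local _ _ _ _ _ (inv_st j) (step a (dL (dt j)) w)
  (orb a (lz (dL (dt j)))) (g * (l * f))%g g (w (l * f)%g).2.+1.
move=> m mM; have /= mgA := core _ _ eu mM.
rewrite mulgA (step_in aX gL al mgA) /sh /orb /=.
by rewrite al.2 ?add0n//; exact: goodAN gL _ mgA.
Qed.

Lemma planted_in n k : n \in sH (st k) -> exists j, plants a pat (st j) (dt j) (st j.+1) n.
Proof.
elim: k => [|k IH]; first by rewrite st0.
case: (next_task (next_st k)) => [[m pm]|[_ ->] //].
have [_ _ -> _ _] := pm; rewrite in_cons => /orP[/eqP ->|//].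
by exists k.
Qed.

Lemma sH_le j k n : j <= k -> n \in sH (st j) -> n \in sH (st k).
Proof.
elim: k => [|k IH]; first by rewrite leqn0 => /eqP ->.
rewrite leq_eqVlt => /orP[/eqP -> //|]; rewrite ltnS => /IH h /h nk.
case: (next_task (next_st k)) => [[m [_ _ -> _ _]]|[_ ->] //].
by rewrite in_cons nk orbT.
Qed.

(** Priority of the least index: past some stage no pattern of index below [n] is planted any more,
    so when pattern [n] occurs again unplanted, it is the least candidate. *)
Lemma recurrent_planted n :
  (forall K, exists k x, K <= k /\ matches (approx k x) (pat n)) ->
  exists j, plants a pat (st j) (dt j) (st j.+1) n.
Proof.
move=> h; apply: contrapT => np.
have nH k : n \notin sH (st k) by apply/negP => /planted_in.
have [K hK] : exists K, forall m k, m < n -> K <= k ->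
    ~ plants a pat (st k) (dt k) (st k.+1) m.
  elim: (n) => [|m [K IH]]; first by exists 0.
  have [[j pj]|no] := pselect (exists j, plants a pat (st j) (dt j) (st j.+1) m).
    exists (maxn K j.+1) => i k; rewrite geq_max ltnS leq_eqVlt.
    move=> /orP[/eqP -> /andP[_ jk]|im /andP[Kk _]]; last exact: IH.
    move=> [_ /negP + _ _ _]; apply; apply: (sH_le jk).
    by have [_ _ -> _ _] := pj; rewrite in_cons eqxx.
  exists K => i k; rewrite ltnS leq_eqVlt => /orP[/eqP -> _ pk|im]; last exact: IH.
  by apply: no; exists k.
pose B := \max_(e <- pat n) e.1.2.
have [k [x [Kk mx]]] := h (maxn K B.+1).
have ok : occurs a pat (st k) n.
  split; last by exists x.
  move=> e eu; apply: leq_trans (ss_ge k); apply: leq_trans Kk.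
  rewrite leq_max ltnS; apply/orP; right.
  exact: (@leq_bigmax_seq _ (pat n) xpredT (fun e => e.1.2)).
case: (next_task (next_st k)) => [[m pm]|[all _]]; last first.
  by have := all _ ok; rewrite (negbTE (nH k)).
have [_ _ _ _ [min _]] := pm; have := min _ ok (nH k).
rewrite leq_eqVlt => /orP[/eqP mn|mn]; first by apply: np; exists k; rewrite -mn.
by apply: (hK m k mn) => //; apply: leq_trans Kk; rewrite leq_maxl.
Qed.

Hypothesis pat_surj : forall u, exists n, pat n = u.

Definition limit_point (y : G -> nat -> bool) :=
  forall (W : seq (G * nat)) K, exists k x, K <= k /\
    forall e, e \in W -> y e.1 e.2 = approx k x e.1 e.2.

Lemma limit_point_shift y g : limit_point y -> limit_point (shift y g).
Proof.
move=> hy W K; have [k [x [Kk h]]] := hy [seq ((e.1 * g)%g, e.2) | e <- W] K.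
exists k, (a g x); split => // e eW; rewrite -approx_shift /shift.
by apply: (h ((e.1 * g)%g, e.2)); apply/mapP; exists e.
Qed.

Lemma limit_point_minimal y y' u : limit_point y -> limit_point y' ->
  matches y u -> exists q, matches (shift y' q) u.
Proof.
move=> ly ly' yu; have [n un] := pat_surj u.
have [j pj] : exists j, plants a pat (st j) (dt j) (st j.+1) n.
  apply: recurrent_planted => K.
  have [k [x [Kk h]]] := ly [seq e.1 | e <- u] K.
  exists k, x; split => // e; rewrite un => eu.
  by rewrite -h ?yu// map_f.
have [V hV] := planted_syndetic pj.
have [k [x [jk h]]] := ly' [seq ((e.1.1 * q)%g, e.1.2) | e <- u, q <- V] j.+1.
have [q qV mq] := hV k x jk; exists q => e eu.
rewrite /shift (h ((e.1.1 * q)%g, e.1.2)); last by apply/allpairsP; exists (e, q).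
by apply: mq; rewrite un.
Qed.

Lemma limit_point_good j y : limit_point y ->
  2 ^ j * cnt (dF (dt j)) (fun f => ~ good j (shift y f)) <= #|` dF (dt j)|.
Proof.
move=> ly.
have [k [x [jk h]]] := ly [seq ((e.1 * e.2)%g, i) |
  e <- [seq (g, f) | g <- E j, f <- dF (dt j)], i <- iota 0 (ss (st j.+1))] j.+1.
apply: leq_trans (good_frequent x 1%g jk).
rewrite leq_mul//; apply: cnt_le => f fF; apply: contra_not => -[v [nh hv]].
exists v; split => // g i gE hi; rewrite -hv// /shift mulg1.
apply: (h ((g * f)%g, i)); apply/allpairsP; exists ((g, f), i); split => //.
  by apply/allpairsP; exists (g, f).
by rewrite mem_iota.
Qed.

(** The witnesses [v j] converge. In the block from [ss (st j)] on, [v j] and [v j.+1] both show the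
    symbols of [y], as step [j.+1] does not alter the unhit [v j.+1] at 1; [next_det] extends the
    agreement to all smaller indices. *)
Lemma good_decode j0 y : (forall j, j0 <= j -> good j y) ->
  exists x, forall j, j0 <= j ->
    [/\ ~ hits j x, forall i, i < ss (st j.+1) -> y 1%g i = approx j.+1 x 1%g i &
     exists2 v, agree b (ss (st j.+1)) v x & forall g i, g \in E j ->
       i < ss (st j.+1) -> y g i = approx j.+1 v g i].
Proof.
move=> gy.
have /choice[v hv] : forall j, exists v, j0 <= j -> ~ hits j v /\
    forall g i, g \in E j -> i < ss (st j.+1) -> y g i = approx j.+1 v g i.
  move=> j; case: (leqP j0 j) => [/gy[v hv]|]; last by exists point.
  by exists v.
have blk j i : j0 <= j -> ss (st j) <= i < ss (st j.+1) -> y 1%g i = b i (v j).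
  by move=> jj /andP[h1 h2]; rewrite (hv j jj).2 ?E1// approx_block.
have step1 j : j0 <= j -> agree b (ss (st j.+1)) (v j) (v j.+1).
  move=> jj; have blkE i : ss (st j) <= i < ss (st j.+1) -> b i (v j) = b i (v j.+1).
    move=> hi; rewrite -blk// (hv j.+1 (leqW jj)).2 ?E1//; last first.
      by apply: ltn_trans (ss_lt _); case/andP: hi.
    rewrite approx_unhit; last by case: (hv j.+1 (leqW jj)).
    by rewrite approx_block//; case/andP: hi.
  have [_ _ low] := next_det (next_st j) blkE.
  move=> i hi; case: (ltnP i (ss (st j))) => [/low//|hi'].
  by apply: blkE; rewrite hi'.
have chain j k : j0 <= j -> j <= k -> agree b (ss (st j.+1)) (v j) (v k).
  move=> jj; elim: k => [|k IH]; first by rewrite leqn0 => /eqP ->.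
  rewrite leq_eqVlt => /orP[/eqP -> //|]; rewrite ltnS => jk i hi.
  rewrite IH// step1 ?(leq_trans jj)//.
  by apply: leq_trans hi _; exact: ss_le.
have [x hx] : exists x, forall n, agree b n (v (j0 + n)) x.
  apply: coded_limit; first exact: (bcoded 0).
  move=> n m nm; apply: agree_le (chain _ _ (leq_addr n j0) _).
    by apply: leq_trans (ss_ge _); rewrite (leq_trans (leq_addl j0 n))// leqnSn.
  by rewrite leq_add2l.
have vx j : j0 <= j -> agree b (ss (st j.+1)) (v j) x.
  move=> jj i hi; rewrite (chain j (j0 + ss (st j.+1)) jj _ i hi) ?hx//.
  by apply: leq_trans (leq_addl _ _); apply: leq_trans (ss_ge _); exact: leqnSn.
exists x => j jj; have [nh hvj] := hv j jj.
have blkE i : ss (st j) <= i < ss (st j.+1) -> b i (v j) = b i x.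
  by move=> /andP[_ hi]; exact: vx.
have [wE aE _] := next_det (next_st j) blkE; split.
- by move=> /wE.
- move=> i hi; rewrite hvj ?E1//; case: (ltnP i (ss (st j))) => [/aE//|hi'].
  by rewrite !approx_block//; exact: vx.
- by exists (v j) => //; exact: vx.
Qed.

Definition eventually_unhit (x : X) := forall g, exists j0,
  forall j, j0 <= j -> ~ hits j (a g x).

Definition eventually_good (y : G -> nat -> bool) := forall g, exists j0,
  forall j, j0 <= j -> good j (shift y g).

Lemma approx_stable x g j0 : (forall j, j0 <= j -> ~ hits j (a g x)) ->
  forall j i, j0 <= j -> approx j x g i = approx j0 x g i.
Proof.
move=> h j i; elim: j => [|j IH]; first by rewrite leqn0 => /eqP ->.
rewrite leq_eqVlt => /orP[/eqP -> //|]; rewrite ltnS => jj.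
rewrite -IH// -[g]mul1g.
rewrite -[LHS]/(shift (approx j.+1 x) g 1%g i) -[RHS]/(shift (approx j x) g 1%g i).
by rewrite !approx_shift approx_unhit//; exact: h.
Qed.

Lemma exists_limit x : eventually_unhit x ->
  exists y, forall g j0, (forall j, j0 <= j -> ~ hits j (a g x)) ->
    forall j i, j0 <= j -> y g i = approx j x g i.
Proof.
move=> /choice[J hJ]; exists (fun g i => approx (J g) x g i) => g j0 hj0 j i jj.
rewrite (approx_stable hj0 i jj).
have <- := approx_stable (hJ g) i (leq_maxl (J g) j0).
by have <- := approx_stable hj0 i (leq_maxr (J g) j0).
Qed.

(** Decoding at each [g] separately gives points [xs g], which must be shown to form an orbit. The
    witness [v] at 1 also explains [y] at [g] once [g] is in [E j]; so [a g v] and [xs g] share a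
    block, and [v] is close to [x]. *)
Lemma eventually_good_decode y : eventually_good y ->
  exists x, eventually_unhit x /\ forall g, exists j0, forall j, j0 <= j ->
    forall i, i < ss (st j.+1) -> y g i = approx j.+1 x g i.
Proof.
move=> gy; have /choice[xs hxs] : forall g, exists x, exists j0, forall j, j0 <= j ->
    [/\ ~ hits j x,
     forall i, i < ss (st j.+1) -> shift y g 1%g i = approx j.+1 x 1%g i &
     exists2 v, agree b (ss (st j.+1)) v x & forall h i, h \in E j ->
       i < ss (st j.+1) -> shift y g h i = approx j.+1 v h i].
  move=> g; have [j0 h] := gy g; have [x hx] := good_decode h.
  by exists x, j0.
pose x := xs 1%g.
have xE g : xs g = a g x.
  apply: contrapT => /(coded_sep (bcoded 0))[i]; apply; rewrite add0n.
  have [j1 h1] := hxs 1%g; have [j2 h2] := hxs g; have [j3 h3] := Eev g.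
  have lci : locally_constant (fun v => b i (a g v)).
    by move=> v; exact: (@action_continuous _ _ _ aX g v _ (b_lc bcoded i (a g v))).
  have [n hn] := coded_determines (bcoded 0) lci.
  pose j := maxn (maxn j1 j2) (maxn (maxn j3 n) i.+1).
  have j1j : j1 <= j by rewrite /j !leq_max leqnn.
  have j2j : j2 <= j by rewrite /j !leq_max leqnn !orbT.
  have j3j : j3 <= j by rewrite /j !leq_max leqnn !orbT.
  have nj : n <= j by rewrite /j !leq_max leqnn !orbT.
  have ij : i < j by rewrite /j !leq_max leqnn !orbT.
  have [_ _ [v vx yv]] := h1 j j1j; have [_ yg _] := h2 j j2j.
  have blkE i' : ss (st j) <= i' < ss (st j.+1) -> b i' (a g v) = b i' (xs g).
    move=> /andP[hi hi']; rewrite -(approx_block _ hi) -(approx_block (xs g) hi).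
    rewrite -yg// -approx_shift /shift mul1g -yv//; last exact: h3.
    by rewrite /shift mulg1.
  have [_ _ low] := next_det (next_st j) blkE.
  rewrite -low; last exact: leq_trans ij (ss_ge _).
  rewrite (hn v x)// => i' hi'; apply: vx.
  exact: leq_trans hi' (leq_trans nj (leq_trans (leqnSn _) (ss_ge _))).
exists x; split => g; have [j0 h] := hxs g; exists j0 => j jj.
  by rewrite -xE; case: (h j jj).
move=> i hi; have [_ yg _] := h j jj.
have := yg i hi; rewrite /shift mul1g xE => ->.
by rewrite -approx_shift /shift mul1g.
Qed.

End consequences.

Lemma continuous_ptws (S : topologicalType) (I : Type) (V : topologicalType)
  (f : S -> {ptws I -> V}) : (forall i, continuous (fun s => f s i)) -> continuous f.
Proof.
move=> cf s; apply/cvg_sup => i.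
exact: (@continuous_comp_initial {ptws I -> V} S V (fun g => g i) f (cf i) s).
Qed.

Lemma compact_set_type (T : topologicalType) (A : set T) :
  compact A -> compact [set: A].
Proof.
move=> cA F FF _; pose F' := (fun x : A => \val x) @ F.
have [|z [Az cz]] := cA F' _.
  by apply: (@filterE _ F _ (fun x : A => A (\val x))) => x; exact: set_valP.
exists (exist _ z (mem_set Az)); split => // B C FB [D [[W oW WD] Dz DC]].
pose v (x : A) : T := \val x.
have [_ [/= [x Bx <-] Wx]] : v @` B `&` W !=set0.
  apply: cz.
    have : F (v @^-1` (v @` B)) by apply: filterS FB => x Bx; exists x.
    by [].
  by apply: open_nbhs_nbhs; split => //; move: Dz; rewrite -WD.
by exists x; split => //; apply: DC; rewrite -WD.
Qed.

(** * The minimal subshift *)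

Section shift_space.
Variables (G : groupType).
Hypothesis cG : countable [set: G].
Variable P : (G -> nat -> bool) -> Prop.
Hypothesis P0 : exists y, P y.
Hypothesis Pshift : forall y g, P y -> P (shift y g).
Hypothesis Pclosed : forall y, (forall W : seq (G * nat),
  exists2 y', P y' & forall e, e \in W -> y' e.1 e.2 = y e.1 e.2) -> P y.

Local Notation Z := {ptws (G * nat)%type -> bool}.
Let PZ : set Z := [set z | P (fun g i => z (g, i))].

Let near_coord (z : Z) (W : seq (G * nat)) :
  \forall z' \near z, forall e, e \in W -> z' e = z e.
Proof.
elim: W => [|e W IH]; first by near=> z' => e.
have : \forall z' \near z, z' e = z e.
  have := @proj_continuous _ (fun _ : G * nat => bool) e z.
  by move=> /(_ _ (discrete_set1 (z e))).
by apply: filterS2 IH => z' h he i; rewrite in_cons => /orP[/eqP ->|/h].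
Unshelve. all: by end_near. Qed.

Let PZ_closed : closed PZ.
Proof.
move=> z hz; apply: Pclosed => W.
have [z' [Pz' e]] := hz _ (near_coord z W).
by exists (fun g i => z' (g, i)) => // -[g i] /e.
Qed.

Lemma exists_shift_space : exists (Y : ptopologicalType) (ev : Y -> G -> nat -> bool)
    (sigma : G -> Y -> Y),
  [/\ compact [set: Y], injective ev, forall y, P (ev y),
    forall f, P f -> exists y, ev y = f &
    [/\ forall g i, locally_constant (fun y => ev y g i),
      forall g y, ev (sigma g y) = shift (ev y) g &
      exists e : nat -> G * nat, coded (fun n y => ev y (e n).1 (e n).2)]].
Proof.
pose y0 : PZ := exist _ (fun e => projT1 (cid P0) e.1 e.2 : bool)
  (mem_set (projT2 (cid P0) : PZ (fun e => projT1 (cid P0) e.1 e.2))).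
pose Y : ptopologicalType := HB.pack_for ptopologicalType (set_type PZ)
  (Topological.class (set_type PZ)) (isPointed.Build (set_type PZ) y0).
pose ev (y : Y) g i := (\val (y : PZ) : Z) (g, i).
have evP y : P (ev y) by exact: (set_valP (y : PZ)).
have hsig g y : PZ (fun e => shift (ev y) g e.1 e.2) by exact: Pshift.
pose mkY (f : Z) (h : PZ f) : Y := exist (fun z : Z => z \in PZ) f (mem_set h).
pose sigma g (y : Y) : Y := mkY _ (hsig g y).
have evI : injective ev.
  move=> y y' e; apply: val_inj; apply/funext => -[g i].
  exact: (congr1 (fun f => f g i) e).
have evlc g i : locally_constant (fun y => ev y g i).
  move=> y; have h : nbhs (y : PZ) ((fun x : PZ => \val x) @^-1`
      [set z' : Z | forall e, e \in [:: (g, i)] -> z' e = (\val (y : PZ) : Z) e]).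
    exact: (@initial_continuous _ _ (fun x : PZ => \val x) y _ (near_coord _ _)).
  apply: filterS (h : nbhs y _) => y' /= h'.
  by apply: h'; rewrite inE.
have cY : compact [set: Y].
  apply: (@compact_set_type Z PZ); apply: subclosed_compact PZ_closed _ _.
    exact: (@tychonoff _ (fun _ : G * nat => bool) (fun=> setT) (fun=> bool_compact)).
  by move=> z _ e.
have [e he] : exists e : nat -> G * nat, forall x, exists n, e n = x.
  have [c hc] := recurrent_enumeration (1%g : G) cG.
  exists (fun n => if (choice.unpickle n : option (nat * nat)) is Some ij
    then (c ij.1, ij.2) else (1%g, 0%N)) => -[g i].
  have [n _ cn] := hc g 0%N; exists (choice.pickle (n, i)).
  by rewrite choice.pickleK /= cn.
exists Y, ev, sigma; split => //; last split => //.
- move=> f Pf.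
  have Pf' : PZ (fun e => f e.1 e.2) by [].
  by exists (mkY _ Pf').
- exists e; split => // y y' ne.
  apply: contrapT => h; apply: ne; apply: evI; apply/funext => g; apply/funext => i.
  have [n en] := he (g, i); apply: contrapT => ne; apply: h; exists n.
  by rewrite en.
Qed.

End shift_space.

Lemma coded_continuous (S T : ptopologicalType) (c : nat -> T -> bool) (f : S -> T) :
  coded c -> (forall i, locally_constant (fun x => c i (f x))) -> continuous f.
Proof.
move=> cc lf x U /(coded_base cc)[n hn].
have : \forall y \near x, agree c n (f x) (f y).
  elim: n {hn} => [|n IH]; first exact: nearW.
  apply: filterS2 (lf n x) IH => y e IH i; rewrite ltnS leq_eqVlt.
  by move=> /orP[/eqP ->|/IH].
by apply: filterS => y; exact: hn.
Qed.

Lemma exists_exhaustion (G : groupType) : countable [set: G] ->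
  exists E : nat -> {fset G}, (forall j, 1%g \in E j) /\
    forall g, exists j0, forall j, (j0 <= j)%N -> g \in E j.
Proof.
move=> cG; have [c hc] := recurrent_enumeration (1%g : G) cG.
exists (fun j => (1%g |` [fset c i | i in iota 0 j])%fset); split.
  by move=> j; rewrite !inE eqxx.
move=> g; have [n _ <-] := hc g 0%N; exists n.+1 => j nj.
rewrite !inE; apply/orP; right; apply/imfsetP; exists n => //=.
by rewrite mem_iota.
Qed.

Lemma exists_patterns (G : groupType) : countable [set: G] ->
  exists pat : nat -> seq (G * nat * bool), forall u, exists n, pat n = u.
Proof.
move=> cG; have [c hc] := recurrent_enumeration (1%g : G) cG.
pose dec (e : nat * nat * bool) := (c e.1.1, e.1.2, e.2).
exists (fun n => if (choice.unpickle n : option (seq (nat * nat * bool))) is Some s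
  then map dec s else [::]) => u.
have [s <-] : exists s, map dec s = u.
  elim: u => [|[[g i] v] u [s <-]]; first by exists [::].
  by have [n _ cn] := hc g 0%N; exists ((n, i, v) :: s); rewrite /= /dec cn.
by exists (choice.pickle s); rewrite choice.pickleK.
Qed.

Section model.
Variables (R : realType) (G : groupType).
Variables (X : ptopologicalType) (a : G -> X -> X).
Hypothesis aX : is_action a.
Variable b : nat -> X -> bool.
Hypothesis bcoded : forall s, coded (fun i => b (s + i)%N).
Hypothesis cG : countable [set: G].
Variables (E : nat -> {fset G}) (pat : nat -> seq (G * nat * bool)).
Variables (st : nat -> state G X) (dt : nat -> data G X).
Hypothesis st0 : st 0 = state0 G b.
Hypothesis inv_st : forall j, inv_state a b (st j).
Hypothesis next_st : forall j, next a b E pat j (st j) (dt j) (st j.+1).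
Hypothesis pat_surj : forall u, exists n, pat n = u.
Local Open Scope nat_scope.

Let P := limit_point a st.

Lemma limit_point_closed y : (forall W : seq (G * nat),
  exists2 y', P y' & forall e, e \in W -> y' e.1 e.2 = y e.1 e.2) -> P y.
Proof.
move=> h W K; have [y' Py' e] := h W; have [k [x [Kk e']]] := Py' W K.
by exists k, x; split => // u uW; rewrite -e// e'.
Qed.

Lemma exists_limit_point : exists y, P y.
Proof.
have tych := @tychonoff _ (fun _ : G * nat => bool) (fun=> setT) (fun=> bool_compact).
pose z k : {ptws (G * nat)%type -> bool} := fun e => approx a st k point e.1 e.2.
have [|y [_ cy]] := tych (z @ \oo) _.
  by apply: filterE => f i.
exists (fun g i => y (g, i)) => W K.
have nW : \forall z' \near (y : {ptws (G * nat)%type -> bool}),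
    forall e, e \in W -> z' e = y e.
  elim: W => [|e W IH]; first by near=> z' => e.
  have : \forall z' \near (y : {ptws (G * nat)%type -> bool}), z' e = y e.
    have := @proj_continuous _ (fun _ : G * nat => bool) e y.
    by move=> /(_ _ (discrete_set1 (y e))).
  by apply: filterS2 IH => z' h he i; rewrite in_cons => /orP[/eqP ->|/h].
have zK : (z @ \oo) [set z k | k in [set k | K <= k]].
  by exists K => // k /= Kk; exists k.
have [_ [/= [k Kk <-] e]] := cy _ _ zK nW.
by exists k, point; split => // -[g i] gW; rewrite -e.
Unshelve. all: by end_near. Qed.

Lemma exists_model : exists (Y : ptopologicalType) (ev : Y -> G -> nat -> bool)
    (sigma : G -> Y -> Y),
  [/\ [/\ compact [set: Y], metrizable R Y & zero_dimensional Y],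
    is_action sigma, minimal_action sigma,
    [/\ injective ev, forall y, P (ev y), forall f, P f -> exists y, ev y = f,
      forall g i, locally_constant (fun y => ev y g i) &
      forall g y, ev (sigma g y) = shift (ev y) g] &
    exists e : nat -> G * nat, coded (fun n y => ev y (e n).1 (e n).2)].
Proof.
have [Y [ev [sigma [cY evI evP evsurj [evlc evs [e cod]]]]]] :=
  exists_shift_space cG exists_limit_point
    (fun y g => limit_point_shift aX inv_st g) limit_point_closed.
have csig g : continuous (sigma g).
  apply: (coded_continuous cod) => i y.
  by apply: filterS (evlc ((e i).1 * g)%g (e i).2 y) => y' h; rewrite !evs.
have sig1 y : sigma 1%g y = y.
  by apply: evI; rewrite evs; apply/funext => g; rewrite /shift mulg1.
have sigM g h y : sigma (g * h)%g y = sigma g (sigma h y).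
  by apply: evI; rewrite !evs; apply/funext => p; rewrite /shift mulgA.
exists Y, ev, sigma; split => //; last by exists e.
- split => //; [exact: coded_metrizable cod|exact: coded_zero_dimensional cod].
- split => // g; split => //; exists (sigma g^-1%g); split => // y.
    by rewrite -sigM mulVg.
  by rewrite -sigM mulgV.
move=> y; apply/seteqP; split => // y' _ U /(coded_base cod)[n hn].
have [|q hq] := limit_point_minimal aX st0 inv_st next_st pat_surj (evP y') (evP y)
  (u := [seq ((e i).1, (e i).2, ev y' (e i).1 (e i).2) | i <- iota 0 n]).
  by move=> _ /mapP[i _ ->].
exists (sigma q y); split; first by exists q.
apply: hn => i ni; have := hq ((e i).1, (e i).2, ev y' (e i).1 (e i).2).
rewrite /= evs => -> //; apply/mapP; exists i => //.
by rewrite mem_iota.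
Qed.

End model.

(** * Invariant measures *)

Section borel_coded.
Variables (T : ptopologicalType) (c : nat -> T -> bool).
Hypothesis cc : coded c.

Lemma open_borel (U : set (borel T)) : open (U : set T) -> measurable U.
Proof. by move=> oU; exact: sub_sigma_algebra. Qed.

Lemma clopen_borel (U : set (borel T)) : clopen (U : set T) -> measurable U.
Proof. by move=> [oU _]; exact: open_borel. Qed.

Lemma lc_borel (V : Type) (h : T -> V) (P : set V) :
  locally_constant h -> measurable (h @^-1` P : set (borel T)).
Proof. by move=> /(locally_constant_clopen P)/clopen_borel. Qed.

(** An open set is the union of the cylinders it contains, and there are countably many
    cylinders. *)
Lemma coded_measurable_fun d (S : measurableType d) (D : set S) (f : S -> borel T) :
  measurable D -> (forall i, measurable (D `&` [set x | c i (f x)])) ->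
  measurable_fun D f.
Proof.
move=> mD mi; apply: (@measurability _ _ _ (borel T) D f (@open T)) => //.
move=> _ [U oU <-].
have mi' i v : measurable (D `&` [set x | c i (f x) = v]).
  case: v; first exact: mi.
  have -> : D `&` [set x | c i (f x) = false] = D `\` (D `&` [set x | c i (f x)]).
    apply/seteqP; split=> x /=.
      by move=> [Dx cx]; split => // -[_]; rewrite cx.
    by move=> [Dx /not_andP[//|ncx]]; split => //; exact/negbTE/negP.
  by apply: measurableD.
pose cyl (w : seq bool) := D `&` [set x | forall i, (i < size w)%N -> c i (f x) = nth false w i].
have mcyl w : measurable (cyl w).
  elim/last_ind: w => [|w v IH].
    have -> // : cyl [::] = D by rewrite /cyl; apply/seteqP; split => [x []|x Dx] //; split => // i.
  have -> : cyl (rcons w v) = cyl w `&` (D `&` [set x | c (size w) (f x) = v]).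
    apply/seteqP; split => x.
      move=> [Dx h]; split; [split => // i iw|split => //].
        by rewrite h ?size_rcons ?leqW// nth_rcons iw.
      by rewrite /= h ?size_rcons// nth_rcons ltnn eqxx.
    move=> [[Dx h] [_ hv]]; split => // i; rewrite size_rcons ltnS leq_eqVlt nth_rcons.
    move=> /orP[/eqP ->|iw]; first by rewrite ltnn eqxx.
    by rewrite iw h.
  exact: measurableI.
pose Us (w : seq bool) := if pselect (forall y : T,
    (forall i, (i < size w)%N -> c i y = nth false w i) -> U y) then cyl w else set0.
have -> : D `&` f @^-1` U = \bigcup_w Us w.
  apply/seteqP; split => x.
    move=> [Dx Ufx]; have [n hn] := coded_base cc (open_nbhs_nbhs (conj oU Ufx)).
    pose w := [seq c i (f x) | i <- iota 0 n].
    have wE i : (i < size w)%N -> nth false w i = c i (f x).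
      rewrite size_map size_iota => ni.
      by rewrite (nth_map 0%N) ?size_iota// nth_iota.
    exists w => //; rewrite /Us; case: pselect => [?|[]].
      by split => // i iw; rewrite wE.
    move=> y hy; apply: hn => i ni.
    have iw : (i < size w)%N by rewrite size_map size_iota.
    by rewrite (hy i iw) (wE i iw).
  move=> [w _]; rewrite /Us; case: pselect => // h [Dx hx]; split => //.
  exact: h.
apply: countable_bigcupT_measurable; first exact: countableP.
by move=> w; rewrite /Us; case: pselect => h; [exact: mcyl|exact: measurable0].
Qed.

Lemma continuous_real_borel (R : realType) (f : T -> R) :
  continuous f -> measurable_fun setT (f : borel T -> R).
Proof.
move=> /continuousP cf; apply: (measurability _ (RGenOpens.measurableE R)).
move=> _ [_ [a [b ->] <-]]; rewrite setTI; apply: open_borel.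
exact/cf/interval_open.
Qed.

End borel_coded.

Lemma continuous_borel (S T : ptopologicalType) (f : S -> T) :
  continuous f -> measurable_fun setT (f : borel S -> borel T).
Proof.
move=> /continuousP cf; apply: (@measurability _ _ _ (borel T) _ _ (@open T)) => //.
by move=> _ [U oU <-]; rewrite setTI; apply: open_borel; exact: cf.
Qed.

Section invariant_measures.
Variables (R : realType) (G : groupType) (T : ptopologicalType) (a : G -> T -> T).
Hypothesis aT : is_action a.
Variable mu : probability (borel T) R.
Hypothesis inv : invariant_probability (R := R) a mu.

Lemma action_preimage g (A : set T) : a g @^-1` A = a g^-1%g @` A.
Proof.
apply/seteqP; split => x; first by move=> Ax; exists (a g x) => //; exact: actionK.
by move=> [y Ay <-]; rewrite /preimage /= actionVK.
Qed.

Lemma action_measurable g (A : set (borel T)) : measurable A ->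
  measurable (a g @^-1` A : set (borel T)).
Proof.
move=> mA; rewrite -[X in measurable X]setTI.
exact: (continuous_borel (@action_continuous _ _ _ aT g) measurableT).
Qed.

Lemma invariant_preimage g (A : set (borel T)) : measurable A ->
  mu (a g @^-1` A) = mu A.
Proof. by move=> mA; rewrite action_preimage inv. Qed.

Local Open Scope ereal_scope.

(** The average over [F] of the indicators of the translates of [A] has integral [mu A] by
    invariance and is at most [1/k] pointwise. *)
Lemma frequency_bound (A : set (borel T)) (F : {fset G}) (k : nat) :
  measurable A -> F != fset0 -> (0 < k)%N ->
  (forall x, (k * cnt F (fun f => A (a f x)) <= #|` F|)%N) ->
  mu A <= (k%:R^-1)%:E.
Proof.
move=> mA F0 k0 h.
have n0 : (0 < #|` F|)%N by rewrite cardfs_gt0.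
pose s f x : R := \1_(a f @^-1` A : set (borel T)) x.
have mpre f : measurable (a f @^-1` A : set (borel T)) by exact: action_measurable.
have sE x : (\sum_(f <- F) s f x = (cnt F (fun f => A (a f x)))%:R)%R.
  rewrite /cnt -sum1_count natr_sum [RHS]big_mkcond /=; apply: eq_bigr => f _.
  rewrite /s indicE; case: asboolP => h'.
    by rewrite mem_set.
  by rewrite memNset.
have i1 f : \int[mu]_x (s f x)%:E = mu A.
  rewrite /s integral_indic//.
  by rewrite setIT; exact: invariant_preimage.
have e1 : \int[mu]_x (\sum_(f <- F) (s f x)%:E) = #|` F|%:R%:E * mu A.
  rewrite ge0_integral_sum//=.
  - under eq_bigr do rewrite i1.
    have : mu A \is a fin_num by exact: fin_num_measure.
    move=> /fineK <-; rewrite sumEFin -EFinM; congr (_%:E).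
    by rewrite big_const_seq count_predT iter_addr_0 mulr_natl.
  - by move=> f; apply/measurable_EFinP; exact: measurable_indic.
  - by move=> f x _; rewrite lee_fin /s indicE; case: (_ \in _).
have e2 : \int[mu]_x (\sum_(f <- F) (s f x)%:E) <= (#|` F|%:R / k%:R)%:E.
  apply: (@le_trans _ _ (\int[mu]_x (cst (#|` F|%:R / k%:R)%:E x))).
    apply: ge0_le_integral => //=.
    - move=> x _; apply: sume_ge0 => f _.
      by rewrite lee_fin /s indicE; case: (_ \in _).
    - apply: emeasurable_sum => f; apply/measurable_EFinP; exact: measurable_indic.
    - move=> x _; rewrite sumEFin lee_fin sE ler_pdivlMr ?ltr0n//.
      by rewrite -natrM ler_nat mulnC.
  rewrite integral_cst//.
  by rewrite [X in _ * X](_ : _ = 1); [rewrite mule1|exact: probability_setT].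
move: e2; rewrite e1.
have : mu A \is a fin_num by exact: fin_num_measure.
move=> /fineK <-; rewrite -EFinM !lee_fin => e2.
rewrite -(ler_pM2l (_ : 0 < #|` F|%:R)%R)// ltr0n//.
Qed.

End invariant_measures.

Section summable.
Variables (R : realType) (T : ptopologicalType) (mu : probability (borel T) R).
Variable B : nat -> set (borel T).
Hypothesis mB : forall j, measurable (B j).
Hypothesis muB : forall j, (mu (B j) <= ((2 ^ j)%:R^-1)%:E)%E.

Definition late m : set (borel T) := \bigcup_j B (m + j)%N.

Lemma late_measurable m : measurable (late m).
Proof. by apply: bigcupT_measurable => j. Qed.

Lemma late_bound m : (mu (late m) <= (2 / (2 ^ m)%:R)%:E)%E.
Proof.
have := @generalized_Boole_inequality _ _ _ mu (fun j => B (m + j)%N)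
  (fun j => mB _) (late_measurable m).
move=> /le_trans; apply.
have e0 : 0 <= 2 / (2 ^ m)%:R :> R by rewrite divr_ge0.
(* [epsilon_trick0] sums [e / 2^(j+1)]; with [e = 2 / 2^m] the terms are [2^-(m+j)]. *)
apply: le_trans (epsilon_trick0 xpredT e0).
apply: lee_nneseries => //= j _; apply: le_trans (muB _) _.
rewrite lee_fin expnD expnS !natrM !invfM.
by rewrite mulrACA mulfV// mul1r mulrC.
Qed.

Definition eventually_not : set (borel T) :=
  [set x | exists j0, forall j, (j0 <= j)%N -> ~ B j x].

Lemma eventually_notE : eventually_not = ~` \bigcap_m late m.
Proof.
apply/seteqP; split=> x.
  move=> [j0 h] /(_ j0 I)[j _]; apply: h; exact: leq_addr.
move=> h; apply: contrapT => no; apply: h => m _; apply: contrapT => h.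
apply: no; exists m => j mj Bj; apply: h; exists (j - m)%N => //.
by rewrite subnKC.
Qed.

Lemma eventually_not_measurable : measurable eventually_not.
Proof.
rewrite eventually_notE; apply: measurableC; apply: bigcapT_measurable => m.
exact: late_measurable.
Qed.

Lemma eventually_not_full : mu eventually_not = 1%E.
Proof.
rewrite eventually_notE probability_setC; last first.
  by apply: bigcapT_measurable => m; exact: late_measurable.
suff -> : mu (\bigcap_m late m) = 0%E by rewrite sube0.
apply/eqP; rewrite eq_le measure_ge0 andbT.
apply/lee_addgt0Pr => e e0; rewrite add0e.
have [m hm] : exists m, 2 / (2 ^ m)%:R < e.
  have := @cvg_expr R (2^-1); rewrite ger0_norm ?invr_ge0// invf_lt1 ?ltr1n//.
  have e2 : 0 < e / 2 by rewrite divr_gt0.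
  move=> /(_ isT) /cvgrPdist_lt/(_ _ e2)[n _ /(_ n (leqnn n))].
  rewrite sub0r normrN ger0_norm ?exprn_ge0 ?invr_ge0// => h; exists n.
  by rewrite natrX -exprVn mulrC -ltr_pdivlMr.
apply: (@le_trans _ _ (mu (late m))).
  apply: le_measure; rewrite ?inE.
  - by apply: bigcapT_measurable => k; exact: late_measurable.
  - exact: late_measurable.
  - by move=> x /(_ m I).
by apply: le_trans (late_bound m) _; rewrite lee_fin ltW.
Qed.

End summable.

(** * Continuity of induced maps on invariant measures *)

Section integral_comparison.
Variables (R : realType) (T : ptopologicalType) (mu : probability (borel T) R).

Lemma bounded_integrable (f : borel T -> R) (M : R) : measurable_fun setT f ->
  (forall x, `|f x| <= M) -> mu.-integrable setT (EFin \o f).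
Proof.
move=> mf fM; apply: measurable_bounded_integrable => //.
  by apply: (@le_lt_trans _ _ 1%E); [exact: probability_le1|exact: ltey].
by exists M; split; [exact: num_real|move=> y My x _; exact: le_trans (fM x) (ltW My)].
Qed.

Lemma integral_near (f g : borel T -> R) (B : set (borel T)) (M e d : R) :
  measurable_fun setT f -> measurable_fun setT g -> measurable B ->
  (forall x, `|f x| <= M) -> (forall x, `|g x| <= M) -> 0 <= e ->
  (mu B <= d%:E)%E -> (forall x, ~ B x -> `|f x - g x| <= e) ->
  `|\int[mu]_x f x - \int[mu]_x g x| <= e + 2 * M * d.
Proof.
move=> mf mg mB fM gM e0 Bd fg.
have M0 : 0 <= M by exact: le_trans (normr_ge0 _) (fM point).
have intf := bounded_integrable mf fM; have intg := bounded_integrable mg gM.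
rewrite -RintegralB//.
have mfg : measurable_fun setT (fun x => f x - g x) by exact: measurable_funB.
have fgM x : `|f x - g x| <= 2 * M.
  by rewrite mulr_natl mulr2n (le_trans (ler_normB _ _))// lerD.
have intfg := bounded_integrable mfg fgM.
apply: le_trans (le_normr_Rintegral measurableT intfg) _.
pose h x : R := e + 2 * M * \1_B x.
have hM x : `|h x| <= e + 2 * M.
  rewrite ger0_norm /h indicE; case: (_ \in _); rewrite ?mulr1 ?mulr0 ?addr0//.
  - by rewrite lerDl mulr_ge0.
  - by rewrite addr_ge0// mulr_ge0.
have m1 : measurable_fun setT (\1_B : borel T -> R) by exact: measurable_indic.
have m2 : measurable_fun setT (fun x : borel T => 2 * M * \1_B x : R).
  exact: (measurable_funM (measurable_cst (2 * M)) m1).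
have mh : measurable_fun setT h.
  exact: (measurable_funD (measurable_cst e) m2).
have inth := bounded_integrable mh hM.
have intn : mu.-integrable setT (EFin \o (fun x => `|f x - g x|)).
  apply: (@bounded_integrable _ (2 * M)) => [|x]; last by rewrite normr_id.
  exact: measurableT_comp.
apply: (@le_trans _ _ (\int[mu]_x h x)).
  apply: le_Rintegral => // x _; rewrite /h indicE.
  have [xB|] := boolP (x \in B).
    by rewrite mulr1 (le_trans (fgM x))// lerDr.
  by rewrite notin_setE => /fg; rewrite mulr0 addr0.
have int1 : mu.-integrable setT (EFin \o (\1_B : borel T -> R)).
  apply: (@bounded_integrable _ 1) => //.
  by move=> x; rewrite indicE; case: (_ \in _); rewrite ?normr1 ?normr0.
have int2 : mu.-integrable setT (EFin \o (fun x => 2 * M * \1_B x : R)).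
  apply: (@bounded_integrable _ (2 * M)) => //.
  move=> x; rewrite indicE; case: (_ \in _); rewrite ?mulr1 ?mulr0 ?normr0 ?mulr_ge0//.
  by rewrite ger0_norm// mulr_ge0.
have inte : mu.-integrable setT (EFin \o (fun _ => e)).
  apply: (@bounded_integrable _ e) => // x; by rewrite ger0_norm.
rewrite RintegralD// Rintegral_cst//.
have -> : fine (mu setT) = 1 by have -> : mu setT = 1%E by exact: probability_setT.
rewrite mulr1 lerD2l RintegralZl//.
apply: ler_wpM2l; first by rewrite mulr_ge0.
rewrite /Rintegral integral_indic// setIT.
have : mu B \is a fin_num by exact: fin_num_measure.
by move=> /fineK h'; rewrite -lee_fin h'.
Qed.

End integral_comparison.

(** One exceptional set [B] serves all invariant measures at once; this uniformity is what yields
    weak* continuity. *)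
Definition approximable (R : realType) (G : groupType) (S T : ptopologicalType)
    (a : G -> S -> S) (c : nat -> T -> bool) (Phi : borel S -> borel T) :=
  forall n (e : R), 0 < e -> exists (q : S -> nat -> bool) (B : set (borel S)),
    [/\ measurable B, forall i, locally_constant (q^~ i),
        forall x, ~ B x -> forall i, (i < n)%N -> c i (Phi x) = q x i &
        forall mu : PG R a, (PG_measure mu B <= e%:E)%E].

Section PG_maps.
Variables (R : realType) (S T : ptopologicalType) (G : groupType).
Variables (a : G -> S -> S) (b : G -> T -> T).
Variable c : nat -> T -> bool.
Hypothesis cc : coded c.

Lemma lc_continuous (V : topologicalType) (f : S -> V) :
  locally_constant f -> continuous f.
Proof.
move=> lf x U Ufx; apply: filterS (lf x) => y; rewrite /preimage /= => ->.
exact: nbhs_singleton.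
Qed.

Lemma coded_bounded (f : T -> R) : continuous f -> exists2 M, 0 <= M & forall x, `|f x| <= M.
Proof.
move=> cf; have [n hn] := coded_continuous_uniform cc cf ltr01.
have [|s [U [hU sU]]] := @compact_finite_choice T (coded_compact cc)
    (fun x U => forall y, U y -> agree c n x y).
  by move=> x; exists (agree c n x) => //; split => //; exact: agree_open.
exists (\sum_(x <- s) `|f x| + 1).
  by rewrite addr_ge0// sumr_ge0.
move=> x; have [y ys Uyx] := sU x.
have := hn y x ((hU y).2 x Uyx); rewrite distrC => h.
have -> : f x = f y + (f x - f y) by rewrite addrC subrK.
rewrite (le_trans (ler_normD _ _))// lerD//; last exact: ltW.
by rewrite (big_rem y)//= lerDl sumr_ge0.
Qed.

Lemma PG_integral_continuous (f : continuousType S R) :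
  continuous (fun mu : PG R a => \int[PG_measure mu]_x f x : R).
Proof.
move=> mu.
have c1 : continuous (fun mu : PG R a => \val mu : weak_star R S).
  exact: initial_continuous.
have c2 : continuous (fun mu : weak_star R S => integrals (mu : probability (borel S) R)
   : {ptws continuousType S R -> R}).
  exact: initial_continuous.
have c3 : continuous (fun h : {ptws continuousType S R -> R} => h f).
  by move=> h; apply: (@proj_continuous _ (fun _ : {classic continuousType S R} => R) f h).
apply: (@continuous_comp _ _ _ (fun mu : PG R a => \val mu : weak_star R S)
  (fun mu : weak_star R S => integrals mu f)); first exact: c1.
exact: (@continuous_comp _ _ _ _ (fun h : {ptws continuousType S R -> R} => h f)
  _ (c2 _) (c3 _)).
Qed.

Lemma PG_continuous (Phistar : PG R a -> PG R b) (Phi : borel S -> borel T) :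
  measurable_fun setT Phi ->
  (forall mu (B : set (borel T)), measurable B ->
    PG_measure (Phistar mu) B = PG_measure mu (Phi @^-1` B)) ->
  approximable R a c Phi -> continuous Phistar.
Proof.
move=> mPhi push apx.
apply: (@continuous_comp_initial _ (PG R a) (weak_star R T) set_val Phistar).
apply: (@continuous_comp_initial _ (PG R a) _ (@integrals R T)).
apply: continuous_ptws => f.
suff key : continuous (fun mu : PG R a => \int[PG_measure (Phistar mu)]_x f x : R).
  exact: key.
have cf : continuous (f : T -> R) by move=> x; exact: cts_fun.
move=> mu0.
have FF : Filter (nbhs (mu0 : PG R a)) by exact: nbhs_filter.
apply/(@cvgrPdist_lt _ _ _ (nbhs (mu0 : PG R a)) FF) => e e0.
have e3 : 0 < e / 3 by rewrite divr_gt0.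
have e6 : 0 < e / 6 by rewrite divr_gt0.
have [M M0 fM] := coded_bounded cf.
have [n hn] := coded_continuous_uniform cc cf e6.
(* Then [2 * M * d < e / 6], also for [M = 0]; with the oscillation [e / 6] the replacement costs
   less than [e / 3], and it is made twice. *)
pose d := e / (12 * (M + 1)).
have M1 : 0 < M + 1 by rewrite ltr_wpDl.
have d0 : 0 < d by rewrite divr_gt0// mulr_gt0.
have [q [B [mB lq hq muB]]] := apx n d d0.
(* The discontinuous [Phi] is replaced by a map that picks a point with the first [n] symbols given
   by [q]. The choice depends on these symbols only, so [psi] is locally constant. *)
pose psi (x : S) : T := if pselect (exists y, forall i, (i < n)%N -> c i y = q x i)
  is left h then projT1 (cid h) else point.
have psiP x : ~ B x -> agree c n (Phi x) (psi x).
  move=> nB i ni; rewrite /psi; case: pselect => [h|[]]; last first.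
    by exists (Phi x) => j nj; exact: hq.
  by case: cid => y /= hy; rewrite hy//; exact: hq.
have lpsi : locally_constant psi.
  move=> x.
  have : \forall y \near x, forall i, (i < n)%N -> q y i = q x i.
    elim: (n) => [|m IH]; first exact: nearW.
    apply: filterS2 (lq m x) IH => y h1 h2 i; rewrite ltnS leq_eqVlt.
    by move=> /orP[/eqP ->|/h2].
  apply: filterS => y hy; rewrite /psi.
  suff -> : (fun y' => forall i, (i < n)%N -> c i y' = q y i) =
            (fun y' => forall i, (i < n)%N -> c i y' = q x i) by [].
  by apply/funext => y'; apply/propext; split => h i ni; rewrite h// hy.
pose f' : S -> R := f \o psi.
have lf' : locally_constant f' by move=> x; apply: filterS (lpsi x) => y; rewrite /f' /= => ->.
have cf' := lc_continuous lf'.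
pose f'' : continuousType S R := HB.pack_for (continuousType S R) f'
  (isContinuous.Build S R f' cf').
have mf' : measurable_fun setT (f' : borel S -> R) by exact: continuous_real_borel.
have mf : measurable_fun setT (f : borel T -> R) by exact: continuous_real_borel.
have close mu : `|\int[PG_measure (Phistar mu)]_x f x - \int[PG_measure mu]_x f' x| < e / 3.
  have -> : \int[PG_measure (Phistar mu)]_x f x = \int[PG_measure mu]_x (f (Phi x)).
    rewrite /Rintegral; congr fine.
    rewrite (@eq_measure_integral _ _ _ _ (pushforward (PG_measure mu) Phi)); last first.
      by move=> A mA _; rewrite /= push.
    rewrite (@integral_pushforward _ _ _ _ _ _ mPhi)//.
    - exact/measurable_EFinP.
    - rewrite preimage_setT.
      apply: (@bounded_integrable _ _ _ (fun x => f (Phi x)) M) => [|x]; last exact: fM.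
      exact: measurableT_comp mf mPhi.
  have := @integral_near R S (PG_measure mu) (fun x => f (Phi x)) f' B M (e / 6) d.
  move=> /(_ (measurableT_comp mf mPhi) mf' mB (fun x => fM _) (fun x => fM _) (ltW e6) (muB mu)).
  move=> h; apply: le_lt_trans (h _) _.
    by move=> x /psiP/hn/ltW.
  rewrite (_ : e / 3 = e / 6 + e / 6); last by lra.
  rewrite ltrD2l /d.
  rewrite (_ : 2 * M * (e / (12 * (M + 1))) = (e / 6) * (M / (M + 1))); last first.
    by field; rewrite lt0r_neq0.
  by rewrite gtr_pMr// ltr_pdivrMr// mul1r ltrDl.
have := @PG_integral_continuous f'' mu0.
move=> /(@cvgrPdist_lt _ _ _ (nbhs (mu0 : PG R a)) FF) /(_ _ e3).
apply: filterS => mu hmu.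
have t1 := ler_distD (\int[PG_measure mu0]_x f' x)
  (\int[PG_measure (Phistar mu0)]_x f x) (\int[PG_measure (Phistar mu)]_x f x).
have t2 := ler_distD (\int[PG_measure mu]_x f' x)
  (\int[PG_measure mu0]_x f' x) (\int[PG_measure (Phistar mu)]_x f x).
have := close mu; rewrite distrC; have := close mu0.
move: hmu t1 t2 => /=; rewrite /f''/=; lra.
Qed.

End PG_maps.

Section probability_builder.
Variables (R : realType) (T : ptopologicalType) (m : set (borel T) -> \bar R).
Hypotheses (m0 : m set0 = 0%E) (m_ge0 : forall A, (0 <= m A)%E).
Hypotheses (m_add : semi_sigma_additive m) (mT : m setT = 1%E).

Lemma exists_probability : exists P : probability (borel T) R, forall A, P A = m A.
Proof.
pose M : {measure set (borel T) -> \bar R} := HB.pack_for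
  {measure set (borel T) -> \bar R} m
  (isMeasure.Build _ (borel T) R m m0 m_ge0 m_add).
pose P : probability (borel T) R := HB.pack_for (probability (borel T) R)
  (M : set (borel T) -> \bar R) (Measure.class M)
  (Measure_isProbability.Build _ (borel T) R M mT).
by exists P.
Qed.

End probability_builder.

(** * Bijections between non-Borel sets *)

Section cantor_scheme.
Variables (G : groupType) (T : ptopologicalType) (a : G -> T -> T).
Variable c : nat -> T -> bool.
Hypothesis cc : coded c.
Variable z : T.
Hypothesis rec : forall n g, exists h, agree c n (a g z) (a h z) /\ a h z <> a g z.
Local Open Scope nat_scope.

(** At each node the orbit point stays or moves to another one that agrees with it up to the current
    precision; the precision is then raised past a difference of the two. Branches converge, and
    distinct ones stay apart. *)
Lemma cantor_scheme : exists theta : (nat -> bool) -> T, injective theta /\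
  forall i u u', (forall k, k <= i -> u k = u' k) -> c i (theta u) = c i (theta u').
Proof.
have /choice[nx hnx] : forall s : G * nat, exists s' : G * nat,
    [/\ agree c s.2 (a s.1 z) (a s'.1 z), s.2 < s'.2 &
     ~ agree c s'.2 (a s.1 z) (a s'.1 z)].
  move=> [g n]; have [h [ag ne]] := rec n g.
  have [i ci] := coded_sep cc ne.
  exists (h, (maxn n i).+1); split => //=; first by rewrite ltnS leq_maxl.
  by move=> /(_ i); rewrite ltnS leq_maxr => /(_ isT) e; apply: ci; rewrite e.
pose next (s : G * nat) (v : bool) := ((if v then (nx s).1 else s.1), (nx s).2).
pose fix node (u : nat -> bool) k : G * nat :=
  if k is m.+1 then next (node u m) (u m) else (1%g, 0).
have node_eq u u' k : (forall i, i < k -> u i = u' i) -> node u k = node u' k.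
  elim: k => //= k IH h; rewrite IH => [|i ik]; last by apply: h; rewrite ltnW.
  by rewrite h.
pose v u k := a (node u k).1 z; pose d u k := (node u k).2.
have d_lt u k : d u k < d u k.+1 by case: (hnx (node u k)).
have d_le u k m : k <= m -> d u k <= d u m.
  elim: m => [|m IH]; first by rewrite leqn0 => /eqP ->.
  rewrite leq_eqVlt => /orP[/eqP -> //|]; rewrite ltnS => /IH h.
  exact: leq_trans h (ltnW (d_lt u m)).
have d_ge u k : k <= d u k by elim: k => // k IH; exact: leq_ltn_trans IH (d_lt u k).
have step u k : agree c (d u k) (v u k) (v u k.+1).
  rewrite /v /= /next; case: (u k) => //=.
  by have [] := hnx (node u k).
have chain u k m : k <= m -> agree c (d u k) (v u k) (v u m).
  elim: m => [|m IH]; first by rewrite leqn0 => /eqP ->.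
  rewrite leq_eqVlt => /orP[/eqP -> //|]; rewrite ltnS => km i hi.
  by rewrite IH// step// (leq_trans hi)// d_le.
have /choice[theta htheta] : forall u, exists x, forall k, agree c k (v u k) x.
  move=> u; apply: (coded_limit cc) => k m km.
  exact: agree_le (d_ge u k) (chain u k m km).
have full u k : agree c (d u k) (v u k) (theta u).
  move=> i hi; rewrite (chain u k (maxn k i.+1) (leq_maxl _ _) i hi) htheta//.
  by rewrite leq_max leqnn orbT.
exists theta; split.
  move=> u u' e; apply: contrapT => ne.
  have h : exists k, u k != u' k.
    apply: contrapT => h; apply: ne; apply/funext => k; apply/eqP/negPn/negP => h'.
    by apply: h; exists k.
  case: (ex_minnP h) => k uk kmin.
  have nodek : node u k = node u' k.
    apply: node_eq => i ik; apply/eqP/negPn/negP => /kmin.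
    by rewrite leqNgt ik.
  have dk : d u k.+1 = d u' k.+1 by rewrite /d /= nodek.
  have [_ _] := hnx (node u k); apply => i hi.
  have h1 := full u k.+1 i hi; have h2 := full u' k.+1 i.
  rewrite -dk in h2; have {}h2 := h2 hi.
  move: h1 h2; rewrite -e /v /= -nodek /next /=.
  by case: (u k) (u' k) uk => -[] //= _ -> ->.
move=> i u u' uu'.
rewrite -(htheta u i.+1)// -(htheta u' i.+1)// /v.
by rewrite (node_eq u u')// => k; rewrite ltnS; exact: uu'.
Qed.

End cantor_scheme.

(** * Recurrent points of invariant measures *)

Section recurrence.
Variables (R : realType) (G : groupType).
Hypotheses (cG : countable [set: G]) (iG : infinite_set [set: G]).
Variables (T : ptopologicalType) (a : G -> T -> T).
Hypothesis aT : is_action a.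
Variable c : nat -> T -> bool.
Hypothesis cc : coded c.
Variable mu : probability (borel T) R.
Hypothesis inv : invariant_probability (R := R) a mu.
Variable D : set (borel T).
Hypotheses (mD : measurable D) (muD : mu D = 1%E).
Hypothesis freeD : forall x g, D x -> a g x = x -> g = 1%g.

(* Poincare recurrence: the points of [U] that never return to [U] form a
   wandering set, which is null. *)
Lemma wandering_null (U : set (borel T)) : measurable U ->
  let V := [set x | U x /\ forall g, g <> 1%g -> ~ U (a g x)] in
  measurable (V : set (borel T)) /\ mu V = 0%E.
Proof.
move=> mU V.
have mV : measurable (V : set (borel T)).
  have -> : V = U `\` \bigcup_g (if pselect (g = 1%g) then set0 else a g @^-1` U).
    apply/seteqP; split => x.
      move=> [Ux h]; split => // -[g _]; case: pselect => // g1; exact: h.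
    move=> [Ux h]; split => // g g1 Ug; apply: h; exists g => //.
    by case: pselect.
  apply: measurableD => //; apply: countable_bigcupT_measurable => // g.
  by case: pselect => h; [exact: measurable0|exact: action_measurable].
split => //; apply/eqP; rewrite eq_le measure_ge0 andbT.
apply/lee_addgt0Pr => e e0; rewrite add0e.
have [n hn] : exists n, n.+1%:R^-1 < e.
  have := @cvg_harmonic R => /cvgrPdist_lt/(_ _ e0)[n _ /(_ n (leqnn n))].
  by rewrite sub0r normrN ger0_norm ?invr_ge0//; exists n.
have [F _ nF] := infinite_set_fset n.+1 iG.
apply: (@le_trans _ _ (n.+1%:R^-1)%:E); last by rewrite lee_fin ltW.
apply: (frequency_bound aT inv mV (F := F)) => //.
  by rewrite -cardfs_gt0 (leq_trans _ nF).
move=> x; apply: leq_trans (nF); rewrite -[leqRHS]muln1 leq_mul//.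
rewrite leqNgt; apply/negP => h.
have [f fF Vf] := cnt_gt0 (ltnW h).
suff : (cnt F (fun f => V (a f x)) <= cnt [fset f]%fset (fun=> True))%N.
  move=> /(leq_trans h); rewrite ltnNge => /negP; apply.
  by rewrite (leq_trans (cnt_card _ _))// cardfs1.
apply: (@cnt_inj _ _ _ _ _ id) => // g gF Vg; split => //.
rewrite inE; apply/eqP; apply: contrapT => gf.
apply: (Vf.2 (g * f^-1)%g); last by rewrite -(actionM aT) mulgVK; case: Vg.
by move/divg1_eq.
Qed.

(** Only countably many cylinders are involved, so some point of [D] returns to each cylinder
    containing it. Continuity carries the return over to [a g z], and freeness on [D] makes it a
    different point. *)
Lemma exists_recurrent : exists z, forall n g, exists h,
  agree c n (a g z) (a h z) /\ a h z <> a g z.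
Proof.
pose U (w : seq bool) : set (borel T) :=
  [set x | forall i, (i < size w)%N -> c i x = nth false w i].
have mU w : measurable (U w).
  have -> : U w = (fun x => [seq c i x | i <- iota 0 (size w)]) @^-1` [set w].
    apply/seteqP; split => x h.
      apply: (@eq_from_nth _ false); rewrite size_map size_iota// => i iw.
      by rewrite (nth_map 0%N) ?size_iota// nth_iota// h.
    move=> i iw; have := congr1 (fun s => nth false s i) h.
    by rewrite (nth_map 0%N) ?size_iota// nth_iota.
  apply: lc_borel => x; apply: filterS (agree_locally_constant cc (size w) x) => y h.
  by apply/eq_in_map => i; rewrite mem_iota => /h.
pose V w : set (borel T) := [set x | U w x /\ forall g, g <> 1%g -> ~ U w (a g x)].
have mV w : measurable (V w) by case: (wandering_null (mU w)).
have V0 w : mu (V w) = 0%E by case: (wandering_null (mU w)).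
have mVV : measurable (\bigcup_w V w).
  by apply: countable_bigcupT_measurable => //; exact: countableP.
have VV0 : mu (\bigcup_w V w) = 0%E.
  pose V' n : set (borel T) :=
    if (choice.unpickle n : option (seq bool)) is Some w then V w else set0.
  have mV' n : measurable (V' n).
    by rewrite /V'; case: choice.unpickle => [w|]; [exact: mV|exact: measurable0].
  have VE : \bigcup_w V w = \bigcup_n V' n.
    apply/seteqP; split => x.
      by move=> [w _ Vw]; exists (choice.pickle w) => //; rewrite /V' choice.pickleK.
    by move=> [n _]; rewrite /V'; case: choice.unpickle => // w Vw; exists w.
  apply/eqP; rewrite eq_le measure_ge0 andbT VE.
  apply: (le_trans (generalized_Boole_inequality mu mV' _)).
    by rewrite -VE.
  rewrite eseries0// => n _ _; rewrite /V'.
  by case: choice.unpickle => [w|]; [exact: V0|exact: measure0].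
have [z [Dz nV]] : exists z, D z /\ ~ (\bigcup_w V w) z.
  apply: contrapT => no.
  have : D `<=` \bigcup_w V w.
    by move=> x Dx; apply: contrapT => nx; apply: no; exists x.
  move=> DV; have : (mu D <= mu (\bigcup_w V w))%E by apply: le_measure; rewrite ?inE.
  by rewrite VV0 muD lee_fin ler10.
exists z => n g.
have nb : nbhs z (a g @^-1` agree c n (a g z)).
  apply: (@action_continuous _ _ _ aT g z); apply: open_nbhs_nbhs; split => //.
  exact: agree_open.
have [m hm] := coded_base cc nb.
pose w := [seq c i z | i <- iota 0 m].
have wE i : (i < size w)%N -> nth false w i = c i z.
  rewrite size_map size_iota => ni.
  by rewrite (nth_map 0%N) ?size_iota// nth_iota.
have Uz : U w z by move=> i iw; rewrite wE.
have [h [h1 Uh]] : exists h, h <> 1%g /\ U w (a h z).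
  apply: contrapT => no; apply: nV; exists w => //; split => // h h1 Uh.
  by apply: no; exists h.
exists (g * h)%g; rewrite (actionM aT); split.
  apply: hm => i im; have iw : (i < size w)%N by rewrite size_map size_iota.
  by rewrite Uh// wE.
by move=> /(can_inj (actionK aT g))/(freeD Dz).
Qed.

End recurrence.

Section nonmeasurable_sets.

Lemma coded_injection (S T : ptopologicalType) (cS : nat -> S -> bool)
    (cT : nat -> T -> bool) (theta : (nat -> bool) -> T) :
  coded cS -> coded cT -> injective theta ->
  (forall i u u', (forall k, (k <= i)%N -> u k = u' k) ->
    cT i (theta u) = cT i (theta u')) ->
  exists f : S -> T, injective f /\ continuous f.
Proof.
move=> codS codT it ft; exists (fun x => theta (fun k => cS k x)); split.
  move=> x y /it e; apply: contrapT => /(coded_sep codS)[i]; apply.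
  exact: (congr1 (@^~ i) e).
apply: (coded_continuous codT) => i x.
apply: filterS (agree_locally_constant codS i.+1 x) => y h.
by apply: ft => k ki; exact: h.
Qed.

(** The direct image is used: by injectivity it pulls back to the original set, so a Borel image
    would make that set Borel. *)
Lemma nonmeasurable_card_le (S T : ptopologicalType) (f : S -> T) :
  injective f -> continuous f ->
  ([set A : set (borel S) | ~ measurable A] #<=
   [set A : set (borel T) | ~ measurable A])%card.
Proof.
move=> fi cf.
have pre (A : set S) : A = f @^-1` (f @` A).
  apply/seteqP; split => x; first by move=> Ax; exists x.
  by move=> [y Ay /fi <-].
have inj : {in [set A : set (borel S) | ~ measurable A] &,
    injective (fun A : set S => f @` A)}.
  by move=> A B _ _ e; rewrite (pre A) e -pre.
have /card_eqPle[_ h] := inj_card_eq inj.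
apply: card_le_trans h _; apply: subset_card_le.
move=> _ [A nA <-] mA; apply: nA; rewrite (pre A).
by rewrite -[X in measurable X]setTI; apply: (continuous_borel cf).
Qed.

Lemma nonmeasurable_bij (S T : ptopologicalType) (f : S -> T) (g : T -> S) :
  injective f -> continuous f -> injective g -> continuous g ->
  exists J : set (borel S) -> set (borel T),
    set_bij [set A | ~ measurable A] [set A | ~ measurable A] J.
Proof.
move=> fi cf gi cg; apply/card_set_bijP.
by apply: Cantor_Bernstein; apply: nonmeasurable_card_le; eauto.
Qed.

End nonmeasurable_sets.

Lemma probability_ext (R : realType) (T : ptopologicalType)
  (P Q : probability (borel T) R) : (forall A, P A = Q A) -> P = Q.
Proof.
case: P => p pc; case: Q => q qc /= pq.
have e : p = q by apply/funext.
subst q; suff -> : pc = qc by [].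
case: pc => [[p1 p2] [p3] [p4] [p5] [p6] [p7] [p8]].
case: qc => [[q1 q2] [q3] [q4] [q5] [q6] [q7] [q8]].
rewrite (Prop_irrelevance q1 p1) (Prop_irrelevance q2 p2) in q3 *.
by rewrite (Prop_irrelevance q3 p3) (Prop_irrelevance q4 p4) (Prop_irrelevance q5 p5)
  (Prop_irrelevance q6 p6) (Prop_irrelevance q7 p7) (Prop_irrelevance q8 p8).
Qed.

(** * The Borel star isomorphism *)

Section full_sets.
Variables (R : realType) (T : ptopologicalType) (mu : probability (borel T) R).

Lemma measure_eq_on_full (D A B : set (borel T)) : measurable D -> mu D = 1%E ->
  measurable A -> measurable B -> (forall x, D x -> (A x <-> B x)) -> mu A = mu B.
Proof.
move=> mD D1 mA mB AB.
have nD : mu (~` D) = 0%E by rewrite probability_setC// D1 subee.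
have key (C : set (borel T)) : measurable C -> mu C = mu (C `&` D).
  move=> mC.
  have CE : C = (C `&` D) `|` (C `\` D) by rewrite setUIDK.
  have dis : (C `&` D) `&` (C `\` D) = set0.
    by apply/seteqP; split => x // -[[_ ?] []].
  have -> : mu C = (mu (C `&` D) + mu (C `\` D))%E.
    by rewrite {1}CE; apply: measureU => //; [exact: measurableI|exact: measurableD].
  suff -> : mu (C `\` D) = 0%E by rewrite adde0.
  apply/eqP; rewrite eq_le measure_ge0 andbT -nD.
  by apply: le_measure; rewrite ?inE; [exact: measurableD|exact: measurableC|move=> x []].
rewrite key// [RHS]key//; congr (mu _).
by apply/seteqP; split => x [h Dx]; split => //; exact/AB.
Qed.

Lemma full_bigcap (I : Type) (F : I -> set (borel T)) : countable [set: I] ->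
  (exists i : I, True) -> (forall i, measurable (F i)) -> (forall i, mu (F i) = 1%E) ->
  measurable (\bigcap_i F i) /\ mu (\bigcap_i F i) = 1%E.
Proof.
move=> cI [i0 _] mF F1; have [c hc] := recurrent_enumeration i0 cI.
have -> : \bigcap_i F i = ~` \bigcup_n ~` F (c n).
  apply/seteqP; split => x; first by move=> h [n _]; apply; exact: h.
  move=> h i _; apply: contrapT => nF; apply: h.
  by have [n _ ci] := hc i 0%N; exists n => //; rewrite ci.
have mU : measurable (\bigcup_n ~` F (c n)).
  by apply: bigcupT_measurable => n; exact: measurableC.
split; first exact: measurableC.
rewrite probability_setC//.
suff -> : mu (\bigcup_n ~` F (c n)) = 0%E by rewrite sube0.
apply/eqP; rewrite eq_le measure_ge0 andbT.
apply: (le_trans (generalized_Boole_inequality mu _ mU)).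
  by move=> n; exact: measurableC.
rewrite eseries0// => n _ _.
have : mu (~` F (c n)) = 0%E by rewrite probability_setC// F1 subee.
by [].
Qed.

End full_sets.

Section transport.
Variables (R : realType) (G : groupType) (S T : ptopologicalType).
Variables (a : G -> S -> S) (b : G -> T -> T).
Hypotheses (aS : is_action a) (bT : is_action b).
Variables (D : set (borel S)) (Phi : borel S -> borel T).
Hypothesis mD : measurable D.
Hypothesis D1 : forall mu : PG R a, PG_measure mu D = 1%E.
Hypothesis mPhi : measurable_fun setT Phi.
Hypothesis DPhi : forall g x, D x -> D (a g x) /\ Phi (a g x) = b g (Phi x).

Lemma preimage_measurable (B : set (borel T)) : measurable B -> measurable (Phi @^-1` B).
Proof. by move=> mB; rewrite -[X in measurable X]setTI; exact: mPhi. Qed.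

(* The values of a measure on non-measurable sets are arbitrary, so they have
   to be transported as well, along [J]. *)
Lemma transport_measure (J : set (borel T) -> set (borel S)) : exists F : PG R a -> PG R b,
  forall mu, (forall B, measurable B ->
    PG_measure (F mu) B = PG_measure mu (Phi @^-1` B)) /\
   (forall B, ~ measurable B -> PG_measure (F mu) B = PG_measure mu (J B)).
Proof.
suff /choice[F hF] : forall mu : PG R a, exists nu : PG R b,
    (forall B, measurable B -> PG_measure nu B = PG_measure mu (Phi @^-1` B)) /\
    (forall B, ~ measurable B -> PG_measure nu B = PG_measure mu (J B)).
  by exists F.
move=> mu; pose P := PG_measure mu.
have invP : invariant_probability (R := R) a P by exact: (set_valP mu).
pose m (B : set (borel T)) : \bar R :=
  if pselect (measurable B) then P (Phi @^-1` B) else P (J B).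
have mE B : measurable B -> m B = P (Phi @^-1` B).
  by rewrite /m; case: pselect.
have [nu hnu] : exists nu : probability (borel T) R, forall A, nu A = m A.
  apply: exists_probability.
  - by rewrite mE// preimage_set0 measure0.
  - by move=> A; rewrite /m; case: pselect => ?; exact: measure_ge0.
  - move=> F mF tF mUF; rewrite mE//.
    have := @measure_semi_sigma_additive _ _ _ (pushforward P Phi) F mF tF mUF.
    have -> : (fun n => (\sum_(0 <= i < n) m (F i))%E) =
        (fun n => (\sum_(0 <= i < n) pushforward P Phi (F i))%E).
      by apply/funext => n; apply: eq_bigr => i _; rewrite mE.
    by move=> h; exact: (h mPhi).
  - by rewrite mE// preimage_setT; exact: probability_setT.
have inv_nu : invariant_probability (R := R) b nu.
  move=> g A mA.
  have bA : b g @` A = b g^-1%g @^-1` A by rewrite (action_preimage bT) invgK.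
  have mbA : measurable (b g @` A : set (borel T)).
    by rewrite bA; exact: action_measurable.
  rewrite !hnu !mE// bA -(invariant_preimage aS invP g^-1%g (preimage_measurable mA)).
  apply: (@measure_eq_on_full _ _ _ D) => //.
  - exact: D1.
  - by apply: preimage_measurable; rewrite -bA.
  - by apply: action_measurable => //; exact: preimage_measurable.
  - by move=> x Dx; rewrite /preimage /=; have [_ ->] := DPhi g^-1%g Dx.
exists (exist _ nu (mem_set inv_nu)); split => B mB /=.
  by rewrite -mE// -hnu.
have : m B = P (J B) by rewrite /m; case: pselect.
by rewrite -hnu.
Qed.

End transport.

Section eventually.
Variables (R : realType) (G : groupType) (T : ptopologicalType) (a : G -> T -> T).
Hypotheses (cG : countable [set: G]) (aT : is_action a).
Variable B : nat -> set (borel T).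
Hypothesis mB : forall j, measurable (B j).

Definition orbit_eventually_not : set (borel T) :=
  \bigcap_g (a g @^-1` eventually_not B).

Lemma orbit_eventually_not_measurable : measurable orbit_eventually_not.
Proof.
rewrite /orbit_eventually_not -[X in measurable X]setCK setC_bigcap.
apply: measurableC; apply: countable_bigcupT_measurable => // g.
by apply: measurableC; apply: action_measurable => //; exact: eventually_not_measurable.
Qed.

Lemma orbit_eventually_not_full (mu : PG R a) :
  (forall j, (PG_measure mu (B j) <= ((2 ^ j)%:R^-1)%:E)%E) ->
  PG_measure mu orbit_eventually_not = 1%E.
Proof.
move=> hB; apply: (full_bigcap cG (ex_intro _ 1%g I) _ _).2 => g.
  by apply: action_measurable => //; exact: eventually_not_measurable.
have inv : invariant_probability (R := R) a (PG_measure mu) by exact: (set_valP mu).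
rewrite (invariant_preimage aT inv); first exact: eventually_not_full.
exact: eventually_not_measurable.
Qed.

Lemma orbit_eventually_not_action g x : orbit_eventually_not x ->
  orbit_eventually_not (a g x).
Proof. by move=> h h' _; rewrite /preimage /= -(actionM aT); exact: h. Qed.

End eventually.

Lemma small_power (R : realType) (e : R) : 0 < e ->
  exists m, forall k, (m <= k)%N -> 2 / (2 ^ k)%:R < e.
Proof.
move=> e0; have h1 : `|2^-1 : R| < 1.
  by rewrite ger0_norm ?invr_ge0// invf_lt1 ?ltr1n.
have e2 : 0 < e / 2 by rewrite divr_gt0.
have /cvgrPdist_lt/(_ _ e2)[n _ h] := cvg_expr h1; exists n => k /h.
rewrite sub0r normrN ger0_norm ?exprn_ge0 ?invr_ge0//.
by rewrite ltr_pdivlMr ?ltr0n// natrX exprVn mulrC.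
Qed.

Section recurrent_embedding.
Variables (R : realType) (G : groupType).
Hypotheses (cG : countable [set: G]) (iG : infinite_set [set: G]).
Variables (S T : ptopologicalType) (a : G -> S -> S).
Hypothesis aS : is_action a.
Variables (cS : nat -> S -> bool) (cT : nat -> T -> bool).
Hypotheses (codS : coded cS) (codT : coded cT).

Lemma recurrent_embedding (mu : PG R a) (D : set (borel S)) : measurable D ->
  PG_measure mu D = 1%E -> (forall x g, D x -> a g x = x -> g = 1%g) ->
  exists f : T -> S, injective f /\ continuous f.
Proof.
move=> mD D1 freeD.
have [z hz] := exists_recurrent cG iG aS codS (set_valP mu) mD D1 freeD.
have [theta [ti tc]] := cantor_scheme codS hz.
exact: (coded_injection codT codS ti tc).
Qed.

End recurrent_embedding.

Section criterion.
Variables (R : realType) (G : groupType).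
Hypotheses (cG : countable [set: G]) (iG : infinite_set [set: G]).
Variables (S T : ptopologicalType) (a : G -> S -> S) (b : G -> T -> T).
Hypotheses (aS : is_action a) (bT : is_action b).
Variables (cS : nat -> S -> bool) (cT : nat -> T -> bool).
Hypotheses (codS : coded cS) (codT : coded cT).
Variables (D : set (borel S)) (E : set (borel T)).
Hypotheses (mD : measurable D) (mE : measurable E).
Hypothesis D1 : forall mu : PG R a, PG_measure mu D = 1%E.
Hypothesis E1 : forall nu : PG R b, PG_measure nu E = 1%E.
Variables (Phi : borel S -> borel T) (Psi : borel T -> borel S).
Hypotheses (mPhi : measurable_fun setT Phi) (mPsi : measurable_fun setT Psi).
Hypotheses (DPhi : forall x, D x -> E (Phi x)) (EPsi : forall y, E y -> D (Psi y)).
Hypotheses (PhiK : forall x, D x -> Psi (Phi x) = x).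
Hypotheses (PsiK : forall y, E y -> Phi (Psi y) = y).
Hypothesis Da : forall g x, D x -> D (a g x).
Hypothesis Phi_eq : forall g x, D x -> Phi (a g x) = b g (Phi x).
Hypotheses (aPhi : approximable R a cT Phi) (aPsi : approximable R b cS Psi).

Let Eb g y : E y -> E (b g y) /\ Psi (b g y) = a g (Psi y).
Proof.
move=> yE; rewrite -{1 2}(PsiK yE) -Phi_eq; last exact: EPsi.
by split; [apply: DPhi|rewrite PhiK//]; apply: Da; exact: EPsi.
Qed.

(** The laws are stated under [PG R a] because the embeddings of the two spaces into each other come
    from recurrence of an invariant measure; without one, constant functions serve. *)
Let exists_junk : (forall x g, D x -> a g x = x -> g = 1%g) ->
  exists (J : set (borel T) -> set (borel S)) (J' : set (borel S) -> set (borel T)),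
  PG R a ->
    (forall A, ~ measurable A -> ~ measurable (J' A) /\ J (J' A) = A) /\
    (forall B, ~ measurable B -> ~ measurable (J B) /\ J' (J B) = B).
Proof.
move=> freeD.
have [[mu _]|nmu] := pselect (exists mu : PG R a, True); last first.
  by exists (fun=> set0), (fun=> set0) => mu; case: nmu; exists mu.
have [f [fi fc]] := recurrent_embedding cG iG aS codS codT mD (D1 mu) freeD.
(* Only some invariant measure on [T] is wanted here, so the values on non-Borel sets may be
   arbitrary. *)
have [F _] := transport_measure aS bT mD D1 mPhi
  (fun g x Dx => conj (Da g Dx) (Phi_eq g Dx)) (fun=> set0).
have freeE y g : E y -> b g y = y -> g = 1%g.
  move=> yE eq; apply: (freeD (Psi y)); first exact: EPsi.
  by have [_ <-] := Eb g yE; rewrite eq.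
have [f' [fi' fc']] := recurrent_embedding cG iG bT codT codS mE (E1 (F mu)) freeE.
have [J' [J'im J'inj J'surj]] := nonmeasurable_bij fi' fc' fi fc.
have /choice[J hJ] : forall B : set (borel T), exists A : set (borel S),
    ~ measurable B -> ~ measurable A /\ J' A = B.
  move=> B; have [?|nB] := pselect (measurable B); first by exists set0.
  by have [A nA <-] := J'surj B nB; exists A.
exists J, J' => _; split => [A nA|]; last exact: hJ.
have nJ : ~ measurable (J' A) by exact: J'im.
split => //; have [nJJ eq] := hJ _ nJ.
by apply: J'inj => //; apply/mem_set.
Qed.

Lemma borel_star_criterion : (forall x g, D x -> a g x = x -> g = 1%g) ->
  borel_star_isomorphic R a b.
Proof.
move=> freeD; have [J [J' JP]] := exists_junk freeD.
have [F hF] := transport_measure aS bT mD D1 mPhi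
  (fun g x Dx => conj (Da g Dx) (Phi_eq g Dx)) J.
have [H hH] := transport_measure bT aS mE E1 mPsi Eb J'.
have mPD B : measurable B -> measurable (Phi @^-1` B) by exact: preimage_measurable.
have mPE A : measurable A -> measurable (Psi @^-1` A) by exact: preimage_measurable.
have FK : cancel F H.
  move=> mu; apply/val_inj/probability_ext => A.
  have [mA|nA] := pselect (measurable A).
    rewrite [LHS](hH (F mu)).1// (hF mu).1; last exact: mPE.
    apply: (measure_eq_on_full mD (D1 mu)) => //; first by apply: mPD; exact: mPE.
    by move=> x Dx; rewrite /preimage /= PhiK.
  have [h1 _] := JP mu; have [nJ JK] := h1 A nA.
  by rewrite [LHS](hH (F mu)).2// (hF mu).2// JK.
have HK : cancel H F.
  move=> nu; apply/val_inj/probability_ext => B.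
  have [mB|nB] := pselect (measurable B).
    rewrite [LHS](hF (H nu)).1// (hH nu).1; last exact: mPD.
    apply: (measure_eq_on_full mE (E1 nu)) => //; first by apply: mPE; exact: mPD.
    by move=> x Dx; rewrite /preimage /= PsiK.
  have [_ h2] := JP (H nu); have [nJ JK] := h2 B nB.
  by rewrite [LHS](hF (H nu)).2// (hH nu).2// JK.
have formula mu B : measurable B ->
    PG_measure (F mu) B = PG_measure mu (D `&` Phi @^-1` B).
  move=> mB; rewrite (hF mu).1//; apply: (measure_eq_on_full mD (D1 mu)).
  - exact: mPD.
  - by apply: measurableI => //; exact: mPD.
  - by move=> x Dx; split => [?|[]].
exists D, E, Phi; split.
- split; first by split => // mu inv; exact: (D1 (exist _ mu (mem_set inv))).
  move=> g; apply/seteqP; split => [_ [x Dx <-]|x Dx]; first exact: Da.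
  by exists (a g^-1%g x); [exact: Da|rewrite actionVK].
- split; first by split => // nu inv; exact: (E1 (exist _ nu (mem_set inv))).
  move=> g; apply/seteqP; split => [_ [y Ey <-]|y Ey]; first by have [] := Eb g Ey.
  by exists (b g^-1%g y); [have [] := Eb g^-1%g Ey|rewrite actionVK].
- split; last by apply: (measurable_funS measurableT) mPhi.
  split => [|x x' /set_mem Dx /set_mem Dx' eq|y Ey]; first exact: DPhi.
    by rewrite -(PhiK Dx) -(PhiK Dx') eq.
  by exists (Psi y); [exact: EPsi|exact: PsiK].
- exact: Phi_eq.
exists F; split => //.
  split; first by apply: (PG_continuous codT mPhi _ aPhi) => mu; exact: (hF mu).1.
  exists H; split => //.
  by apply: (PG_continuous codS mPsi _ aPsi) => nu; exact: (hH nu).1.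
move=> t mu nu rho _ h B mB; rewrite !(hF _).1//; apply: h; exact: mPD.
Qed.

End criterion.

(** * The limit map and its inverse *)

Section assembly.
Variables (R : realType) (G : groupType).
Hypotheses (cG : countable [set: G]) (iG : infinite_set [set: G]).
Variables (X : ptopologicalType) (a : G -> X -> X).
Hypotheses (aX : is_action a) (fX : free_action a).
Variable b : nat -> X -> bool.
Hypothesis bcoded : forall s, coded (fun i => b (s + i)%N).
Variables (E : nat -> {fset G}) (pat : nat -> seq (G * nat * bool)).
Hypothesis E1 : forall j, 1%g \in E j.
Hypothesis Eev : forall g, exists j0, forall j, (j0 <= j)%N -> g \in E j.
Variables (st : nat -> state G X) (dt : nat -> data G X).
Hypothesis inv_st : forall j, inv_state a b (st j).
Hypothesis next_st : forall j, next a b E pat j (st j) (dt j) (st j.+1).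
Variables (Y : ptopologicalType) (ev : Y -> G -> nat -> bool) (sigma : G -> Y -> Y).
Hypothesis aY : is_action sigma.
Hypotheses (ev_inj : injective ev) (evP : forall y, limit_point a st (ev y)).
Hypothesis ev_surj : forall f, limit_point a st f -> exists y, ev y = f.
Hypothesis ev_lc : forall g i, locally_constant (fun y => ev y g i).
Hypothesis ev_shift : forall g y, ev (sigma g y) = shift (ev y) g.
Variable idx : nat -> G * nat.
Let c n y := ev y (idx n).1 (idx n).2.
Hypothesis cod : coded c.
Local Open Scope nat_scope.

Let bcod : coded b := bcoded 0.

Let hitsB j : set (borel X) := hits a dt j.
Let badB j : set (borel Y) := [set y | ~ good a E st dt j (ev y)].

Let hits_measurable j : measurable (hitsB j).
Proof.
have lc : locally_constant (fun v => `[< hits a dt j v >]).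
  move=> x; apply: filterS (agree_locally_constant bcod (ss (st j.+1)) x) => y h.
  apply: asbool_equiv_eq; apply: (fun h' => let: And3 h1 _ _ := next_det (next_st j) h' in h1).
  by move=> i /andP[_ /h].
have -> : hitsB j = (fun v => `[< hits a dt j v >]) @^-1` [set true].
  by apply/seteqP; split => x /=; [move=> ?; apply/asboolP|move=> /asboolP].
exact: lc_borel.
Qed.

Let ev_near (W : seq (G * nat)) y :
  \forall y' \near y, forall u, u \in W -> ev y' u.1 u.2 = ev y u.1 u.2.
Proof.
elim: W => [|u W IH]; first by apply: nearW.
apply: filterS2 (ev_lc u.1 u.2 y) IH => y' h IH v.
by rewrite in_cons => /orP[/eqP ->|/IH].
Qed.

Let bad_measurable j : measurable (badB j).
Proof.
have lc : locally_constant (fun y => `[< ~ good a E st dt j (ev y) >]).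
  move=> y; apply: filterS (ev_near [seq (g, i) | g <- E j, i <- iota 0 (ss (st j.+1))] y).
  move=> y' h; apply: asbool_equiv_eq.
  have h' g i : g \in E j -> i < ss (st j.+1) -> ev y' g i = ev y g i.
    move=> gE hi; apply: (h (g, i)); apply/allpairsP; exists (g, i).
    by rewrite mem_iota.
  split; apply: contra_not => -[v [nh hv]]; exists v; split => // g i gE hi.
    by rewrite h'// hv.
  by rewrite -h'// hv.
have -> : badB j = (fun y => `[< ~ good a E st dt j (ev y) >]) @^-1` [set true].
  by apply/seteqP; split => x /=; [move=> ?; apply/asboolP|move=> /asboolP].
exact: lc_borel.
Qed.

Let hits_bound (mu : PG R a) j :
  (PG_measure mu (hitsB j) <= ((2 ^ j)%:R^-1)%:E)%E.
Proof.
apply: (frequency_bound aX (set_valP mu) (hits_measurable j) (next_F0 (next_st j))).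
  by rewrite expn_gt0.
by move=> x; exact: (hits_frequent aX next_st).
Qed.

Let bad_bound (nu : PG R sigma) j :
  (PG_measure nu (badB j) <= ((2 ^ j)%:R^-1)%:E)%E.
Proof.
apply: (frequency_bound aY (set_valP nu) (bad_measurable j) (next_F0 (next_st j))).
  by rewrite expn_gt0.
move=> y; apply: leq_trans (limit_point_good aX inv_st next_st j (evP y)).
by rewrite leq_mul//; apply: cnt_le => f _; rewrite /badB /= ev_shift.
Qed.

Let XE_bound (mu : PG R a) m : (PG_measure mu (late hitsB m) <= (2 / (2 ^ m)%:R)%:E)%E.
Proof. exact: late_bound. Qed.

Let YE_bound (nu : PG R sigma) m : (PG_measure nu (late badB m) <= (2 / (2 ^ m)%:R)%:E)%E.
Proof. exact: late_bound. Qed.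

Let XE : set (borel X) := orbit_eventually_not a hitsB.
Let YE : set (borel Y) := orbit_eventually_not sigma badB.

Let XE_unhit x : XE x -> eventually_unhit a dt x.
Proof. by move=> h g; exact: (h g I). Qed.

Let YE_good y : YE y -> eventually_good a E st dt (ev y).
Proof.
move=> h g; have [j0 hj0] := h g I; exists j0 => j /hj0 nb.
by rewrite -ev_shift; apply: contrapT => ng; apply: nb.
Qed.

Let unhit_XE x : eventually_unhit a dt x -> XE x.
Proof. by move=> h g _; exact: h. Qed.

Let b_tail x x' s : (forall i, s <= i -> b i x = b i x') -> x = x'.
Proof.
move=> h; apply: contrapT => /(coded_sep (bcoded s))[i]; apply.
by apply: h; rewrite leq_addr.
Qed.

(** The constant value off [XE] makes [Phi] measurable on the whole space and not only on [XE]. *)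
Let exists_Phi : exists Phi : borel X -> borel Y, (forall x, ~ XE x -> Phi x = point) /\
  forall x, XE x -> forall g j0, (forall j, j0 <= j -> ~ hits a dt j (a g x)) ->
    forall j i, j0 <= j -> ev (Phi x) g i = approx a st j x g i.
Proof.
suff /choice[Phi h] : forall x, exists y, (~ XE x -> y = point) /\ (XE x ->
  forall g j0, (forall j, j0 <= j -> ~ hits a dt j (a g x)) ->
    forall j i, j0 <= j -> ev y g i = approx a st j x g i).
  by exists Phi; split => x; [exact: (h x).1|exact: (h x).2].
move=> x; have [xE|?] := pselect (XE x); last by exists point.
have ux := XE_unhit xE; have [f hf] := exists_limit aX inv_st next_st ux.
have [|y yf] := @ev_surj f; last by exists y; split => // _; rewrite yf.
have /choice[J hJ] := ux.
move=> W K; exists (maxn K (\max_(u <- W) J u.1)), x; split; first by rewrite leq_maxl.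
move=> u uW; apply: (hf u.1 (J u.1)); first exact: hJ.
rewrite leq_max; apply/orP; right.
exact: (@leq_bigmax_seq _ W xpredT (fun u => J u.1)).
Qed.

(* Off the sets [late badB m], the first bits of the preimage of [y] are read
   off its bits in the block between [ss (st m)] and [ss (st m.+1)]. *)
Let read m (y : Y) i := `[< exists v, b i v /\
  forall i', ss (st m) <= i' < ss (st m.+1) -> b i' v = ev y 1%g i' >].

Let read_lc m i : locally_constant ((read m)^~ i).
Proof.
move=> y; apply: filterS (ev_near [seq (1%g, i) | i <- iota 0 (ss (st m.+1))] y).
move=> y' h; apply: asbool_equiv_eq.
have h' i' : i' < ss (st m.+1) -> ev y' 1%g i' = ev y 1%g i'.
  by move=> hi; apply: (h (1%g, i')); apply: map_f; rewrite mem_iota.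
split=> -[v [bv hv]]; exists v; split => // i' /[dup] hi' /andP[_ lt].
  by rewrite hv// h'.
by rewrite hv// -h'.
Qed.

(** [good_decode] gives a point whose symbols from [ss (st m)] on are those of [y]; it shares a tail
    with [x], hence equals [x]. By [next_det] any [v] with the same block has the same low
    symbols. *)
Let read_decode m x y s : (forall j, m <= j -> good a E st dt j (ev y)) ->
  (forall i, s <= i -> ev y 1%g i = b i x) ->
  forall i, i < ss (st m) -> read m y i = b i x.
Proof.
move=> gm tail i im.
have [x' hx'] := good_decode aX bcoded E1 inv_st next_st gm.
have h i' : ss (st m) <= i' -> ev y 1%g i' = b i' x'.
  move=> mi'.
  have ex : exists j, (m <= j) && (i' < ss (st j.+1)).
    exists (maxn m i'); rewrite leq_maxl.
    by apply: leq_trans (ss_ge next_st _); rewrite ltnS leq_maxr.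
  (* The least such [j] is the step whose block contains [i']. *)
  have [j /andP[mj ij] jmin] := ex_minnP ex.
  have [_ -> // _] := hx' j mj.
  apply: (approx_block aX next_st).
  have [->//|nj] := eqVneq j m.
  have /prednK jE : 0 < j by lia.
  rewrite leqNgt; apply/negP => lt; have := jmin j.-1.
  rewrite jE lt andbT; lia.
have xx' : x = x'.
  apply: (@b_tail _ _ (maxn s (ss (st m)))) => i'; rewrite geq_max => /andP[si mi].
  by rewrite -tail// h.
apply/asboolP/idP => [[v [bv hv]]|bx]; last first.
  by exists x; split => // i' /andP[mi' _]; rewrite h// xx'.
have [|_ _ /(_ i im) <- //] := next_det (next_st m) (v := v) (v' := x).
by move=> i' hi'; rewrite hv// h ?xx'//; case/andP: hi'.
Qed.

Lemma borel_star : borel_star_isomorphic R a sigma.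
Proof.
have [Phi [Phi0 hPhi]] := exists_Phi.
have mXE : measurable XE by exact: orbit_eventually_not_measurable.
have mYE : measurable YE by exact: orbit_eventually_not_measurable.
have XE1 (mu : PG R a) : PG_measure mu XE = 1%E.
  exact: orbit_eventually_not_full.
have YE1 (nu : PG R sigma) : PG_measure nu YE = 1%E.
  exact: orbit_eventually_not_full.
have XEa g x : XE x -> XE (a g x) by exact: orbit_eventually_not_action.
have YEa g y : YE y -> YE (sigma g y) by exact: orbit_eventually_not_action.
have PhiE x g : XE x -> exists j0, forall j i, j0 <= j ->
    ev (Phi x) g i = approx a st j x g i.
  move=> xE; have [j0 h] := XE_unhit xE g; exists j0 => j i jj.
  exact: (hPhi _ xE g j0).
have Phi_tail x : XE x -> exists s, forall i, s <= i -> ev (Phi x) 1%g i = b i x.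
  move=> xE; have [j0 h] := PhiE x 1%g xE; exists (ss (st j0)) => i hi.
  by rewrite (h j0)// (approx_tail aX inv_st).
have Phi_inj x x' : XE x -> XE x' -> Phi x = Phi x' -> x = x'.
  move=> xE xE' eq; have [s h] := Phi_tail _ xE; have [s' h'] := Phi_tail _ xE'.
  apply: (@b_tail _ _ (maxn s s')) => i; rewrite geq_max => /andP[si s'i].
  by rewrite -h// -h'// eq.
have Phi_eq g x : XE x -> Phi (a g x) = sigma g (Phi x).
  move=> xE; apply: ev_inj; apply/funext => p; apply/funext => i.
  have [j1 h1] := PhiE _ p (XEa g _ xE); have [j2 h2] := PhiE _ (p * g)%g xE.
  rewrite (h1 (maxn j1 j2)) ?leq_maxl// ev_shift /shift (h2 (maxn j1 j2)) ?leq_maxr//.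
  by rewrite -(approx_shift aX inv_st).
have Phi_surj y : YE y -> exists2 x, XE x & Phi x = y.
  move=> yE; have [x [ux hx]] :=
    eventually_good_decode aX bcoded E1 Eev inv_st next_st (YE_good yE).
  have xE := unhit_XE ux; exists x => //.
  apply: ev_inj; apply/funext => g; apply/funext => i.
  have [j1 h1] := hx g; have [j2 h2] := PhiE _ g xE.
  pose j := maxn (maxn j1 j2) i.
  have jj1 : j1 <= j by rewrite /j !leq_max leqnn.
  have jj2 : j2 <= j by rewrite /j !leq_max leqnn orbT.
  have ij : i <= j by rewrite leq_maxr.
  rewrite (h2 j.+1) ?(leq_trans jj2)// (h1 j)//.
  by apply: leq_trans (ss_ge next_st j.+1); rewrite ltnS.
have mconst (S : ptopologicalType) (D : set (borel S)) (p : bool) : measurable D ->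
    measurable (D `&` [set _ | p]).
  by move=> mD; apply: measurableI => //; case: p; rewrite ?set_true ?set_false.
have mPhi : measurable_fun setT Phi.
  apply: (coded_measurable_fun cod) => // n; rewrite setTI.
  pose g := (idx n).1; pose i := (idx n).2.
  (* On [XE] the symbol is the eventual value of [approx j x g i], so it is true exactly when [x]
     leaves the sets [B j] for good. *)
  pose B j : set (borel X) := [set x | ~~ approx a st j x g i].
  have mB j : measurable (B j).
    exact: (lc_borel (fun v : bool => ~~ v) (approx_lc inv_st j g i)).
  have -> : [set x | c n (Phi x)] = (XE `&` eventually_not B) `|`
      (~` XE `&` [set _ | c n point]).
    apply/seteqP; split => x.
      move=> h; have [xE|nx] := pselect (XE x); last by right; rewrite -(Phi0 _ nx).
      left; split => //; have [j0 hj] := PhiE x g xE; exists j0 => j jj.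
      by rewrite /B /= -hj// => /negP; apply.
    move=> [[xE [j0 hj]]|[nx]]; last by rewrite /= -(Phi0 _ nx).
    have [j1 hj1] := PhiE x g xE; rewrite /= /c -/g -/i (hj1 (maxn j0 j1)) ?leq_maxr//.
    by apply/negPn/negP; apply: hj; rewrite leq_maxl.
  apply: measurableU; last by apply: mconst; exact: measurableC.
  by apply: measurableI => //; exact: eventually_not_measurable.
have /choice[Psi hPsi] : forall y, exists x, (~ YE y -> x = point) /\
    (YE y -> XE x /\ Phi x = y).
  move=> y; have [yE|?] := pselect (YE y); last by exists point.
  by have [x xE xy] := Phi_surj y yE; exists x.
have YPsi y : YE y -> XE (Psi y) by move=> /(hPsi y).2[].
have PsiK y : YE y -> Phi (Psi y) = y by move=> /(hPsi y).2[].
have readE m y : YE y -> (forall j, m <= j -> ~ badB j y) ->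
    forall i, i < ss (st m) -> read m y i = b i (Psi y).
  move=> yE nb; have [s h] := Phi_tail _ (YPsi _ yE).
  apply: (@read_decode _ _ _ s) => [j mj|i si]; last by rewrite -h// PsiK.
  by apply: contrapT => ng; apply: (nb j).
have mPsi : measurable_fun setT (Psi : borel Y -> borel X).
  apply: (coded_measurable_fun bcod) => // i; rewrite setTI.
  pose B j : set (borel Y) := [set y | ~~ read j y i].
  have mB j : measurable (B j).
    exact: (lc_borel (fun v : bool => ~~ v) (@read_lc j i)).
  have readE' y : YE y -> exists m, forall j, m <= j -> read j y i = b i (Psi y).
    move=> yE; have := yE 1%g I; rewrite /preimage /= (action1 aY) => -[j0 nb].
    exists (maxn j0 i.+1) => j; rewrite geq_max => /andP[jj ij].
    apply: readE => //; first by move=> j' jj'; apply: nb; exact: leq_trans jj'.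
    by apply: leq_trans ij (ss_ge next_st j).
  have -> : [set y | b i (Psi y)] = (YE `&` eventually_not B) `|`
      (~` YE `&` [set _ | b i point]).
    apply/seteqP; split => y.
      move=> h; have [yE|ny] := pselect (YE y); last by right; rewrite -((hPsi y).1 ny).
      left; split => //; have [j0 hj] := readE' y yE; exists j0 => j jj.
      by rewrite /B /= hj// => /negP; apply.
    move=> [[yE [j0 hj]]|[ny]]; last by rewrite /= -((hPsi y).1 ny).
    have [j1 hj1] := readE' y yE; rewrite /= -(hj1 (maxn j0 j1)) ?leq_maxr//.
    by apply/negPn/negP; apply: hj; rewrite leq_maxl.
  apply: measurableU; last by apply: mconst; exact: measurableC.
  by apply: measurableI => //; exact: eventually_not_measurable.
(* [Phi] may send a point of [XE] outside [YE]. Such points are null: the image of an invariant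
   measure is invariant and so gives [YE] mass 1. *)
pose D : set (borel X) := XE `&` Phi @^-1` YE.
have mD : measurable D.
  by apply: measurableI => //; exact: preimage_measurable.
have D1 (mu : PG R a) : PG_measure mu D = 1%E.
  have [F hF] := transport_measure aX aY mXE XE1 mPhi
    (fun g x xE => conj (XEa g x xE) (Phi_eq g x xE)) (fun=> set0).
  rewrite -(YE1 (F mu)) (hF mu).1//; apply: (measure_eq_on_full mXE (XE1 mu)) => //.
    exact: preimage_measurable.
  by move=> x xE; split => [[]|].
have late_small (S : ptopologicalType) (mu : probability (borel S) R) (D' L : set (borel S)) d :
    measurable D' -> mu D' = 1%E -> measurable L -> (mu L <= d)%E ->
    (mu (~` D' `|` L) <= d)%E.
  move=> mD' D'1 mL; rewrite (measure_eq_on_full mD' D'1 (B := L))//.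
    by apply: measurableU => //; exact: measurableC.
  by move=> x Dx; split => [[]|] //; right.
apply: (@borel_star_criterion _ _ cG iG _ _ _ _ aX aY _ _ bcod cod
  D YE mD mYE D1 YE1 Phi Psi mPhi mPsi).
- by move=> x [].
- by move=> y yE; split; [exact: YPsi|rewrite /preimage /= PsiK].
- by move=> x [xE yE]; apply: Phi_inj => //; [exact: YPsi|exact: PsiK].
- exact: PsiK.
- by move=> g x [xE yE]; split; [exact: XEa|rewrite /preimage /= Phi_eq//; exact: YEa].
- by move=> g x [xE _]; exact: Phi_eq.
- move=> n e e0.
  (* The [n] translates below have measure less than [e / n.+1] each; the successor covers
     [n = 0]. *)
  have [m hm] := small_power (divr_gt0 e0 (ltr0Sn R n)).
  pose L k : set (borel X) := a (idx k).1 @^-1` late hitsB m.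
  have mL k : measurable (L k).
    by apply: action_measurable => //; exact: late_measurable.
  have mU : measurable (\big[setU/set0]_(k < n) L k) by exact: bigsetU_measurable.
  exists (fun x k => approx a st m x (idx k).1 (idx k).2),
    (~` D `|` \big[setU/set0]_(k < n) L k); split.
  + by apply: measurableU => //; exact: measurableC.
  + by move=> i; exact: approx_lc.
  + move=> x /not_orP[/contrapT[xE _] nL] i lin.
    apply: (hPhi _ xE _ m) => // j mj hj; apply: nL.
    rewrite -bigcup_mkord; exists i => //; exists (j - m) => //.
    by rewrite subnKC.
  + move=> mu; apply: (late_small _ _ D) => //.
    apply: le_trans (le_mu_bigsetU _ _) _ => //.
    apply: (@le_trans _ _ (\sum_(k < n) (e / n.+1%:R)%:E)%E).
      apply: lee_sum => k _.
      have eq : PG_measure mu (L k) = PG_measure mu (late hitsB m).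
        exact: (invariant_preimage aX (set_valP mu) _ (late_measurable hits_measurable m)).
      apply: le_trans (_ : PG_measure mu (L k) <= _)%E (le_trans (XE_bound mu m) _).
        by rewrite eq.
      by rewrite lee_fin ltW// hm.
    rewrite sumEFin lee_fin sumr_const card_ord -[_ *+ n]mulr_natr -mulrA mulrC.
    have n1 : (n.+1%:R^-1 * n%:R <= 1 :> R)%R.
      by rewrite mulrC ler_pdivrMr ?ltr0n// mul1r ler_nat.
    by rewrite -[leRHS]mul1r; apply: ler_wpM2r => //; exact: ltW.
(* Taking [m'] at least [n] puts the first [n] symbols below [ss (st m')], where [read m'] decodes
   them. *)
- move=> n e e0; have [m hm] := small_power e0; pose m' := maxn m n.
  exists (read m'), (~` YE `|` late badB m'); split.
  + by apply: measurableU; [exact: measurableC|exact: late_measurable].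
  + by move=> i; exact: read_lc.
  + move=> y /not_orP[/contrapT yE nL] i lin; rewrite readE//.
      by move=> j mj hj; apply: nL; exists (j - m') => //; rewrite subnKC.
    by apply: leq_trans lin (leq_trans (leq_maxr m n) (ss_ge next_st m')).
  + move=> nu; apply: (late_small _ _ YE) => //; first exact: late_measurable.
    by apply: le_trans (YE_bound nu m') _; rewrite lee_fin ltW// hm// leq_maxl.
- by move=> x g _; exact: fX.
Qed.

End assembly.

Theorem theorem1p2 (R : realType) (G : groupType)
  (cG : countable [set: G]) (iG : infinite_set [set: G])
  (amG : amenable R G)
  (X : ptopologicalType)
  (cX : compact [set: X]) (mX : metrizable R X) (zX : zero_dimensional X)
  (a : G -> X -> X) (aX : is_action a) (fX : free_action a) :
  exists (Y : ptopologicalType) (b : G -> Y -> Y),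
    [/\ compact [set: Y], metrizable R Y & zero_dimensional Y] /\
    [/\ is_action b, minimal_action b & borel_star_isomorphic R a b].
Proof.
have [b bcoded] := exists_code cX mX zX.
have [E [E1 Eev]] := exists_exhaustion cG.
have [pat pat_onto] := exists_patterns cG.
have [st [dt [st0 inv_st next_st]]] :=
  exists_sequence cG iG amG cX zX aX fX bcoded E pat.
have [Y [ev [sigma [Ytop sigma_act sigma_min [ev_inj evP ev_surj ev_lc ev_shift] [idx cod]]]]] :=
  exists_model R aX cG st0 inv_st next_st pat_onto.
exists Y, sigma; split => //; split => //.
exact: (borel_star R cG iG aX fX bcoded E1 Eev inv_st next_st sigma_act ev_inj evP
  ev_surj ev_lc ev_shift cod).
Qed.
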